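(* Let $s\in(0,1)$. For $j\in\{1,2\}$ let $(M_j,g_j)$ be closed, connected, $C^4$-regular Riemannian manifolds of dimension $n\ge2$. Let $(O_1,g_1)\subset(M_1,g_1)$ and $(O_2,g_2)\subset(M_2,g_2)$ be open, non-empty sets such that $O_1=O_2=:O$. Let $\bar L^1_{s,O},\bar L^2_{s,O}$ be the source-to-solution operators (defined in the context) associated with the metrics $g_1,g_2$, and assume that $\bar L^1_{s,O}=\bar L^2_{s,O}$. Then $g_1|_O=g_2|_O$.
   Context: For a closed Riemannian manifold $(M,g)$, $dV_g$ is the volume form, $-\Delta_g$ the Laplace--Beltrami operator with eigenvalues $0=\lambda_0<\lambda_1\le\lambda_2\le\dots$ and $L^2(M,dV_g)$-orthonormal eigenfunctions $(\phi_k)_{k\ge0}$, and $(-\Delta_g)^su:=\sum_{k\ge1}\lambda_k^s(u,\phi_k)_{L^2(M,dV_g)}\phi_k$ for $s\in(0,1)$. Source-to-solution operator: for $f\in C_c^\infty(O)$ with $\int_M\frac{1}{\sqrt{\det(g)}}f\,dV_g=0$, $\bar L_{s,O}(f):=u^f|_O$, where $u^f$ is the solution of $\sqrt{\det(g)}(-\Delta_g)^su^f=f$ in $M$ with $(u^f,1)_{L^2(M,dV_g)}=0$. Coordinate convention: $\det(g)$ is the determinant of the matrix of $g$ in fixed local coordinates on $O$, the same for both metrics (the condition on $f$ then reads $\int f\,dx=0$ and does not depend on $g$). If $O$ is not covered by a single chart, $f$ is understood as the coefficient function of a density $f\,dx$, so that the equation is independent of the choice of chart. $O_1=O_2$ means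 that the two sets are identified as manifolds, with the same coordinates. *)

(* Defs.v *)
From HB Require Import structures.
From mathcomp Require Import all_boot all_order all_algebra.
From mathcomp Require Import all_classical all_reals all_analysis.

Set Implicit Arguments.
Unset Strict Implicit.
Unset Printing Implicit Defensive.

Import Order.TTheory GRing.Theory Num.Theory.
Import numFieldNormedType.Exports.

Local Open Scope classical_set_scope.
Local Open Scope ring_scope.

Definition partial {R : realType} {n : nat} (i : 'I_n) (f : 'rV[R]_n -> R) :
  'rV[R]_n -> R := fun y => 'D_(delta_mx 0 i) f y.

(* C^k functions on an open set U: the partial derivatives of order at most k
   exist at the points of U, and those of order k are continuous there. *)
Fixpoint Ck {R : realType} {n : nat} (k : nat) (U : set 'rV[R]_n)
    (f : 'rV[R]_n -> R) : Prop :=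
  match k with
  | 0 => forall y, U y -> {for y, continuous f}
  | k'.+1 => forall i : 'I_n,
      (forall y, U y -> derivable f y (delta_mx 0 i)) /\ Ck k' U (partial i f)
  end.

(* A chart is given by the inverse of its coordinate map: [par] maps the open
   set [dom] of R^n onto an open set of T.  The values of [par] outside [dom]
   carry no information. *)
Record chart (R : realType) (n : nat) (T : Type) := Chart {
  dom : set 'rV[R]_n;
  par :> 'rV[R]_n -> T }.

Definition is_chart {R : realType} {n : nat} {T : topologicalType}
    (p : chart R n T) : Prop :=
  [/\ open (dom p),
      forall y z, dom p y -> dom p z -> p y = p z -> y = z,
      forall y, dom p y -> {for y, continuous p} &
      forall V, open V -> V `<=` dom p -> open (p @` V)].

(* The change of coordinates from p to q, defined on [overlap p q]. *)
Definition overlap {R : realType} {n : nat} {T : Type} (p q : chart R n T) :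
  set 'rV[R]_n := [set y | dom p y /\ (q @` dom q) (p y)].

Definition transition {R : realType} {n : nat} {T : Type} (p q : chart R n T)
  (y : 'rV[R]_n) : 'rV[R]_n := xget 0 [set z | dom q z /\ q z = p y].

Definition smooth_transition {R : realType} {n : nat} {T : Type}
    (p q : chart R n T) : Prop :=
  forall (k : nat) (j : 'I_n), Ck k (overlap p q) (fun y => transition p q y 0 j).

(* Smooth manifolds without boundary, with their maximal atlas.  The carrier is
   pointed because the measure theory library requires it; thus manifolds are
   nonempty, and the base point plays no other role. *)
Record manifold (R : realType) (n : nat) := Manifold {
  carrier :> ptopologicalType;
  atlas : set (chart R n carrier);
  manifold_hausdorff : hausdorff_space carrier;
  manifold_second_countable : @second_countable carrier;
  atlas_chart : forall p, atlas p -> is_chart p;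
  atlas_cover : forall x : carrier, exists2 p, atlas p & (p @` dom p) x;
  atlas_smooth : forall p q, atlas p -> atlas q -> smooth_transition p q;
  atlas_maximal : forall q, is_chart q ->
    (forall p, atlas p -> smooth_transition p q /\ smooth_transition q p) ->
    atlas q }.

Definition push {R : realType} {n : nat} {T U : Type} (i : T -> U)
  (p : chart R n T) : chart R n U := Chart (dom p) (i \o p).

(* i identifies the manifold O with the open subset U of M: since i is
   injective and sends charts of O to charts of M, it is a diffeomorphism from
   O onto U. *)
Definition identifies {R : realType} {n : nat} {O M : manifold R n}
    (i : O -> M) (U : set M) : Prop :=
  [/\ injective i, range i = U &
      forall p, atlas (m := O) p -> atlas (m := M) (push i p)].

(* A Riemannian metric of class C^k, as the family of its matrices in the charts
   of M.  The Jacobian 'J f y acts on row vectors from the right: its (i, j)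
   entry is the i-th partial derivative of the j-th component of f. *)
Record metric (R : realType) (n : nat) (k : nat) (M : manifold R n) := Metric {
  gmat :> chart R n M -> 'rV[R]_n -> 'M[R]_n;
  gmat_Ck : forall p, atlas p -> forall a b, Ck k (dom p) (fun y => gmat p y a b);
  gmat_sym : forall p, atlas p -> forall y, dom p y -> (gmat p y)^T = gmat p y;
  gmat_pos : forall p, atlas p -> forall y, dom p y ->
    forall v : 'rV[R]_n, v != 0 -> 0 < (v *m gmat p y *m v^T) 0 0;
  gmat_transition : forall p q, atlas p -> atlas q ->
    forall y, overlap p q y ->
    let J := 'J (transition p q) y in
    gmat p y = J *m gmat q (transition p q y) *m J^T }.

Definition restrict_metric {R : realType} {n k : nat} {O M : manifold R n}
  (i : O -> M) (g : metric k M) (p : chart R n O) : 'rV[R]_n -> 'M[R]_n :=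
  g (push i p).

Definition sqrtdet {R : realType} {n k : nat} {M : manifold R n}
  (g : metric k M) (p : chart R n M) (y : 'rV[R]_n) : R :=
  Num.sqrt (\det (g p y)).

(* The integral over R^n of a nonnegative Borel function, as an iterated
   integral (Tonelli). *)
Fixpoint lebesgue_integral_rV {R : realType} (n : nat) :
    ('rV[R]_n -> \bar R) -> \bar R :=
  match n with
  | 0 => fun F => F 0
  | n'.+1 => fun F => (\int[lebesgue_measure]_t
      lebesgue_integral_rV (fun y : 'rV[R]_n' =>
        F (row_mx (t%:M : 'rV[R]_1) y)))%E
  end.

Notation borel M := (g_sigma_algebraType (@open M)).
Notation borel_measure R M := {measure set (borel M) -> \bar R}.

(* mu is the Borel measure dV_g, which is sqrt(det g) dx in every chart. *)
Definition is_volume {R : realType} {n k : nat} {M : manifold R n}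
    (g : metric k M) (mu : borel_measure R M) : Prop :=
  forall p, atlas p -> forall A : set (borel M), measurable A ->
  A `<=` p @` dom p ->
  mu A = lebesgue_integral_rV (fun y =>
    (\1_[set z | dom p z /\ A (p z)] y * sqrtdet g p y)%:E).

Definition L2 {R : realType} {n : nat} {M : manifold R n}
  (mu : borel_measure R M) (u : M -> R) : Prop :=
  (u : borel M -> R) \in Lfun mu 2%:E.

Definition inner {R : realType} {n : nat} {M : manifold R n}
  (mu : borel_measure R M) (u v : M -> R) : R :=
  \int[mu]_x (u x * v x).

(* The Laplace-Beltrami operator in the chart p, applied to a function v of the
   coordinates. *)
Definition laplace_beltrami {R : realType} {n k : nat} {M : manifold R n}
    (g : metric k M) (p : chart R n M) (v : 'rV[R]_n -> R) (y : 'rV[R]_n) : R :=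
  (sqrtdet g p y)^-1 *
  \sum_(a < n) partial a (fun z =>
    sqrtdet g p z * \sum_(b < n) invmx (g p z) a b * partial b v z) y.

Definition eigenfunction {R : realType} {n k : nat} {M : manifold R n}
    (g : metric k M) (lambda : R) (phi : M -> R) : Prop :=
  forall p, atlas p -> Ck 2 (dom p) (phi \o p) /\
    forall y, dom p y ->
      - laplace_beltrami g p (phi \o p) y = lambda * phi (p y).

Definition is_spectrum {R : realType} {n k : nat} {M : manifold R n}
    (g : metric k M) (mu : borel_measure R M)
    (lambda : nat -> R) (phi : nat -> M -> R) : Prop :=
  [/\ [/\ lambda 0%N = 0, 0 < lambda 1%N &
          forall j, (1 <= j)%N -> lambda j <= lambda j.+1],
      forall j, eigenfunction g (lambda j) (phi j),
      forall j l, inner mu (phi j) (phi l) = (j == l)%:R &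
      forall u, L2 mu u -> (forall j, inner mu u (phi j) = 0) ->
        {ae mu, forall x, u x = 0}].

(* w is (-Delta_g)^s u, i.e. the L^2 sum of the spectral series. *)
Definition is_fractional_laplacian {R : realType} {n : nat} {M : manifold R n}
    (mu : borel_measure R M) (lambda : nat -> R) (phi : nat -> M -> R)
    (s : R) (u w : M -> R) : Prop :=
  [/\ L2 mu u, L2 mu w &
      Lnorm mu 2%:E (fun x => (w x - \sum_(1 <= j < N)
        (lambda j `^ s) * inner mu u (phi j) * phi j x)%:E) @[N --> \oo]
      --> 0%E].

(* f is a smooth compactly supported density on O, given by its coefficient
   function in each chart. *)
Definition Cc_density {R : realType} {n : nat} {O : manifold R n}
    (f : chart R n O -> 'rV[R]_n -> R) : Prop :=
  [/\ forall p, atlas p -> forall k, Ck k (dom p) (f p),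
      forall p q, atlas p -> atlas q -> forall y, overlap p q y ->
        f p y = `|\det ('J (transition p q) y)| * f q (transition p q y) &
      exists2 K : set O, compact K &
        forall p, atlas p -> forall y, dom p y -> ~ K (p y) -> f p y = 0].

(* sqrt(det g) w = f in M, where f is extended by zero outside O. *)
Definition sqrtdet_mul_eq {R : realType} {n k : nat} {O M : manifold R n}
    (g : metric k M) (i : O -> M) (w : M -> R)
    (f : chart R n O -> 'rV[R]_n -> R) : Prop :=
  (forall p, atlas p -> forall y, dom p y ->
     sqrtdet g (push i p) y * w (i (p y)) = f p y) /\
  (forall x, ~ range i x -> w x = 0).

(* The graph of the source-to-solution operator.  The function h is
   f / sqrt(det g).  An element of L^2 is represented by the set of its Borel
   representatives, so f is related to all the Borel functions on O that are
   equal to u^f almost everywhere. *)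
Definition source_to_solution {R : realType} {n k : nat} {O M : manifold R n}
    (g : metric k M) (mu : borel_measure R M)
    (lambda : nat -> R) (phi : nat -> M -> R) (s : R) (i : O -> M) :
    set ((chart R n O -> 'rV[R]_n -> R) * (O -> R)) :=
  [set fv | [/\ Cc_density fv.1,
    exists2 h, sqrtdet_mul_eq g i h fv.1 & inner mu h (fun=> 1) = 0 &
    exists u, [/\ exists2 w, is_fractional_laplacian mu lambda phi s u w &
                              sqrtdet_mul_eq g i w fv.1,
                  inner mu u (fun=> 1) = 0 &
                  fv.2 = u \o i]]].

(* Main.v *)
Require Import Defs.
From HB Require Import structures.
From mathcomp Require Import all_boot all_order all_algebra.
From mathcomp Require Import all_classical all_reals all_analysis.
From mathcomp Require Import measurable_realfun.
From mathcomp Require Import ring lra.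

Import Order.TTheory GRing.Theory Num.Theory.
Import numFieldNormedType.Exports.
Set Implicit Arguments.
Unset Strict Implicit.
Unset Printing Implicit Defensive.

Local Open Scope classical_set_scope.
Local Open Scope ring_scope.

(** The source-to-solution operator determines the energies Q(f), the integrals of
   f u^f dx over O. The metric is read off from their growth for sources that
   oscillate faster and faster near a point.

   With h = f / sqrt(det g) and coefficients h_k in the basis of eigenfunctions,
   Q(f) is the sum of the lambda_k^(-s) h_k^2. If f is close to
   chi(y) cos(tau xi.y + w), where chi is a bump at c, one expects the operator
   (-Delta)^(-s) to act as the multiplication by (tau^2 a)^(-s), a being the squared
   norm of the covector xi for g at c, so that tau^(2s) Q(f) tends to
   a^(-s) / sqrt(det g)(c) times the integral of chi^2 cos^2. No pseudodifferential
   calculus is needed to prove this. The quasimode v, an explicit multiple of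
   chi cos(tau xi.y + w), satisfies - Delta v = tau^2 h + O(tau) by a computation in
   coordinates, so h_k is close to tau^(-2) lambda_k v_k and Q(f) to
   tau^(-4) times the sum of the lambda_k^(2-s) v_k^2. By convexity lambda^(2-s) lies
   between a combination of lambda and 1 and a combination of lambda and lambda^2,
   both sharp at lambda = tau^2 a (powR_lower, powR_upper). The corresponding
   sums are, by Parseval, the integrals of v^2, of - v Delta v and of (Delta v)^2,
   which are computed in the chart (fractional_form_lower, fractional_form_upper,
   energy_bounds). Adding the energies for two phases w that differ by pi/2
   replaces cos^2 by 1 (energy_asymptotics).

   Both metrics have the same energies, so a^(-s) / sqrt(det g) is the same for both
   at all points of O and for all xi. The inverse metrics are then proportional, with
   a factor k such that k^(2s) = k^n by comparing determinants; since 2s < 2 <= n,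
   k = 1 (metric_of_symbol).

   Three points need care. The test sources are derivatives, so that they have
   integral zero, and a solution u^f is produced from square-summable coefficients by
   the completeness of L^2 (riesz_fischer); this requires that a function of mean zero
   be orthogonal to the first eigenfunction, which holds because the others have
   mean zero (eigenfunction_mean). The Laplacian is only ever integrated by parts
   against functions supported in a single chart (green). And a source given in
   one chart is a density in all the charts of O, by the transformation law of the
   volume density (Cc_density_density). *)

(** * Lebesgue measure on R^n *)

Section borel_rV.
Variable R : realType.

Lemma finType_bigcap_measurable d (T : measurableType d) (I : finType)
    (F : I -> set T) : (forall i, measurable (F i)) -> measurable (\bigcap_i F i).
Proof.
move=> mF; rewrite (_ : [set: I] = [set` predT]); last by apply/seteqP; split.
by apply: fin_bigcap_measurable.
Qed.

Lemma borel_open (T : ptopologicalType) (U : set (borel T)) :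
  @open T U -> measurable U.
Proof. by move=> oU; apply: sub_sigma_algebra. Qed.

Lemma open_continuous_borel (T U : ptopologicalType) (D : set T) (f : T -> U) :
  open D -> (forall x, D x -> {for x, continuous f}) ->
  measurable_fun (D : set (borel T)) (f : borel T -> borel U).
Proof.
move=> oD cf; apply: (@measurability _ _ (borel T) (borel U) D f (@open U) erefl) => _ [V oV <-].
apply: borel_open; rewrite openE => x [Dx Vx]; rewrite /interior.
apply: filterI; first exact: open_nbhs_nbhs.
by apply: (cf x Dx); apply: open_nbhs_nbhs.
Qed.

Lemma open_continuous_measurable (T : ptopologicalType) (D : set T) (f : T -> R) :
  open D -> (forall x, D x -> {for x, continuous f}) ->
  measurable_fun (D : set (borel T)) (f : borel T -> R).
Proof.
move=> oD cf; apply: (measurability _ (measurable_realfun.RGenOpens.measurableE R)).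
move=> _ [_ [a [b ->]] <-].
apply: borel_open; rewrite openE => x [Dx Vx]; rewrite /interior.
apply: filterI; first exact: open_nbhs_nbhs.
apply: (cf x Dx); apply: open_nbhs_nbhs; split => //; exact: interval_open.
Qed.

Lemma continuous_borel (T : ptopologicalType) (f : T -> R) : continuous f ->
  measurable_fun setT (f : borel T -> R).
Proof.
move=> cf; apply: (@open_continuous_measurable _ setT); first exact: openT.
by move=> x _; exact: cf.
Qed.

Lemma measurable_coord n (i : 'I_n) :
  measurable_fun setT (fun y : borel 'rV[R]_n => y 0 i : R).
Proof.
exact: (continuous_borel (@coord_continuous _ _ _ 0 i)).
Qed.

Lemma rV_ballE n (c : 'rV[R]_n) (r : R) (y : 'rV[R]_n) :
  ball c r y <-> 0 < r /\ forall i, `|c 0 i - y 0 i| < r.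
Proof.
rewrite -ball_normE /ball_ /=; split=> [h|[r0 h]].
  have r0 : 0 < r by apply: le_lt_trans h.
  split=> // i; apply: le_lt_trans h.
  rewrite [leRHS]/Num.norm /= mx_normrE; apply/bigmax_geP; right => /=.
  by exists (0, i) => //; rewrite !mxE.
rewrite [ltLHS]/Num.norm /= mx_normrE; apply/bigmax_ltP; split => // -[a i] _ /=.
by rewrite !mxE ord1.
Qed.

Lemma coord_ler_norm n (y : 'rV[R]_n) i : `|y 0 i| <= `|y|.
Proof.
rewrite [leRHS]/Num.norm /= mx_normrE; apply/bigmax_geP; right => /=.
by exists (0, i).
Qed.

Lemma rV_norm_ler n (y : 'rV[R]_n) (r : R) : 0 <= r ->
  (forall i, `|y 0 i| <= r) -> `|y| <= r.
Proof.
move=> r0 h; rewrite [leLHS]/Num.norm /= mx_normrE; apply/bigmax_leP.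
by split => // -[a i] _ /=; rewrite ord1.
Qed.

(** Open sets of R^n are countable unions of cubes with rational centres, so
   Borel measurability into R^n is coordinatewise. *)
Lemma measurable_fun_rV d (T : measurableType d) n (D : set T)
    (g : T -> borel 'rV[R]_n) : measurable D ->
  (forall i, measurable_fun D (fun x => g x 0 i : R)) -> measurable_fun D g.
Proof.
move=> mD mg; apply: (@measurability _ _ T (borel 'rV[R]_n) D g (@open 'rV[R]_n) erefl) => _ [U oU <-].
pose c (q : 'rV[rat]_n) : 'rV[R]_n := map_mx ratr q.
pose I := [set p : 'rV[rat]_n * nat | ball (c p.1) p.2.+1%:R^-1 `<=` U].
have -> : D `&` g @^-1` U =
    \bigcup_(p in I) (D `&` g @^-1` (ball (c p.1) p.2.+1%:R^-1)).
  rewrite -setI_bigcupr; congr (_ `&` _); apply/seteqP; split=> [x Ux|x [p Ip px]]; last first.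
    exact: (Ip _ px).
  have /nbhs_ballP[e /= e0 eU] : nbhs (g x) U by exact: open_nbhs_nbhs.
  have [k ke] : exists k : nat, k.+1%:R^-1 < e / 2.
    have e20 : 0 < e / 2 by rewrite divr_gt0.
    by have [k] := ltr_add_invr e20; rewrite add0r => ?; exists k.
  have hq i : exists q : rat, `|g x 0 i - ratr q| < k.+1%:R^-1.
    have : g x 0 i - k.+1%:R^-1 < g x 0 i + k.+1%:R^-1.
      by rewrite ltrBlDr -addrA ltrDl addr_gt0.
    move=> /rat_in_itvoo[q].
    rewrite in_itv /= => /andP[q1 q2]; exists q; rewrite distrC.
    by rewrite ltr_distl q1 q2.
  pose q := \row_i xget 0 [set q : rat | `|g x 0 i - ratr q| < k.+1%:R^-1].
  have qP i : `|g x 0 i - c q 0 i| < k.+1%:R^-1.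
    rewrite !mxE; case: xgetP => [y _ //|H].
    by have [y hy] := hq i; case: (H y).
  exists (q, k) => /=.
    move=> y /rV_ballE[_ hy]; apply: eU; apply/rV_ballE; split=> // i.
    rewrite (splitr e); apply: le_lt_trans (ler_distD (c q 0 i) _ _) _.
    by apply: ltrD; [apply: lt_trans (qP i) ke|apply: lt_trans (hy i) ke].
  by apply/rV_ballE; split=> // i; rewrite distrC.
rewrite bigcup_mkcond; apply: countable_bigcupT_measurable => // -[q k] /=.
case: ifP => // _.
have -> : D `&` g @^-1` ball (c q) k.+1%:R^-1 =
    \bigcap_(i in [set: option 'I_n])
      (if i is Some i then (D `&` (fun x => g x 0 i : R) @^-1`
        `](c q 0 i - k.+1%:R^-1), (c q 0 i + k.+1%:R^-1)[%classic) else D).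
  apply/seteqP; split=> x.
    move=> [Dx] /rV_ballE[_ h] [i|] // _; split=> //=.
    by rewrite in_itv /= -ltr_distl distrC.
  move=> h; split; first exact: (h None).
  apply/rV_ballE; split=> // i; have [_ /=] := h (Some i) Logic.I.
  by rewrite in_itv /= -ltr_distl distrC.
apply: finType_bigcap_measurable.
by case=> [i|//]; apply: mg => //; exact: measurable_itv.
Qed.

End borel_rV.

Section sigma_finite_measure_of.
Context (R : realType) d (T : measurableType d) (m : {measure set T -> \bar R}).

(** An alias of m, to which the proof sm of sigma-finiteness is attached as an
   instance. *)
Definition sf_measure of sigma_finite setT m : set T -> \bar R := m.

Hypothesis sm : sigma_finite setT m.
HB.instance Definition _ := Measure.copy (sf_measure sm) m.
HB.instance Definition _ := Measure_isSigmaFinite.Build _ _ _ (sf_measure sm) sm.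
End sigma_finite_measure_of.

Section lebesgue_rV.
Variable R : realType.
Local Notation LI := lebesgue_integral_rV.
Local Notation mu1 := (@lebesgue_measure R).

Definition push_measure d d' (T1 : measurableType d) (T2 : measurableType d')
    (m : {measure set T1 -> \bar R}) (f : T1 -> T2)
    (mf : measurable_fun setT f) : {measure set T2 -> \bar R} :=
  measure_function_pushforward__canonical__measure_function_Measure m mf.

(** Translations keep the length of intervals, which characterizes the
   measure. *)
Lemma lebesgue_measure_shift (c : R) (A : set R) : measurable A ->
  mu1 ((fun t => t + c) @^-1` A) = mu1 A.
Proof.
move=> mA; have mc : measurable_fun setT (fun t : measurableTypeR R => t + c : measurableTypeR R).
  exact: measurable_funD.
apply/esym; apply: (@lebesgue_measure_unique _ (push_measure lebesgue_measure mc)) => //.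
move=> _ [[a b]] _ <-.
rewrite /= /pushforward.
have -> : (fun t => t + c) @^-1` `]a, b]%classic = `](a - c), (b - c)]%classic.
  by apply/seteqP; split => t /=; rewrite !in_itv /= ltrBlDr lerBrDr.
rewrite !lebesgue_measure_itv /= !lte_fin ltrD2r; case: ifP => // _.
by rewrite -!EFinB opprB addrA subrK.
Qed.

Lemma integral_shift (c : R) (F : R -> \bar R) : measurable_fun [set: R] F ->
  (forall t, 0 <= F t)%E ->
  (\int[mu1]_t F (t + c)%R = \int[mu1]_t F t)%E.
Proof.
move=> mF F0; have mc : measurable_fun setT (fun t : measurableTypeR R => t + c : measurableTypeR R).
  exact: measurable_funD.
have := @ge0_integral_pushforward _ _ _ _ R _ mc lebesgue_measure setT F measurableT mF (fun y _ => F0 y).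
rewrite preimage_setT => <-.
apply: (eq_measure_integral lebesgue_measure) => A mA _.
exact: lebesgue_measure_shift.
Qed.

Lemma row_mx_ord0 n (t : R) (y : 'rV[R]_n) :
  (row_mx (t%:M : 'rV[R]_1) y : 'rV[R]_n.+1) 0 ord0 = t.
Proof.
rewrite (_ : ord0 = lshift n (ord0 : 'I_1)); last exact: val_inj.
by rewrite (@row_mxEl _ 1 1 n) mxE eqxx mulr1n.
Qed.

Lemma row_mx_lift n (t : R) (y : 'rV[R]_n) i :
  (row_mx (t%:M : 'rV[R]_1) y : 'rV[R]_n.+1) 0 (lift ord0 i) = y 0 i.
Proof.
rewrite (_ : lift ord0 i = rshift 1 i); last exact: val_inj.
by rewrite (@row_mxEr _ 1 1 n).
Qed.

Lemma measurable_row_mx n : measurable_fun setT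
  (fun z : R * borel 'rV[R]_n => row_mx (z.1%:M : 'rV[R]_1) z.2 : borel 'rV[R]_n.+1).
Proof.
apply: measurable_fun_rV => // i; case: (unliftP ord0 i) => [j ->|->].
  under eq_fun do rewrite row_mx_lift.
  exact: (measurableT_comp (@measurable_coord R n j)).
under eq_fun do rewrite row_mx_ord0.
exact: measurable_fst.
Qed.

Lemma measurable_row_mxr n (t : R) : measurable_fun setT
  (fun y : borel 'rV[R]_n => row_mx (t%:M : 'rV[R]_1) y : borel 'rV[R]_n.+1).
Proof.
apply: measurable_fun_rV => // i; case: (unliftP ord0 i) => [j ->|->].
  under eq_fun do rewrite row_mx_lift.
  exact: measurable_coord.
under eq_fun do rewrite row_mx_ord0.
exact: measurable_cst.
Qed.

Lemma LI0 n : @LI R n (fun=> 0%E) = 0%E.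
Proof. by elim: n => //= n IH; under eq_integral do rewrite IH; rewrite integral0. Qed.

Definition cube n (r : R) : set 'rV[R]_n := [set y | forall i, `|y 0 i| <= r].

(** Cubes have finite volume, which makes the measure below sigma-finite. *)
Lemma LI_cube n (r : R) : 0 <= r ->
  @LI R n (fun y => (\1_(@cube n r) y)%:E) = ((r *+ 2) ^+ n)%:E.
Proof.
move=> r0; elim: n => [|n IH] /=.
  by rewrite expr0 indicE mem_set // => -[].
transitivity (\int[mu1]_t ((\1_(`[(- r), r]%classic) t)%:E * ((r *+ 2) ^+ n)%:E))%E.
  apply: eq_integral => t _; have [tr|tr] := boolP (`|t| <= r).
    rewrite indicE mem_set; last by rewrite /= in_itv /= -ler_norml.
    rewrite mul1e -IH; congr (LI _); apply/funext => y; congr (_%:E).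
    rewrite !indicE; congr (_%:R); congr nat_of_bool.
    apply/idP/idP; rewrite !inE => h i.
      by have := h (lift ord0 i); rewrite row_mx_lift.
    by case: (unliftP ord0 i) => [j ->|->]; rewrite ?row_mx_lift ?row_mx_ord0.
  rewrite indicE memNset /=; last by rewrite in_itv /= -ler_norml; apply/negP.
  rewrite mul0e -(LI0 n); congr (LI _); apply/funext => y.
  rewrite indicE memNset // => /(_ ord0).
  by rewrite row_mx_ord0; apply/negP.
rewrite ge0_integralZr //=; last 2 first.
- exact/measurable_EFinP.
- by rewrite lee_fin exprn_ge0 // mulrn_wge0.
rewrite integral_indic // setIT.
rewrite [X in (X * _)%E](_ : _ = (r *+ 2)%:E) -?EFinM -?exprS //.
apply: etrans (lebesgue_measure_itv `[(- r), r]) _.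
rewrite /= lte_fin; case: ltP => [_|h]; first by rewrite -EFinB opprK -mulr2n.
have -> : r = 0 by lra.
by rewrite mul0rn.
Qed.

Lemma cubeE n r : @cube n r = \bigcap_i [set y | `|y 0 i| <= r].
Proof. by apply/seteqP; split => y h i; [move=> _|]; exact: h. Qed.

Lemma measurable_cube n r : measurable (@cube n r : set (borel 'rV[R]_n)).
Proof.
rewrite cubeE; apply: finType_bigcap_measurable => i.
have := @measurable_coord R n i measurableT `[(- r), r]%classic
  (measurable_itv _); rewrite setTI; congr measurable.
by apply/seteqP; split => y /=; rewrite in_itv /= ler_norml.
Qed.

(** By induction on n: the image of the product of the measures of R and R^n
   under the map that joins a first coordinate to a row. Tonelli turns its
   integrals into iterated ones. *)
Lemma leb_exists n : exists m : {sigma_finite_measure set (borel 'rV[R]_n) -> \bar R},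
  forall F : borel 'rV[R]_n -> \bar R, measurable_fun [set: borel 'rV[R]_n] F ->
    (forall y, 0 <= F y)%E -> (\int[m]_y F y = LI F)%E.
Proof.
elim: n => [|n [m IH]].
  exists (\d_ (0 : borel 'rV[R]_0)) => F mF F0.
  by rewrite integral_dirac // diracT mul1e.
pose p := (lebesgue_measure \x m)%E.
pose q := push_measure p (@measurable_row_mx n).
have qE F : measurable_fun setT F -> (forall y, 0 <= F y)%E ->
    (\int[q]_y F y = LI F)%E.
  move=> mF F0; rewrite ge0_integral_pushforward //; last exact: measurable_row_mx.
  rewrite preimage_setT.
  rewrite fubini_tonelli1 //; first last.
  - by move=> z /=.
  -  exact: (measurableT_comp mF (@measurable_row_mx n)).
  apply: eq_integral => t _; apply: IH; last by move=> y /=.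
  exact: (measurableT_comp mF (@measurable_row_mxr n t)).
have sq : sigma_finite setT q.
  exists (fun k => cube k%:R).
    apply/seteqP; split => // y _; exists (Num.bound `|y|) => // i.
    exact/ltW/(le_lt_trans (coord_ler_norm y i))/archi_boundP.
  move=> k; split; first exact: measurable_cube.
  rewrite -(setIT (cube _)) -integral_indic //; last exact: measurable_cube.
  rewrite qE ?LI_cube ?ltry //.
  by apply/measurable_EFinP; apply: measurable_indic; exact: measurable_cube.
exists (sf_measure sq); exact: qE.
Qed.

(** Lebesgue measure, characterized by lebE. *)
Definition leb n : {sigma_finite_measure set (borel 'rV[R]_n) -> \bar R} :=
  sval (cid (leb_exists n)).

Lemma lebE n (F : borel 'rV[R]_n -> \bar R) : measurable_fun [set: borel 'rV[R]_n] F ->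
  (forall y, 0 <= F y)%E -> (\int[leb n]_y F y = LI F)%E.
Proof. exact: (svalP (cid (leb_exists n))). Qed.

Lemma measurable_fun_shift n (v : 'rV[R]_n) : measurable_fun setT
  (fun y : borel 'rV[R]_n => y + v : borel 'rV[R]_n).
Proof.
apply: measurable_fun_rV => // i; under eq_fun do rewrite mxE.
by apply: measurable_funD => //; exact: measurable_coord.
Qed.

(** Translating one coordinate at a time reduces to the invariance of the
   one-dimensional measure. *)
Lemma leb_shift n (v : 'rV[R]_n) (F : borel 'rV[R]_n -> \bar R) :
  measurable_fun [set: borel 'rV[R]_n] F -> (forall y, 0 <= F y)%E ->
  (\int[leb n]_y F (y + v)%R = \int[leb n]_y F y)%E.
Proof.
move=> mF F0; rewrite !lebE //; last first.
  exact: (measurableT_comp mF (measurable_fun_shift v)).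
elim: n v F mF F0 => [|n IH] v F mF F0 /=.
  by rewrite (_ : 0 + v = 0) //; apply/rowP => -[].
pose H t := LI (fun y => F (row_mx (t%:M : 'rV[R]_1) y)).
have msec t : measurable_fun setT (fun y : borel 'rV[R]_n => F (row_mx (t%:M : 'rV[R]_1) y)).
  exact: (measurableT_comp mF (@measurable_row_mxr n t)).
have mH : measurable_fun setT H.
  rewrite (_ : H = fubini_F (leb n) (fun z : R * borel 'rV[R]_n => F (row_mx (z.1%:M : 'rV[R]_1) z.2))); last first.
    by apply/funext => t; rewrite /H -lebE.
  apply: measurable_fun_fubini_tonelli_F => //.
  exact: (measurableT_comp mF (@measurable_row_mx n)).
have H0 t : (0 <= H t)%E by rewrite /H -lebE //; apply: integral_ge0.
rewrite -(integral_shift (v 0 0) mH H0).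
pose v' := \row_j v 0 (lift ord0 j).
apply: eq_integral => t _; rewrite /H.
rewrite -(IH v' (fun y => F (row_mx ((t + v 0 0)%:M : 'rV[R]_1) y))) //.
congr (LI _); apply/funext => y; congr (F _); apply/rowP => i; rewrite mxE.
case: (unliftP ord0 i) => [j ->|->]; first by rewrite !row_mx_lift !mxE.
rewrite !row_mx_ord0; congr (t + v _ _); exact: val_inj.
Qed.

End lebesgue_rV.

(** * Functions of class C^k *)

Section Ck_calculus.
Variable R : realType.

(** Restriction to a line reduces partial derivatives to derivatives of
   functions of one variable. *)
Lemma is_derive_line (V : normedModType R) (X : V -> R) (y e : V) (s : R) :
  derivable X (y + s *: e) e ->
  is_derive s 1 (fun t => X (y + t *: e)) ('D_e X (y + s *: e)).
Proof.
move=> dX; have E : (fun h : R => h^-1 *: (((fun t => X (y + t *: e)) \o shift s) (h *: 1)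
     - X (y + s *: e))) =
    (fun h => h^-1 *: ((X \o shift (y + s *: e)) (h *: e) - X (y + s *: e))).
  apply/funext => h /=; congr (_ *: (X _ - _)).
  by rewrite [h *: 1]mulr1 scalerDl addrCA.
by split; rewrite /derivable /derive E.
Qed.

Lemma MVT_line (V : normedModType R) (X : V -> R) (y e : V) (t : R) :
  (forall s : R, `|s| <= `|t| -> derivable X (y + s *: e) e) ->
  exists2 s, `|s| <= `|t| & X (y + t *: e) - X y = t * 'D_e X (y + s *: e).
Proof.
move=> dX; pose f s := X (y + s *: e); pose df (s : R) : R := 'D_e X (y + s *: e).
have fdf (s : R) : `|s| <= `|t| -> is_derive s 1 f (df s).
  by move=> st; apply: is_derive_line; exact: dX.
have cf (a b : R) : (forall s, s \in `[a, b] -> `|s| <= `|t|) ->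
    {within `[a, b], continuous f}.
  move=> ab; apply: continuous_in_subspaceT => s; rewrite inE => /ab st.
  apply/differentiable_continuous/derivable1_diffP.
  by have [] := fdf s st.
have [t0|t0] := leP 0 t.
  have le s : s \in `[0, t] -> `|s| <= `|t|.
    by rewrite in_itv /= => /andP[s0 st]; rewrite !ger0_norm.
  have [|s st] := MVT_segment t0 _ (cf _ _ le) (df := df).
    by move=> s st; apply/fdf/le/subset_itv_oo_cc.
  rewrite /f scale0r addr0 subr0 => ->; exists s; first exact: le.
  by rewrite mulrC.
have le s : s \in `[t, 0] -> `|s| <= `|t|.
  by rewrite in_itv /= => /andP[s0 st]; rewrite !ler0_norm ?lerN2 // ltW.
have [|s st] := MVT_segment (ltW t0) _ (cf _ _ le) (df := df).
  by move=> s st; apply/fdf/le/subset_itv_oo_cc.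
rewrite /f scale0r addr0 sub0r mulrN => E; exists s; first exact: le.
by rewrite mulrC -[RHS]opprK -E opprB.
Qed.

Lemma differentiable_of_expansion (V W : normedModType R) (f : V -> W)
    (df : {linear V -> W}) (y : V) : continuous df ->
  (forall e : R, 0 < e -> \forall h \near (0 : V),
    `|f (h + y) - f y - df h| <= e * `|h|) ->
  differentiable f y /\ 'd f y = df :> (_ -> _).
Proof.
move=> cdf H; have E : f \o shift y = cst (f y) + df +o_ 0 id.
  apply/eqaddoP => e e0; near do rewrite /= fctE opprD addrA.
  exact: H.
have D := diff_unique cdf E.
by split=> //; apply/diff_locallyP; rewrite D.
Unshelve. all: by end_near. Qed.

Lemma is_derive_comp1 (V : normedModType R) (f : V -> R) (Phi : R -> R) (dPhi : R)
    (y v : V) :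
  differentiable f y -> is_derive (f y) 1 Phi dPhi ->
  is_derive y v (fun z => Phi (f z)) (dPhi * 'D_v f y).
Proof.
move=> Df [DPhi E].
have DP : differentiable Phi (f y) by exact/derivable1_diffP.
have DC : differentiable (Phi \o f) y by exact: differentiable_comp.
split; first exact: diff_derivable.
rewrite (_ : (fun z => Phi (f z)) = Phi \o f) // deriveE // diff_comp //=.
rewrite -(deriveE v Df) -{1}['D_v f y]mulr1 -[_ * 1]/(_ *: 1) linearZ /=.
by rewrite -(deriveE (1 : R) DP) E mulrC.
Qed.

Section C1.
Variable n : nat.
Implicit Types (f g : 'rV[R]_n -> R) (y : 'rV[R]_n).
Local Notation e_ i := (delta_mx 0 i : 'rV[R]_n).

(** The differential, as the linear form with the partial derivatives as
   coefficients. *)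
Definition grad f y (v : 'rV[R]_n) : R := \sum_i v 0 i * partial i f y.

Lemma grad_is_linear f y : linear (grad f y).
Proof.
move=> a u v; rewrite /grad scaler_sumr -big_split; apply: eq_bigr => i _ /=.
by rewrite !mxE mulrDl -mulrA.
Qed.
HB.instance Definition _ f y :=
  GRing.isLinear.Build R 'rV[R]_n R _ (grad f y) (grad_is_linear f y).

Lemma grad_continuous f y : continuous (grad f y).
Proof.
apply: continuous_big => [|i _ x]; first exact: add_continuous.
exact: (continuousM (@coord_continuous _ _ _ 0 i x) (@cst_continuous _ _ _ x)).
Qed.

(** Continuous partial derivatives give differentiability: move from y to
   y + h one coordinate at a time and use the mean value theorem on each of
   the n steps. *)
Lemma C1_differentiable f y :
  (forall i, \forall z \near y, derivable f z (e_ i)) ->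
  (forall i, {for y, continuous (partial i f)}) ->
  differentiable f y /\ 'd f y = grad f y :> (_ -> _).
Proof.
move=> df cf; apply: differentiable_of_expansion; first exact: grad_continuous.
move=> _/posnumP[eps].
have eps' : 0 < eps%:num / n.+1%:R by rewrite divr_gt0.
have : \forall z \near y, forall i, derivable f z (e_ i) /\
    `|partial i f z - partial i f y| <= eps%:num / n.+1%:R.
  have := @filter_forall _ 'I_n (fun i z => derivable f z (e_ i) /\
    `|partial i f z - partial i f y| <= eps%:num / n.+1%:R) (nbhs y) _; apply.
  move=> i; near=> z; split; first by near: z; exact: df.
  rewrite distrC; near: z; move: (cf i) => /cvgrPdist_le/(_ _ eps'); exact.
move=> /nbhs_ballP[d /= d0 H].
apply/nbhs_ballP; exists d => // h; rewrite -ball_normE /ball_ /= sub0r normrN => hd.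
pose p (k : nat) := \row_j (y 0 j + (j < k)%N%:R * h 0 j).
have p0 : p 0%N = y by apply/rowP => j; rewrite !mxE mul0r addr0.
have pn : p n = h + y by apply/rowP => j; rewrite !mxE ltn_ord mul1r addrC.
have pS (i : 'I_n) : p i.+1 = p i + h 0 i *: e_ i.
  apply/rowP => j; rewrite !mxE eqxx /= ltnS leq_eqVlt -addrA; congr (_ + _).
  have [->|ji] := eqVneq j i; first by rewrite eqxx ltnn /= mul1r mul0r add0r mulr1.
  by rewrite val_eqE (negbTE ji) /= mulr0 addr0.
have -> : f (h + y) - f y - grad f y h =
    \sum_(i < n) (f (p i.+1) - f (p i) - h 0 i * partial i f y).
  rewrite sumrB /grad; congr (_ - _).
  by rewrite -(big_mkord xpredT (fun i => f (p i.+1) - f (p i))) telescope_sumr // pn p0.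
apply: le_trans (ler_norm_sum _ _ _) _.
apply: (@le_trans _ _ (\sum_(i < n) (`|h| * (eps%:num / n.+1%:R)))); last first.
  rewrite sumr_const card_ord -[leLHS]mulr_natr.
  have -> : `|h| * (eps%:num / n.+1%:R) * n%:R = (eps%:num * `|h|) * (n%:R / n.+1%:R).
    by ring.
  apply: ler_piMr; first by rewrite mulr_ge0.
  by rewrite ler_pdivrMr // mul1r ler_nat.
apply: ler_sum => i _; rewrite pS.
have pb s : `|s| <= `|h 0 i| -> ball y d (p i + s *: e_ i).
  move=> sh; rewrite -ball_normE /ball_ /=; apply: le_lt_trans hd.
  rewrite distrC; apply: rV_norm_ler => // j; rewrite !mxE eqxx /=.
  rewrite [X in `|X|](_ : _ = (j < i)%N%:R * h 0 j + s * (j == i)%:R); last by ring.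
  have [->|ji] := eqVneq j i.
    by rewrite ltnn mul0r add0r mulr1; exact: le_trans sh (coord_ler_norm _ _).
  rewrite mulr0 addr0; case: (_ < _)%N; rewrite ?mul0r ?normr0 // mul1r.
  exact: coord_ler_norm.
have [s sh ->] := MVT_line (X := f) (y := p i) (e := e_ i) (t := h 0 i)
  (fun s hs => (H _ (pb s hs) i).1).
rewrite -mulrBr normrM; apply: ler_pM => //; first exact: coord_ler_norm.
exact: (H _ (pb s sh) i).2.
Unshelve. all: by end_near. Qed.

Variable U : set 'rV[R]_n.
Hypothesis oU : open U.

Let nearU y : U y -> \forall z \near y, U z.
Proof. by move=> Uy; exact: open_nbhs_nbhs. Qed.

Lemma Ck_continuous k f : Ck k U f -> forall y, U y -> {for y, continuous f}.
Proof.
elim: k f => [//|k IH] f Cf y Uy.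
apply: differentiable_continuous.
apply: (C1_differentiable _ _).1 => i.
  by near=> z; apply: (Cf i).1; near: z; exact: nearU.
by apply: IH Uy; exact: (Cf i).2.
Unshelve. all: by end_near. Qed.

Lemma Ck_differentiable k f : Ck k.+1 U f -> forall y, U y -> differentiable f y.
Proof.
move=> Cf y Uy; apply: (C1_differentiable _ _).1 => i.
  by near=> z; apply: (Cf i).1; near: z; exact: nearU.
by apply: (Ck_continuous (Cf i).2).
Unshelve. all: by end_near. Qed.

Lemma Ck_diff k f : Ck k.+1 U f -> forall y, U y -> 'd f y = grad f y :> (_ -> _).
Proof.
move=> Cf y Uy; apply: (C1_differentiable _ _).2 => i.
  by near=> z; apply: (Cf i).1; near: z; exact: nearU.
by apply: (Ck_continuous (Cf i).2).
Unshelve. all: by end_near. Qed.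

Lemma Ck_pred k f : Ck k.+1 U f -> Ck k U f.
Proof.
elim: k f => [|k IH] f Cf; first exact: (Ck_continuous Cf).
by move=> i; split; [exact: (Cf i).1|apply: IH; exact: (Cf i).2].
Qed.

Lemma Ck_leq j k f : (j <= k)%N -> Ck k U f -> Ck j U f.
Proof.
elim: k => [|k IH]; first by rewrite leqn0 => /eqP ->.
by rewrite leq_eqVlt => /predU1P[->//|jk] /Ck_pred; exact: IH.
Qed.

Lemma Ck_partial k f i : Ck k.+1 U f -> Ck k U (partial i f).
Proof. by move=> Cf; exact: (Cf i).2. Qed.

Lemma eq_Ck k f g : (forall y, U y -> f y = g y) -> Ck k U f -> Ck k U g.
Proof.
elim: k f g => [|k IH] f g fg Cf.
  move=> y Uy; have nfg : \near y, f y = g y.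
    by near=> z; apply: fg; near: z; exact: nearU.
  rewrite /prop_for /continuous_at -(fg y Uy); apply: cvg_trans (Cf y Uy).
  exact: (@near_eq_cvg _ _ _ _ f g nfg).
move=> i; have nfg y : U y -> \near y, f y = g y.
  by move=> Uy; near=> z; apply: fg; near: z; exact: nearU.
split=> [y Uy|].
  exact: near_eq_derivable (nfg y Uy) ((Cf i).1 y Uy).
apply: IH (Cf i).2 => y Uy; rewrite /partial.
exact: near_eq_derive (nfg y Uy).
Unshelve. all: by end_near. Qed.

Lemma partial_eq f g i y : (forall y, U y -> f y = g y) -> U y ->
  partial i f y = partial i g y.
Proof.
move=> fg Uy; apply: near_eq_derive.
by near=> z; apply: fg; near: z; exact: nearU.
Unshelve. all: by end_near. Qed.

Lemma partial_cst c i y : partial i (fun=> c : R) y = 0.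
Proof. exact: derive_cst. Qed.

Lemma Ck_cst c k : Ck k U (fun=> c : R).
Proof.
elim: k c => [|k IH] c; first by move=> y _; exact: cst_continuous.
move=> i; split=> [y _|]; first exact: derivable_cst.
by rewrite (_ : partial i _ = fun=> 0) //; apply/funext => y; exact: partial_cst.
Qed.

Lemma is_derive_coord (j : 'I_n) (y v : 'rV[R]_n) :
  is_derive y v (fun z : 'rV[R]_n => z 0 j) (v 0 j).
Proof.
have D := @differentiable_coord R 1 n y 0 j.
split; first exact: diff_derivable.
rewrite deriveE //.
have L : linear (fun z : 'rV[R]_n => z 0 j) by move=> a u w; rewrite !mxE.
pose l : {linear 'rV[R]_n -> R} := HB.pack (fun z : 'rV[R]_n => z 0 j) (GRing.isLinear.Build _ _ _ _ _ L).
by rewrite (_ : (fun _ => _) = l) // diff_lin //; exact: coord_continuous.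
Qed.

Lemma Ck_coord (j : 'I_n) k : Ck k U (fun y => y 0 j).
Proof.
case: k => [|k]; first by move=> y _; exact: coord_continuous.
move=> i; split=> [y _|]; first by have [] := is_derive_coord j y (e_ i).
apply: eq_Ck (Ck_cst ((e_ i) 0 j) k) => y _.
by rewrite /partial; have [_ ->] := is_derive_coord j y (e_ i).
Qed.

Lemma partialD f g i y : derivable f y (e_ i) -> derivable g y (e_ i) ->
  partial i (fun y => f y + g y) y = partial i f y + partial i g y.
Proof. by move=> df dg; rewrite /partial -deriveD. Qed.

Lemma partialM f g i y : derivable f y (e_ i) -> derivable g y (e_ i) ->
  partial i (fun y => f y * g y) y = partial i f y * g y + f y * partial i g y.
Proof.
move=> df dg; rewrite /partial.
have -> : (fun y => f y * g y) = f * g by [].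
by rewrite deriveM // addrC ![_ *: _]mulrC [X in _ + X]mulrC.
Qed.

Lemma CkD k f g : Ck k U f -> Ck k U g -> Ck k U (fun y => f y + g y).
Proof.
elim: k f g => [|k IH] f g Cf Cg.
  by move=> y Uy; exact: continuousD (Cf y Uy) (Cg y Uy).
move=> i; have [[df Cdf] [dg Cdg]] := (Cf i, Cg i).
split=> [y Uy|]; first by apply: derivableD; [exact: df|exact: dg].
apply: eq_Ck (IH _ _ Cdf Cdg) => y Uy.
by rewrite partialD //; [exact: df|exact: dg].
Qed.

Lemma CkM k f g : Ck k U f -> Ck k U g -> Ck k U (fun y => f y * g y).
Proof.
elim: k f g => [|k IH] f g Cf Cg.
  by move=> y Uy; exact: continuousM (Cf y Uy) (Cg y Uy).
move=> i; have [[df Cdf] [dg Cdg]] := (Cf i, Cg i).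
split=> [y Uy|]; first by apply: derivableM; [exact: df|exact: dg].
apply: (eq_Ck (f := fun y => partial i f y * g y + f y * partial i g y)).
  by move=> y Uy; rewrite partialM //; [exact: df|exact: dg].
by apply: CkD; apply: IH => //; exact: Ck_pred.
Qed.

Lemma CkZ k c f : Ck k U f -> Ck k U (fun y => c * f y).
Proof. by move=> Cf; apply: CkM => //; exact: Ck_cst. Qed.

Lemma CkN k f : Ck k U f -> Ck k U (fun y => - f y).
Proof.
by move=> Cf; apply: (eq_Ck (f := fun y => (-1) * f y)) (CkZ _ Cf) => y _; rewrite mulN1r.
Qed.

Lemma CkB k f g : Ck k U f -> Ck k U g -> Ck k U (fun y => f y - g y).
Proof. by move=> Cf Cg; apply: CkD => //; exact: CkN. Qed.

Lemma Ck_sum k (I : Type) (r : seq I) (P : pred I) (F : I -> 'rV[R]_n -> R) :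
  (forall i, P i -> Ck k U (F i)) -> Ck k U (fun y => \sum_(i <- r | P i) F i y).
Proof.
move=> CF; elim: r => [|i r IH].
  by apply: eq_Ck (Ck_cst 0 k) => y _; rewrite big_nil.
case/boolP : (P i) => Pi.
  by apply: eq_Ck (CkD (CF i Pi) IH) => y _; rewrite big_cons Pi.
by apply: eq_Ck IH => y _; rewrite big_cons (negbTE Pi).
Qed.

Lemma Ck_prod k (I : Type) (r : seq I) (P : pred I) (F : I -> 'rV[R]_n -> R) :
  (forall i, P i -> Ck k U (F i)) -> Ck k U (fun y => \prod_(i <- r | P i) F i y).
Proof.
move=> CF; elim: r => [|i r IH].
  by apply: eq_Ck (Ck_cst 1 k) => y _; rewrite big_nil.
case/boolP : (P i) => Pi.
  by apply: eq_Ck (CkM (CF i Pi) IH) => y _; rewrite big_cons Pi.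
by apply: eq_Ck IH => y _; rewrite big_cons (negbTE Pi).
Qed.

Lemma Ck_det k m (A : 'rV[R]_n -> 'M[R]_m) :
  (forall a b, Ck k U (fun y => A y a b)) -> Ck k U (fun y => \det (A y)).
Proof.
move=> CA; apply: Ck_sum => s _; apply: CkZ; apply: Ck_prod => i _; exact: CA.
Qed.

(** A family of functions of one variable closed under differentiation consists
   of smooth functions, and composing with them preserves C^k. *)
Lemma Ck_comp1 (F : set (R -> R)) (D : set R) k f (Phi : R -> R) :
  (forall P, F P -> exists2 dP, F dP & forall x : R, D x -> is_derive x 1 P (dP x)) ->
  F Phi -> Ck k U f -> (forall y, U y -> D (f y)) -> Ck k U (fun y => Phi (f y)).
Proof.
move=> closedF; elim: k Phi f => [|k IH] Phi f FPhi Cf fD.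
  move=> y Uy; apply: (@continuous_comp _ _ _ f Phi); first exact: Cf.
  have [dP _ dPE] := closedF _ FPhi.
  apply: differentiable_continuous; apply/derivable1_diffP.
  by have [] := dPE _ (fD _ Uy).
have [dP FdP dPE] := closedF _ FPhi.
have dC y v : U y -> is_derive y v (fun z => Phi (f z)) (dP (f y) * 'D_v f y).
  move=> Uy; apply: is_derive_comp1; first exact: (Ck_differentiable Cf).
  exact/dPE/fD.
move=> i; split=> [y Uy|]; first by have [] := dC y (e_ i) Uy.
apply: (eq_Ck (f := fun y => dP (f y) * partial i f y)).
  by move=> y Uy; rewrite {2}/partial; have [_ ->] := dC y (e_ i) Uy.
by apply: CkM; [apply: IH => //; exact: Ck_pred|exact: (Cf i).2].
Qed.

(** Induction on k, since 1/f occurs in its own partial derivatives. *)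
Lemma Ck_inv k f : (forall y, U y -> f y != 0) -> Ck k U f -> Ck k U (fun y => (f y)^-1).
Proof.
move=> f0; elim: k f f0 => [|k IH] f f0 Cf.
  by move=> y Uy; exact: continuousV (f0 y Uy) (Cf y Uy).
move=> i; split=> [y Uy|].
  by apply: derivableV; [exact: f0|exact: (Cf i).1].
apply: (eq_Ck (f := fun y => - ((f y)^-1 * (f y)^-1 * partial i f y))).
  move=> y Uy; rewrite {2}/partial deriveV //; [|exact: f0|exact: (Cf i).1].
  by rewrite scaleNr; congr (- (_ * _)); rewrite -exprVn expr2.
apply: CkN; apply: CkM; last exact: (Cf i).2.
by apply: CkM; apply: IH => //; exact: Ck_pred.
Qed.

Lemma Ck_sqrt k f : (forall y, U y -> 0 < f y) -> Ck k U f -> Ck k U (fun y => Num.sqrt (f y)).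
Proof.
move=> f0; elim: k f f0 => [|k IH] f f0 Cf.
  move=> y Uy; apply: (@continuous_comp _ _ _ f Num.sqrt); first exact: Cf.
  exact: sqrt_continuous.
have dC y v : U y -> is_derive y v (fun z => Num.sqrt (f z))
    ((2 * Num.sqrt (f y))^-1 * 'D_v f y).
  move=> Uy; apply: is_derive_comp1; first exact: (Ck_differentiable Cf).
  exact/is_derive1_sqrt/f0.
move=> i; split=> [y Uy|]; first by have [] := dC y (e_ i) Uy.
apply: (eq_Ck (f := fun y => (2 * Num.sqrt (f y))^-1 * partial i f y)).
  by move=> y Uy; rewrite {2}/partial; have [_ ->] := dC y (e_ i) Uy.
apply: CkM; last exact: (Cf i).2.
apply: Ck_inv => [y Uy|]; last by apply: CkZ; apply: IH => //; exact: Ck_pred.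
by rewrite mulf_neq0 // gt_eqF // sqrtr_gt0 f0.
Qed.

Lemma Ck_sin_cos k f : Ck k U f ->
  Ck k U (fun y => sin (f y)) /\ Ck k U (fun y => cos (f y)).
Proof.
move=> Cf; pose F := [set P : R -> R | [\/ P = sin, P = cos, P = \- sin | P = \- cos]].
have cF P : F P -> exists2 dP, F dP & forall x : R, setT x -> is_derive x 1 P (dP x).
  case=> ->.
  - by exists cos; [apply: Or42|move=> x _; exact: is_derive_sin].
  - by exists (\- sin); [apply: Or43|move=> x _; exact: is_derive_cos].
  - by exists (\- cos); [apply: Or44|move=> x _; apply: is_deriveN].
  - exists sin; [apply: Or41|move=> x _] => //.
    by rewrite -[sin x]opprK; apply: is_deriveN.
split; apply: (Ck_comp1 cF) => //; [exact: Or41|exact: Or42].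
Qed.

End C1.

Section change_of_variables.
Variable n : nat.
Variables (U W : set 'rV[R]_n) (T : 'rV[R]_n -> 'rV[R]_n).
Hypotheses (oU : open U) (oW : open W).
Hypothesis TW : forall y, U y -> W (T y).
Local Notation e_ i := (delta_mx 0 i : 'rV[R]_n).

Lemma rV_differentiable y : (forall j, differentiable (fun z => T z 0 j) y) ->
  differentiable T y.
Proof.
move=> dT; rewrite (_ : T = \sum_j (fun z => T z 0 j *: e_ j)); last first.
  apply/funext => z; rewrite fct_sumE; exact: row_sum_delta.
by apply: differentiable_sum => j; apply: differentiableZl.
Qed.

Lemma rV_continuous y : (forall j, {for y, continuous (fun z => T z 0 j)}) ->
  {for y, continuous T}.
Proof.
move=> cT; apply/(@cvgrPdist_lt R 'rV[R]_n _ (nbhs y)) => e e0.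
have : \forall z \near y, forall j, `|T y 0 j - T z 0 j| < e.
  have := @filter_forall _ 'I_n (fun j z => `|T y 0 j - T z 0 j| < e) (nbhs y) _; apply.
  by move=> j; move: (cT j) => /cvgrPdist_lt/(_ _ e0); exact.
apply: filterS => z H; have : ball (T y) e (T z) by apply/rV_ballE.
by rewrite -ball_normE.
Qed.

Lemma diff_rV y v j : differentiable T y -> ('d T y v) 0 j = 'd (fun z => T z 0 j) y v.
Proof.
move=> dT.
have L : linear (fun z : 'rV[R]_n => z 0 j) by move=> a u w; rewrite !mxE.
pose l : {linear 'rV[R]_n -> R} := HB.pack (fun z : 'rV[R]_n => z 0 j) (GRing.isLinear.Build _ _ _ _ _ L).
have dl : differentiable l (T y) by exact: differentiable_coord.
have E : 'd (fun z => T z 0 j) y = 'd l (T y) \o 'd T y :> (_ -> _) := diff_comp dT dl.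
have El : 'd l (T y) = l :> (_ -> _) by apply: diff_lin; exact: coord_continuous.
by rewrite E El.
Qed.

Lemma jacobianE k y : (forall j, Ck k.+1 U (fun z => T z 0 j)) -> U y ->
  forall i j, ('J T y) i j = partial i (fun z => T z 0 j) y.
Proof.
move=> CT Uy i j; have dT j' : differentiable (fun z => T z 0 j') y.
  by apply: (Ck_differentiable oU (CT j')).
rewrite /jacobian /lin1_mx mxE diff_rV; last exact: rV_differentiable.
by rewrite /partial deriveE.
Qed.

Lemma partial_comp k (f : 'rV[R]_n -> R) y i :
  (forall j, Ck k.+1 U (fun z => T z 0 j)) -> Ck k.+1 W f -> U y ->
  is_derive y (e_ i) (fun z => f (T z))
    (\sum_j partial i (fun z => T z 0 j) y * partial j f (T y)).
Proof.
move=> CT Cf Uy; have dT j : differentiable (fun z => T z 0 j) y.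
  by apply: (Ck_differentiable oU (CT j)).
have dTy := rV_differentiable dT.
have df : differentiable f (T y) by apply: (Ck_differentiable oW Cf); exact: TW.
have dfT : differentiable (f \o T) y by exact: differentiable_comp.
split; first exact: diff_derivable.
rewrite (_ : (fun z => f (T z)) = f \o T) // deriveE // diff_comp //=.
rewrite (Ck_diff oW Cf); last exact: TW.
by apply: eq_bigr => j _; congr (_ * _); rewrite diff_rV // /partial deriveE.
Qed.

Lemma Ck_comp k (f : 'rV[R]_n -> R) :
  (forall j, Ck k U (fun z => T z 0 j)) -> Ck k W f -> Ck k U (fun z => f (T z)).
Proof.
elim: k f => [|k IH] f CT Cf.
  move=> y Uy; apply: (@continuous_comp _ _ _ T f); last exact/Cf/TW.
  by apply: rV_continuous => j; exact: CT.
move=> i; split=> [y Uy|]; first by have [] := partial_comp i CT Cf Uy.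
apply: (eq_Ck oU (f := fun y => \sum_j partial i (fun z => T z 0 j) y * partial j f (T y))).
  by move=> y Uy; rewrite {3}/partial; have [_ ->] := partial_comp i CT Cf Uy.
apply: Ck_sum => // j _; apply: CkM => //; first exact: (CT j i).2.
by apply: IH; [move=> j'; exact: Ck_pred|exact: (Cf j).2].
Qed.

End change_of_variables.

End Ck_calculus.

(** * Smooth bump functions *)

Section bump.
Variable R : realType.

(** The functions P(1/x) exp(-1/x) extended by 0: this family is closed under
   differentiation, and its members are flat at 0. *)
Definition flat (P : {poly R}) (x : R) : R :=
  if 0 < x then P.[x^-1] * expR (- x^-1) else 0.

Lemma expR_ge_expn (u : R) (k : nat) : 0 <= u -> (u / k.+1%:R) ^+ k.+1 <= expR u.
Proof.
move=> u0; have v0 : 0 <= u / k.+1%:R by rewrite divr_ge0.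
have -> : expR u = expR (u / k.+1%:R) ^+ k.+1.
  by rewrite -expRM_natl -mulr_natl mulrC divfK.
apply: lerXn2r; rewrite ?nnegrE ?expR_ge0 //.
by apply: le_trans (expR_ge1Dx _); rewrite lerDr.
Qed.

(** The exponential beats every power, so a flat function is O(x^2) at 0. *)
Lemma flat_bound (P : {poly R}) :
  exists2 C : R, 0 <= C & forall x, `|flat P x| <= C * x ^+ 2.
Proof.
pose c (m : nat) : R := m.+2%:R ^+ m.+2.
exists (\sum_(m < size P) `|P`_m| * c m).
  by apply: sumr_ge0 => m _; rewrite mulr_ge0 // exprn_ge0.
move=> x; rewrite /flat; case: ltP => [x0|_]; last first.
  by rewrite normr0 mulr_ge0 ?sqr_ge0 // sumr_ge0 // => m _; rewrite mulr_ge0 // exprn_ge0.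
rewrite horner_coef mulr_suml mulr_suml.
apply: le_trans (ler_norm_sum _ _ _) _; apply: ler_sum => m _.
rewrite -[leRHS]mulrA -[X in `|X|]mulrA normrM; apply: ler_wpM2l => //.
rewrite ger0_norm; last by rewrite mulr_ge0 ?expR_ge0 // exprn_ge0 // invr_ge0 ltW.
rewrite expRN ler_pdivrMr ?expR_gt0 //; clear -x0.
have u0 : 0 <= x^-1 by rewrite invr_ge0 ltW.
apply: (@le_trans _ _ (c m * x ^+ 2 * (x^-1 / m.+2%:R) ^+ m.+2)); last first.
  by apply: ler_wpM2l; [rewrite mulr_ge0 ?sqr_ge0 ?exprn_ge0|exact: expR_ge_expn].
rewrite expr_div_n -/(c m); have cm0 : c m != 0 by rewrite expf_neq0.
have -> : c m * x ^+ 2 * (x^-1 ^+ m.+2 / c m) = x ^+ 2 * x^-1 ^+ m.+2 by field.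
by rewrite -(addn2 m) exprD mulrCA -exprMn mulfV ?gt_eqF // expr1n mulr1.
Qed.

(** Away from 0 this is ordinary calculus; at 0 both sides vanish because flat
   P is O(x^2). *)
Lemma is_derive_flat (P : {poly R}) (x : R) :
  is_derive x 1 (flat P) (flat ('X^2 * (P - P^`())) x).
Proof.
have [x0|x0|->] := ltgtP x 0.
- have E : \near x, cst 0 x = flat P x.
    near=> z; rewrite /flat /= ltNge ltW //; near: z; exact: lt_nbhsl.
  have -> : flat ('X^2 * (P - P^`())) x = 0 by rewrite /flat ltNge ltW.
  exact: near_eq_is_derive E _.
- have E : \near x, P.[x^-1] * expR (- x^-1) = flat P x.
    near=> z; rewrite /flat /= ifT //; near: z; exact: lt_nbhsr.
  apply: near_eq_is_derive E _.
  have xn0 : x != 0 by rewrite gt_eqF.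
  have dinv : derivable (fun z : R => z^-1) x 1.
    by have [d1 d2] := is_derive_id x (1 : R); exact: derivableV.
  have vinv : 'D_1 (fun z : R => z^-1) x = - x ^- 2.
    have [d1 d2] := is_derive_id x (1 : R).
    by rewrite deriveV // d2; exact: mulr1.
  have Dinv : differentiable (fun z : R => z^-1) x by exact/derivable1_diffP.
  have dP : is_derive x 1 (fun z : R => P.[z^-1]) ((- x ^- 2) * P^`().[x^-1]).
    rewrite mulrC -vinv; apply: (is_derive_comp1 (Phi := horner P)) => //.
  have dE : is_derive x 1 (fun z : R => expR (- z^-1)) (x ^- 2 * expR (- x^-1)).
    have dN : is_derive x 1 (fun z : R => - z^-1) (x ^- 2).
      rewrite -[x ^- 2]opprK -vinv.
      exact: is_deriveN.
    have [dN1 dN2] := dN.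
    rewrite mulrC -[in X in _ * X]dN2; apply: (is_derive_comp1 (Phi := expR)).
      by apply/derivable1_diffP.
  have -> : flat ('X^2 * (P - P^`())) x =
      P.[x^-1] *: (x ^- 2 * expR (- x^-1)) + expR (- x^-1) *: ((- x ^- 2) * P^`().[x^-1]).
    rewrite /flat x0 !hornerE /= -![_ *: _]/(_ * _) -!exprVn; ring.
  exact: is_deriveM.
have -> : flat ('X^2 * (P - P^`())) 0 = 0 by rewrite /flat ltxx.
have [C C0 HC] := flat_bound P.
suff L : (fun h : R => h^-1 *: ((flat P \o shift 0) (h *: 1) - flat P 0)) @ 0^' --> (0 : R).
  split; first by apply/cvg_ex; exists 0.
  exact: cvg_lim L.
apply/cvgrPdist_le => e e0; have C1 : 0 < C + 1 by rewrite ltr_wpDl.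
have eC : 0 < e / (C + 1) by rewrite divr_gt0.
near=> h.
have h0 : h != 0 by near: h; exact: nbhs_dnbhs_neq.
rewrite sub0r normrN /= addr0 [h *: 1]mulr1 {2}/flat ltxx subr0 [_ *: _]/(_ * _).
rewrite normrM normfV ler_pdivrMl ?normr_gt0 //.
apply: le_trans (HC h) _; rewrite -real_normK ?num_real // expr2 mulrA.
rewrite [leRHS]mulrC; apply: ler_wpM2r => //.
have : `|h| <= e / (C + 1) by near: h; exact: dnbhs0_le.
rewrite ler_pdivlMr // => H; apply: le_trans H; rewrite mulrC.
by apply: ler_wpM2l => //; rewrite lerDl.
Unshelve. all: by end_near. Qed.

(** Smooth, positive exactly on ball c r, which is a cube for the norm of row
   vectors. *)
Definition bump n (c : 'rV[R]_n) (r : R) (y : 'rV[R]_n) : R :=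
  \prod_i (flat 1 (1 + r^-1 * (y 0 i - c 0 i)) * flat 1 (1 - r^-1 * (y 0 i - c 0 i))).

Lemma flat1_ge0 x : 0 <= flat 1 x.
Proof. by rewrite /flat; case: ifP => // _; rewrite hornerC mul1r expR_ge0. Qed.

Lemma flat1_gt0 x : (0 < flat 1 x) = (0 < x).
Proof.
by rewrite /flat; case: ifP; rewrite ?ltxx // hornerC mul1r expR_gt0.
Qed.

Lemma Ck_bump n (c : 'rV[R]_n) (r : R) k : Ck k setT (bump c r).
Proof.
have oT : open [set: 'rV[R]_n] := openT.
pose F := [set Q | exists P, Q = flat P].
have cF Q : F Q -> exists2 dQ, F dQ & forall x : R, setT x -> is_derive x 1 Q (dQ x).
  move=> [P ->]; exists (flat ('X^2 * (P - P^`()))); first by eexists.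
  by move=> x _; exact: is_derive_flat.
have Cy i : Ck k setT (fun y : 'rV[R]_n => r^-1 * (y 0 i - c 0 i)).
  by apply: CkZ => //; apply: CkB => //; [exact: Ck_coord|exact: Ck_cst].
apply: Ck_prod => // i _; apply: CkM => //; apply: (Ck_comp1 oT cF) => //; try by exists 1.
- by apply: CkD => //; exact: Ck_cst.
- by apply: CkB => //; exact: Ck_cst.
Qed.

Lemma bump_ge0 n (c : 'rV[R]_n) (r : R) y : 0 <= bump c r y.
Proof. by apply: prodr_ge0 => i _; rewrite mulr_ge0 ?flat1_ge0. Qed.

Let flat1_factor (r t : R) : 0 < r ->
  (0 < flat 1 (1 + r^-1 * t) * flat 1 (1 - r^-1 * t)) = (`|t| < r).
Proof.
move=> r0; have E (a b : R) : 0 <= a -> 0 <= b -> (0 < a * b) = (0 < a) && (0 < b).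
  rewrite !le_eqVlt => /predU1P[<-|a0] /predU1P[<-|b0];
    by rewrite ?mul0r ?mulr0 ?ltxx ?andbF ?mulr_gt0 ?a0 ?b0.
rewrite E ?flat1_ge0 // !flat1_gt0 ltr_norml; set a := r^-1 * t.
have -> : t = r * a by rewrite /a mulVKf // gt_eqF.
by apply/andP/andP => -[h1 h2]; split; nra.
Qed.

Lemma bump_gt0 n (c : 'rV[R]_n) (r : R) y : 0 < r -> ball c r y -> 0 < bump c r y.
Proof.
move=> r0 /rV_ballE[_ H]; apply: prodr_gt0 => i _.
by rewrite flat1_factor // distrC.
Qed.

Lemma bump_eq0 n (c : 'rV[R]_n) (r : R) y : 0 < r -> ~ ball c r y -> bump c r y = 0.
Proof.
move=> r0 H; have [i hi] : exists i, ~~ (`|c 0 i - y 0 i| < r).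
  apply/existsP; rewrite -negb_forall; apply/negP => /forallP h.
  by apply: H; apply/rV_ballE.
rewrite /bump (bigD1 i) //=; apply/eqP; rewrite mulf_eq0; apply/orP; left.
rewrite distrC -flat1_factor // -leNgt in hi.
by rewrite eq_le hi mulr_ge0 ?flat1_ge0.
Qed.

End bump.

(** * Integrals over R^n *)

Section rV_integrals.
Variable R : realType.
Variable n : nat.
Local Notation e_ i := (delta_mx 0 i : 'rV[R]_n).
Local Notation cube r := (@cube R n r).
Implicit Types (F X : 'rV[R]_n -> R).

Lemma cube_compact r : compact (cube r).
Proof.
have := @rV_compact R n (fun=> `[(- r), r]%classic) (fun=> @segment_compact _ _ _).
by congr compact; apply/seteqP; split => y h i; have := h i; rewrite /= in_itv /= ler_norml.
Qed.

Lemma open_not_cube r : open (~` cube r).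
Proof.
rewrite openC; apply: (compact_closed _ (@cube_compact r)).
exact: norm_hausdorff.
Qed.

Lemma leb_cube_lty r : (leb R n (cube r : set (borel 'rV[R]_n)) < +oo)%E.
Proof.
have [r0|r0] := leP 0 r.
  rewrite -[cube r]setIT -integral_indic //; last exact: measurable_cube.
  rewrite lebE ?LI_cube ?ltry //.
  by apply/measurable_EFinP; apply: measurable_indic; exact: measurable_cube.
apply: (@le_lt_trans _ _ (leb R n (cube 0))); last first.
  rewrite -[cube 0]setIT -integral_indic //; last exact: measurable_cube.
  rewrite lebE ?LI_cube ?ltry //.
  by apply/measurable_EFinP; apply: measurable_indic; exact: measurable_cube.
apply: le_measure; rewrite ?inE; try exact: measurable_cube.
by move=> y h i; exact: le_trans (h i) (ltW r0).
Qed.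

Lemma cube_integrable F (r C : R) : measurable_fun [set: borel 'rV[R]_n] F ->
  (forall y, `|F y| <= C) -> (forall y, ~ cube r y -> F y = 0) ->
  (leb R n).-integrable setT (EFin \o F).
Proof.
move=> mF bF F0; have mc := @measurable_cube R n r.
have -> : EFin \o F = (EFin \o F) \_ (cube r).
  apply/funext => y; rewrite patchE; case: ifPn => //; rewrite notin_setE => h.
  by rewrite /= F0.
apply/(@integrable_mkcond _ _ _ (leb R n) (cube r) (EFin \o F) mc).
apply: (@measurable_bounded_integrable _ _ _ (leb R n) F (cube r)) => //.
- exact: leb_cube_lty.
- exact: measurable_funTS.
- exists C; split; first exact: num_real.
  by move=> x Cx y _; exact: le_trans (bF y) (ltW Cx).
Qed.

Lemma bounded_on_cube F r : continuous F -> (forall y, ~ cube r y -> F y = 0) ->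
  exists2 C : R, 0 <= C & forall y, `|F y| <= C.
Proof.
move=> cF F0; have [M [Mr HM]] : bounded_set (F @` cube r).
  apply: compact_bounded; apply: continuous_compact; last exact: cube_compact.
  exact: continuous_subspaceT.
exists (`|M| + 1); first by rewrite addr_ge0.
move=> y; have [cy|cy] := pselect (cube r y).
  by apply: (HM (`|M| + 1)); [rewrite ltr_pwDr // ler_norm|exists y].
by rewrite F0 // normr0 addr_ge0.
Qed.

Lemma continuous_integrable F r : continuous F -> (forall y, ~ cube r y -> F y = 0) ->
  (leb R n).-integrable setT (EFin \o F).
Proof.
move=> cF F0; have [C _ bF] := bounded_on_cube cF F0.
exact: (cube_integrable (continuous_borel cF) bF F0).
Qed.

Lemma Rintegral_shift F (v : 'rV[R]_n) : measurable_fun [set: borel 'rV[R]_n] F ->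
  \int[leb R n]_y F (y + v) = \int[leb R n]_y F y.
Proof.
move=> mF; rewrite /Rintegral; congr fine.
have mE : measurable_fun [set: borel 'rV[R]_n] (EFin \o F) by exact/measurable_EFinP.
rewrite [LHS]integralE [RHS]integralE; congr (_ - _)%E.
- apply: etrans (leb_shift v (measurable_funepos mE) (fun y => funepos_ge0 _ y)).
  by apply: eq_integral => y _; rewrite !funeposE.
- apply: etrans (leb_shift v (measurable_funeneg mE) (fun y => funeneg_ge0 _ y)).
  by apply: eq_integral => y _; rewrite !funenegE.
Qed.

Lemma partial_support0 X r i y : (forall z, ~ cube r z -> X z = 0) -> ~ cube r y ->
  partial i X y = 0.
Proof.
move=> X0 cy; rewrite (partial_eq (open_not_cube (r := r)) (g := fun=> 0)) //.
exact: partial_cst.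
Qed.

(** The integral of a difference quotient vanishes by translation invariance,
   and difference quotients converge boundedly to the partial derivative. *)
Lemma integral_partial_eq0 X r i : Ck 1 setT X -> (forall y, ~ cube r y -> X y = 0) ->
  \int[leb R n]_y partial i X y = 0.
Proof.
move=> CX X0.
have dX y : derivable X y (e_ i) by apply: (CX i).1.
have cX : continuous X by move=> y; apply: (Ck_continuous openT CX).
have cdX : continuous (partial i X) by move=> y; exact: ((CX i).2 y).
have dX0 y : ~ cube r y -> partial i X y = 0 by exact: partial_support0.
have [C C0 bC] := bounded_on_cube cdX dX0.
pose t (k : nat) : R := k.+1%:R^-1.
pose D k y := (t k)^-1 * (X (y + t k *: e_ i) - X y).
have mX : measurable_fun [set: borel 'rV[R]_n] X by exact: continuous_borel.
have mXt k : measurable_fun [set: borel 'rV[R]_n] (fun y => X (y + t k *: e_ i)).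
  exact: (measurableT_comp mX (measurable_fun_shift _)).
have mD k : measurable_fun [set: borel 'rV[R]_n] (D k).
  by apply: measurable_funM => //; exact: measurable_funB.
have t1 k : `|t k| <= 1 by rewrite ger0_norm ?invr_ge0 // invf_le1 // ler1n.
have t0 k : t k != 0 by rewrite invr_neq0.
have Dle k y : `|D k y| <= C.
  have [s _ E] := MVT_line (X := X) (y := y) (e := e_ i) (t := t k) (fun s _ => dX _).
  by rewrite /D E mulKf //; exact: bC.
have Dcube k y : ~ cube (r + 1) y -> D k y = 0.
  move=> cy; rewrite /D !X0 ?subrr ?mulr0 //.
    move=> h; apply: cy => j; apply: le_trans (h j) _; lra.
  move=> h; apply: cy => j; have := h j; rewrite !mxE eqxx /= => hj.
  rewrite -[y 0 j](addrK (t k * (j == i)%:R)); apply: le_trans (ler_normB _ _) _.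
  apply: lerD => //; rewrite normrM; case: (j == i); rewrite ?normr1 ?normr0 ?mulr1 ?mulr0 //.
have X0' y : ~ cube (r + 1) y -> X y = 0.
  by move=> cy; apply: X0 => h; apply: cy => j; apply: le_trans (h j) _; lra.
have Xt0 k y : ~ cube (r + 1) y -> X (y + t k *: e_ i) = 0.
  by move=> cy; have := Dcube k y cy; rewrite /D (X0' y) // subr0 => /eqP;
    rewrite mulf_eq0 invr_eq0 (negbTE (t0 k)) /= => /eqP.
have iX : (leb R n).-integrable setT (EFin \o X) by exact: continuous_integrable X0.
have [CX' _ bX] := bounded_on_cube cX X0.
have iXt k : (leb R n).-integrable setT (EFin \o (fun y => X (y + t k *: e_ i))).
  by apply: (cube_integrable (mXt k)) (Xt0 k) => y; exact: bX.
have iD k : (leb R n).-integrable setT (EFin \o D k) by exact: (cube_integrable (mD k)) (Dcube k).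
have D_0 k : (\int[leb R n]_y (D k y)%:E = 0)%E.
  have : \int[leb R n]_y D k y = 0.
    rewrite RintegralZl //; last first.
      exact: (integrableB measurableT (iXt k) iX).
    by rewrite RintegralB // Rintegral_shift // subrr mulr0.
  have fD := integrable_fin_num measurableT (iD k).
  by move=> E; rewrite -(fineK fD); move: E; rewrite /Rintegral => ->.
have mdX : measurable_fun [set: borel 'rV[R]_n] (partial i X) by exact: continuous_borel.
pose g y : \bar R := (C * \1_(cube (r + 1)) y)%:E.
have ig : (leb R n).-integrable setT g.
  apply: (@cube_integrable (fun y => C * \1_(cube (r + 1)) y) (r + 1) C).
  - by apply: measurable_funM => //; apply: measurable_indic; exact: measurable_cube.
  - by move=> y; rewrite normrM ger0_norm // ler_piMr // indicE; case: (_ \in _); rewrite ?normr1 ?normr0.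
  - by move=> y cy; rewrite indicE memNset // mulr0.
have [] := @dominated_convergence _ _ _ (leb R n) setT measurableT
  (fun k y => (D k y)%:E) (fun y => (partial i X y)%:E) g _ _ _ ig _.
- by move=> k; exact/measurable_EFinP.
- exact/measurable_EFinP.
- apply: aeW => y _; apply/cvg_EFin; first by near=> k.
  apply/cvgrPdist_lt => eps eps0.
  have /cvgrPdist_lt/(_ _ eps0) := dX y.
  move=> /nbhs_ballP[d /= d0 H].
  near=> k; rewrite /= /D.
  rewrite (addrC y (t k *: e_ i)); apply: (H (t k)) => //.
  rewrite -ball_normE /ball_ /= sub0r normrN ger0_norm ?invr_ge0 //.
  near: k; exact: (near_infty_natSinv_lt (PosNum d0)).
- apply: aeW => y k _; rewrite lee_fin; have [cy|cy] := pselect (cube (r + 1) y).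
    by rewrite indicE mem_set // mulr1.
  by rewrite Dcube // normr0 mulr_ge0.
move=> _ _ /=; rewrite [X in X @ _ --> _](_ : _ = cst 0%E); last first.
  by apply/funext => k /=; exact: D_0.
move=> /(cvg_unique _ (cvg_cst _)) E; rewrite /Rintegral -E //.
Unshelve. all: by end_near. Qed.

End rV_integrals.

(** * Square integrable functions and orthonormal systems *)

Section square_integrable.
Context (R : realType) d (T : measurableType d) (mu : {measure set T -> \bar R}).
Implicit Types (u v w : T -> R).

Definition l2 u := measurable_fun [set: T] u /\ (\int[mu]_x ((u x) ^+ 2)%:E < +oo)%E.

Definition ip u v : R := \int[mu]_x (u x * v x).

Lemma l2_measurable u : l2 u -> measurable_fun [set: T] u. Proof. by case. Qed.

Lemma poweR_Lnorm2 u :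
  (Lnorm mu 2%:E (EFin \o u) `^ 2 = \int[mu]_x ((u x) ^+ 2)%:E)%E.
Proof.
rewrite poweR_Lnorm //; apply: eq_integral => x _ /=.
by rewrite powR_mulrn // real_normK // num_real.
Qed.

Lemma l2P u : reflect (l2 u) (u \in Lfun mu 2%:E).
Proof.
have E : measurable_fun [set: T] u ->
    finite_norm mu 2%:E u <-> (\int[mu]_x ((u x) ^+ 2)%:E < +oo)%E.
  move=> mu_; rewrite /finite_norm -poweR_Lnorm2; split=> [|h]; first exact: poweR_lty.
  by apply: (@lty_poweRy _ _ 2).
apply: (iffP idP) => [|[mu_ fu]].
  by rewrite inE => /andP[/[!inE]/= m_ f_]; split=> //; exact/E.
by rewrite inE; apply/andP; split; rewrite inE //=; exact/E.
Qed.

Lemma l2_integrable u v : l2 u -> l2 v -> mu.-integrable setT (EFin \o (fun x => u x * v x)).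
Proof. by move=> /l2P hu /l2P hv; apply/Lfun1_integrable; exact: Lfun2_mul_Lfun1. Qed.

Lemma l2D u v : l2 u -> l2 v -> l2 (fun x => u x + v x).
Proof.
move=> hu hv; split; first by apply: measurable_funD; apply: l2_measurable.
have h := integrableD measurableT (integrableD measurableT (l2_integrable hu hu)
  (l2_integrable hv hv)) (integrableD measurableT (l2_integrable hu hv)
  (l2_integrable hu hv)).
apply: le_lt_trans (integrable_lty measurableT h).
rewrite le_eqVlt; apply/orP; left; apply/eqP; apply: eq_integral => x _ /=.
by rewrite -!EFinD; congr (_%:E); ring.
Qed.

Lemma l2Z a u : l2 u -> l2 (fun x => a * u x).
Proof.
move=> hu; split; first by apply: measurable_funM => //; exact: l2_measurable.
have h := integrableZl measurableT (a ^+ 2) (l2_integrable hu hu).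
apply: le_lt_trans (integrable_lty measurableT h).
rewrite le_eqVlt; apply/orP; left; apply/eqP; apply: eq_integral => x _ /=.
by rewrite -!EFinM; congr (_%:E); ring.
Qed.

Lemma l2_0 : l2 (fun=> 0).
Proof.
split; first exact: measurable_cst.
by under eq_integral do rewrite expr0n /=; rewrite integral0.
Qed.

Lemma l2B u v : l2 u -> l2 v -> l2 (fun x => u x - v x).
Proof.
move=> hu hv; rewrite (_ : (fun _ => _) = (fun x => u x + (-1) * v x)); last first.
  by apply/funext => x; rewrite mulN1r.
by apply: l2D => //; exact: l2Z.
Qed.

Lemma l2_sum (I : Type) (s : seq I) (P : pred I) (F : I -> T -> R) :
  (forall i, l2 (F i)) -> l2 (fun x => \sum_(i <- s | P i) F i x).
Proof.
move=> hF; elim: s => [|i s IH].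
  by under eq_fun do rewrite big_nil; exact: l2_0.
under eq_fun do rewrite big_cons.
by case: (P i) => //; exact: l2D.
Qed.

Lemma ipC u v : ip u v = ip v u.
Proof. by apply: eq_Rintegral => x _; rewrite mulrC. Qed.

Lemma ipDl u v w : l2 u -> l2 v -> l2 w -> ip (fun x => u x + v x) w = ip u w + ip v w.
Proof.
move=> hu hv hw; rewrite /ip -RintegralD //; try exact: l2_integrable.
by apply: eq_Rintegral => x _; rewrite mulrDl.
Qed.

Lemma ipZl a u w : l2 u -> l2 w -> ip (fun x => a * u x) w = a * ip u w.
Proof.
move=> hu hw; rewrite /ip -RintegralZl //; try exact: l2_integrable.
by apply: eq_Rintegral => x _; rewrite mulrA.
Qed.

Lemma ipBl u v w : l2 u -> l2 v -> l2 w -> ip (fun x => u x - v x) w = ip u w - ip v w.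
Proof.
move=> hu hv hw; rewrite /ip -RintegralB //; try exact: l2_integrable.
by apply: eq_Rintegral => x _; rewrite mulrBl.
Qed.

Lemma ip0l w : ip (fun=> 0) w = 0.
Proof. by rewrite /ip /Rintegral; under eq_integral do rewrite mul0r; rewrite integral0. Qed.

Lemma ip_suml (I : Type) (s : seq I) (P : pred I) (F : I -> T -> R) w :
  (forall i, l2 (F i)) -> l2 w ->
  ip (fun x => \sum_(i <- s | P i) F i x) w = \sum_(i <- s | P i) ip (F i) w.
Proof.
move=> hF hw; elim: s => [|i s IH].
  by under eq_fun do rewrite big_nil; rewrite ip0l big_nil.
under eq_fun do rewrite big_cons; rewrite big_cons; case: (P i) => //.
by rewrite ipDl // ?IH //; exact: l2_sum.
Qed.

Lemma ip_ge0 u : 0 <= ip u u.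
Proof. by apply: Rintegral_ge0 => x _; rewrite -expr2 sqr_ge0. Qed.

Lemma ip_sqrB u v : l2 u -> l2 v ->
  ip (fun x => u x - v x) (fun x => u x - v x) = ip u u - 2 * ip u v + ip v v.
Proof.
move=> hu hv; rewrite ipBl //; last exact: l2B.
by rewrite ![ip _ (fun x => u x - v x)]ipC !ipBl // (ipC v u); ring.
Qed.

(** The quadratic polynomial t -> ip (u - t v) (u - t v) is nonnegative. *)
Lemma ip_CS u v : l2 u -> l2 v -> ip u v ^+ 2 <= ip u u * ip v v.
Proof.
move=> hu hv; have P t : 0 <= ip u u - 2 * t * ip u v + t ^+ 2 * ip v v.
  have := ip_ge0 (fun x => u x - t * v x); rewrite ip_sqrB //; last exact: l2Z.
  rewrite ipZl //; last exact: l2Z.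
  by rewrite ![ip _ (fun x => t * v x)]ipC !ipZl // (ipC v u) expr2 !mulrA.
have [v0|v0] := eqVneq (ip v v) 0.
  rewrite v0 mulr0; have [->|uv0] := eqVneq (ip u v) 0; first by rewrite expr0n.
  have := P ((ip u u + 1) / (2 * ip u v)); rewrite v0 mulr0 addr0.
  have -> : 2 * ((ip u u + 1) / (2 * ip u v)) * ip u v = ip u u + 1 by field.
  lra.
have vp : 0 < ip v v by rewrite lt_def v0 ip_ge0.
have := P (ip u v / ip v v).
have -> : ip u u - 2 * (ip u v / ip v v) * ip u v + (ip u v / ip v v) ^+ 2 * ip v v
   = (ip u u * ip v v - ip u v ^+ 2) / ip v v by field.
by rewrite pmulr_lge0 ?invr_gt0 // subr_ge0.
Qed.

Lemma ipE u : l2 u -> (\int[mu]_x ((u x) ^+ 2)%:E = (ip u u)%:E)%E.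
Proof.
move=> hu; have := integrable_fin_num measurableT (l2_integrable hu hu).
by rewrite /ip /Rintegral => /fineK ->; apply: eq_integral => x _ /=; rewrite expr2.
Qed.

Lemma Lnorm2E u : l2 u -> Lnorm mu 2%:E (EFin \o u) = (Num.sqrt (ip u u))%:E.
Proof.
move=> hu; rewrite unlock /=.
have -> : (\int[mu]_x (`|(u x)%:E| `^ 2) = (ip u u)%:E)%E.
  by rewrite -(ipE hu) -poweR_Lnorm2 poweR_Lnorm.
by rewrite /= powR12_sqrt // ip_ge0.
Qed.

Lemma cvg_Lnorm2 (u : nat -> T -> R) : (forall n, l2 (u n)) ->
  (Lnorm mu 2%:E (fun x => (u n x)%:E) @[n --> \oo] --> 0%E) <->
  (ip (u n) (u n) @[n --> \oo] --> 0).
Proof.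
move=> hu; have -> : (fun n => Lnorm mu 2%:E (fun x => (u n x)%:E)) =
    (fun n => (Num.sqrt (ip (u n) (u n)))%:E).
  by apply/funext => n; rewrite -Lnorm2E.
split=> [/fine_cvgP[_ h]|h].
  have h2 : (fun n => (Num.sqrt (ip (u n) (u n))) * (Num.sqrt (ip (u n) (u n)))) @ \oo --> (0 * 0 : R).
    exact: (cvgM h h).
  rewrite mul0r in h2; apply: cvg_trans h2; apply: near_eq_cvg; near=> n.
  by rewrite -expr2 sqr_sqrtr // ip_ge0.
apply: cvg_EFin; first by near=> n.
rewrite -[0 in X in _ --> X]sqrtr0 /=.
apply: (continuous_cvg _ (@sqrt_continuous R 0)); exact: h.
Unshelve. all: by end_near. Qed.

End square_integrable.

Section riesz_fischer.
Context (R : realType) d (T : measurableType d) (mu : {measure set T -> \bar R}).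
Local Notation l2 := (l2 mu).
Local Notation ip := (ip mu).
Implicit Types (u v w : T -> R).

Lemma limn_einf_le (a : nat -> \bar R) (M : \bar R) :
  (\forall k \near \oo, (a k <= M)%E) -> (limn_einf a <= M)%E.
Proof.
move=> H; rewrite limn_einf_lim; apply: lime_le; first exact: is_cvg_einfs.
near=> n; apply: ge_ereal_inf; exists (a n); first by exists n => /=.
by near: n.
Unshelve. all: by end_near. Qed.

(** Fatou: a pointwise limit keeps L^2 distance bounds. *)
Lemma l2_limit_le (u : nat -> T -> R) v w (e : R) :
  (forall k, l2 (u k)) -> l2 v -> measurable_fun [set: T] w ->
  (forall x, u k x @[k --> \oo] --> w x) ->
  (\forall k \near \oo, ip (fun x => u k x - v x) (fun x => u k x - v x) <= e) ->
  (\int[mu]_x ((w x - v x) ^+ 2)%:E <= e%:E)%E.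
Proof.
move=> hu hv mw uw He.
have mF k : measurable_fun [set: T] (fun x => ((u k x - v x) ^+ 2)%:E).
  apply/measurable_EFinP; apply: measurable_funX; apply: measurable_funB.
    exact: l2_measurable (hu k).
  exact: l2_measurable hv.
have := @fatou _ _ _ mu setT measurableT (fun k x => ((u k x - v x) ^+ 2)%:E) mF
  (fun k x _ => ltac:(rewrite lee_fin; exact: sqr_ge0)).
have -> : (\int[mu]_x limn_einf (fun k => ((u k x - v x) ^+ 2)%:E) =
    \int[mu]_x ((w x - v x) ^+ 2)%:E)%E.
  apply: eq_integral => x _; have Hx := uw x.
  have L : (fun k => ((u k x - v x) ^+ 2)%:E) @ \oo --> ((w x - v x) ^+ 2)%:E.
    apply: cvg_EFin; first by near=> k.
    rewrite /= (_ : fine \o _ = fun k => (u k x - v x) ^+ 2) //.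
    rewrite !expr2; apply: (@cvg_comp _ _ _ (fun k => u k x - v x) (fun t => t * t)).
      by apply: cvgB => //; exact: cvg_cst.
    exact: (@continuousM _ _ (fun t : R => t) (fun t => t)).
  by rewrite (is_cvg_limn_einfE (cvgP _ L)); exact: cvg_lim L.
move=> H; apply: le_trans H _; apply: limn_einf_le.
apply: filterS He => k; rewrite -lee_fin -ipE //.
by apply: l2B.
Unshelve. all: by end_near. Qed.

Lemma ip_ae u u' v v' : measurable_fun [set: T] u -> measurable_fun [set: T] u' ->
  measurable_fun [set: T] v -> measurable_fun [set: T] v' ->
  {ae mu, forall x, u x = u' x} -> {ae mu, forall x, v x = v' x} ->
  ip u v = ip u' v'.
Proof.
move=> mu1 mu2 mv1 mv2 uu vv; rewrite /ip /Rintegral; congr fine.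
apply: ae_eq_integral => //; try by apply/measurable_EFinP; exact: measurable_funM.
by apply: filterS2 uu vv => x -> ->.
Qed.

Lemma l2_ae u u' : measurable_fun [set: T] u' -> l2 u ->
  {ae mu, forall x, u x = u' x} -> l2 u'.
Proof.
move=> mu' hu uu; split=> //; apply: le_lt_trans hu.2.
rewrite le_eqVlt; apply/orP; left; apply/eqP; apply: ae_eq_integral => //.
- by apply/measurable_EFinP; exact: measurable_funX.
- by apply/measurable_EFinP; apply: measurable_funX; exact: l2_measurable hu.
- by apply: filterS uu => x ->.
Qed.

Lemma geometric_half n : \sum_(0 <= k < n) 2^-1 ^+ k = 2 - 2 * 2^-1 ^+ n :> R.
Proof.
elim: n => [|n IH]; first by rewrite big_geq // expr0; ring.
by rewrite big_nat_recr //= IH exprS; field.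
Qed.

Lemma geometric_half_lty : (\sum_(k <oo) (2^-1 ^+ k)%:E < +oo :> \bar R)%E.
Proof.
apply: (@le_lt_trans _ _ 2%:E); last exact: ltry.
apply: lime_le; first by apply: is_cvg_nneseries => k _ _; rewrite lee_fin exprn_ge0.
near=> n; rewrite sumEFin lee_fin geometric_half gerBl.
by rewrite mulr_ge0 // exprn_ge0.
Unshelve. all: by end_near. Qed.

(** Completeness of L^2: a subsequence with summable increments converges
   almost everywhere. *)
Lemma riesz_fischer (u : nat -> T -> R) : (forall k, l2 (u k)) ->
  (forall e, 0 < e -> exists N : nat, forall m n, (N <= m)%N -> (N <= n)%N ->
     ip (fun x => u m x - u n x) (fun x => u m x - u n x) <= e) ->
  exists2 w, l2 w &
    ip (fun x => u k x - w x) (fun x => u k x - w x) @[k --> \oo] --> 0.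
Proof.
move=> hu Cu.
have [f Hf] : {f : nat -> nat | forall k m n, (f k <= m)%N -> (f k <= n)%N ->
    ip (fun x => u m x - u n x) (fun x => u m x - u n x) <= 4^-1 ^+ k}.
  have H k := cid (Cu (4^-1 ^+ k) ltac:(by rewrite exprn_gt0)).
  by exists (fun k => sval (H k)) => k; exact: svalP (H k).
pose nn (k : nat) := (\sum_(i < k.+1) (f i).+1)%N.
have nnf k : (f k <= nn k)%N.
  by rewrite /nn big_ord_recr /= (leq_trans (leqnSn _)) // leq_addl.
have nnk k : (k <= nn k)%N.
  elim: k => // k IH; rewrite /nn big_ord_recr /= addnS ltnS.
  exact: leq_trans IH (leq_addr _ _).
have nnS k : (nn k <= nn k.+1)%N by rewrite /nn [leqRHS]big_ord_recr /= leq_addr.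
have nnmono j k : (j <= k)%N -> (nn j <= nn k)%N.
  by elim: k => [|k IH]; [rewrite leqn0 => /eqP ->|rewrite leq_eqVlt => /predU1P[->//|/IH h]; exact: leq_trans h (nnS k)].
pose D k x := u (nn k.+1) x - u (nn k) x.
have hD k : l2 (D k) by exact: l2B.
have D4 k : ip (D k) (D k) <= 4^-1 ^+ k.
  by apply: Hf => //; apply: leq_trans (nnf k) _ => //; exact: nnmono.
(* The squared norm of D k is at most 4^-k, so the weights 2^k keep the series of
   the integrals convergent. *)
pose g k x : \bar R := (2 ^+ k * D k x ^+ 2)%:E.
have mg k : measurable_fun [set: T] (g k).
  apply/measurable_EFinP; apply: measurable_funM => //; apply: measurable_funX.
  exact: l2_measurable (hD k).
have g0 k x : (0 <= g k x)%E by rewrite lee_fin mulr_ge0 ?sqr_ge0 ?exprn_ge0.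
pose G x := (\sum_(k <oo) g k x)%E.
have mG : measurable_fun [set: T] G by apply: ge0_emeasurable_sum => // k x _ _; exact: g0.
have iG : (\int[mu]_x G x < +oo)%E.
  rewrite integral_nneseries; [|exact: measurableT|exact: mg|by move=> k x _; exact: g0].
  apply: (@le_lt_trans _ _ (\sum_(k <oo) (2^-1 ^+ k)%:E)%E).
    apply: lee_nneseries => [k _ _|k _]; first by apply: integral_ge0 => x _; exact: g0.
    rewrite /g; under eq_integral do rewrite EFinM.
    rewrite ge0_integralZl_EFin ?exprn_ge0 //; last 2 first.
    - by move=> x _; rewrite lee_fin sqr_ge0.
    - by apply/measurable_EFinP/measurable_funX; exact: l2_measurable (hD k).
    rewrite ipE // -EFinM lee_fin; apply: le_trans (ler_wpM2l _ (D4 k)) _.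
      by rewrite exprn_ge0.
    by rewrite -exprMn; rewrite (_ : 2 * 4^-1 = 2^-1) //; lra.
  exact: geometric_half_lty.
have G0 x : (0 <= G x)%E by apply: nneseries_ge0 => k _ _; exact: g0.
have iG' : mu.-integrable setT G.
  apply/integrableP; split=> //; apply: le_lt_trans iG.
  by under eq_integral do rewrite gee0_abs //.
pose E := [set x | (G x < +oo)%E].
have mE : measurable E.
  rewrite -[E]setTI; apply: (measurable_lte measurableT) => //.
have aeE : {ae mu, forall x, E x}.
  apply: filterS (integrable_ae measurableT iG') => x /(_ Logic.I).
  by rewrite ge0_fin_numE.
pose v k x := u (nn k) x * \1_E x.
have mv k : measurable_fun [set: T] (v k).
  apply: measurable_funM; first exact: l2_measurable (hu _).
  exact: measurable_indic.
have cv x : cvgn (v^~ x).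
  rewrite /v; have [Ex|Ex] := pselect (E x); last first.
    rewrite (_ : (fun k => _) = cst 0); first exact: is_cvg_cst.
    by apply/funext => k; rewrite indicE memNset // mulr0.
  have -> : (fun k => u (nn k) x * \1_E x) = (fun k => u (nn 0%N) x + series (D^~ x) k).
    apply/funext => k; rewrite indicE mem_set // mulr1 seriesEnat /D.
    by rewrite /= (telescope_sumr (fun j => u (nn j) x)) // addrC subrK.
  apply: is_cvgD; first exact: is_cvg_cst.
  apply: normed_cvg; apply: nondecreasing_is_cvgn.
    by apply/nondecreasing_seqP => k; rewrite /= /series /= big_nat_recr //= lerDl.
  have fG : G x \is a fin_num by rewrite ge0_fin_numE.
  exists (2 + fine (G x)) => _ [k _ <-]; rewrite /= /series /=.
  (* |D j x| <= 2^-j + 2^j * (D j x)^2, and both terms are summable on E. *)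
  apply: (@le_trans _ _ (\sum_(0 <= j < k) (2^-1 ^+ j + 2 ^+ j * D j x ^+ 2))).
    apply: ler_sum => j _; have p0 : 0 < 2 ^+ j :> R by rewrite exprn_gt0.
    have := sqr_ge0 (1 - 2 ^+ j * `|D j x|).
    have -> : (1 - 2 ^+ j * `|D j x|) ^+ 2 =
        2 ^+ j * (2^-1 ^+ j + 2 ^+ j * D j x ^+ 2 - 2 * `|D j x|).
      rewrite exprVn -[D j x ^+ 2]real_normK ?num_real //; field.
      by rewrite gt_eqF.
    rewrite pmulr_rge0 // subr_ge0 => H; apply: le_trans H.
    by rewrite ler_peMl // ler1n.
  rewrite big_split /= geometric_half; apply: lerD.
    by rewrite gerBl mulr_ge0 // exprn_ge0.
  rewrite -lee_fin fineK // -sumEFin; apply: nneseries_lim_ge => j _ _; exact: g0.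
pose w x := limn (v^~ x).
have mw : measurable_fun [set: T] w.
  by apply: (measurable_fun_cvg mv) => x _; exact: cv.
have vu k : {ae mu, forall x, u (nn k) x = v k x}.
  by apply: filterS aeE => x Ex; rewrite /v indicE mem_set // mulr1.
have hv k : l2 (v k) by exact: l2_ae (mv k) (hu (nn k)) (vu k).
have key e N : (forall m n, (N <= m)%N -> (N <= n)%N ->
     ip (fun x => u m x - u n x) (fun x => u m x - u n x) <= e) ->
    forall n, (N <= n)%N -> (\int[mu]_x ((w x - u n x) ^+ 2)%:E <= e%:E)%E.
  move=> HN n Nn; apply: (@l2_limit_le v) => //; near=> k.
  rewrite (@ip_ae _ (fun x => u (nn k) x - u n x) _ (fun x => u (nn k) x - u n x)).
  - by apply: HN => //; apply: leq_trans (nnk k); near: k; exact: nbhs_infty_ge.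
  - by apply: measurable_funB => //; exact: l2_measurable (hu n).
  - by apply: measurable_funB; exact: l2_measurable (hu _).
  - by apply: measurable_funB => //; exact: l2_measurable (hu n).
  - by apply: measurable_funB; exact: l2_measurable (hu _).
  - by apply: filterS (vu k) => x ->.
  - by apply: filterS (vu k) => x ->.
have hw : l2 w.
  have [N HN] := Cu 1 ltr01.
  have h : l2 (fun x => w x - u N x).
    split; first by apply: measurable_funB => //; exact: l2_measurable (hu N).
    by apply: le_lt_trans (key 1 N HN N (leqnn N)) _; rewrite ltry.
  rewrite (_ : w = fun x => (w x - u N x) + u N x); first exact: l2D.
  by apply/funext => x; rewrite subrK.
exists w => //; apply/cvgrPdist_le => e e0.
have [N HN] := Cu e e0; near=> k.
rewrite sub0r normrN ger0_norm ?ip_ge0 // -lee_fin -ipE; last exact: l2B.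
apply: le_trans (key e N HN k _); last by near: k; exact: nbhs_infty_ge.
rewrite le_eqVlt; apply/orP; left; apply/eqP; apply: eq_integral => x _.
by rewrite -sqrrN opprB.
Unshelve. all: by end_near. Qed.

End riesz_fischer.

Section orthonormal_systems.
Context (R : realType) d (T : measurableType d) (mu : {measure set T -> \bar R}).
Local Notation l2 := (l2 mu).
Local Notation ip := (ip mu).
Variable phi : nat -> T -> R.
Hypothesis hphi : forall j, l2 (phi j).
Hypothesis ophi : forall j l, ip (phi j) (phi l) = (j == l)%:R.
Implicit Types (u v w : T -> R) (c : nat -> R).

Definition expansion c N x := \sum_(0 <= j < N) c j * phi j x.

Lemma l2_expansion c N : l2 (expansion c N).
Proof. by apply: l2_sum => j; exact: l2Z. Qed.

Lemma ip_expansion c N u : l2 u ->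
  ip (expansion c N) u = \sum_(0 <= j < N) c j * ip (phi j) u.
Proof.
move=> hu; rewrite ip_suml // => [|j]; last exact: l2Z.
by apply: eq_bigr => j _; rewrite ipZl.
Qed.

Lemma ip_expansion_phi c N k : ip (expansion c N) (phi k) = (k < N)%N%:R * c k.
Proof.
rewrite ip_expansion //; under eq_bigr do rewrite ophi.
have [kN|Nk] := ltnP k N.
  rewrite (bigD1_seq k) ?iota_uniq ?mem_index_iota //= eqxx mulr1 mul1r.
  by rewrite big1 ?addr0 // => j /negbTE ->; rewrite mulr0.
rewrite mul0r big_nat big1 // => j /andP[_ jN].
by rewrite (ltn_eqF (leq_trans jN Nk)) // mulr0.
Qed.

Lemma ip_expansion2 b c N M : (N <= M)%N ->
  ip (expansion b N) (expansion c M) = \sum_(0 <= j < N) b j * c j.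
Proof.
move=> NM; rewrite ip_expansion; last exact: l2_expansion.
rewrite !big_nat; apply: eq_bigr => j /andP[_ jN].
by rewrite ipC ip_expansion_phi (leq_trans jN NM) mul1r.
Qed.

Definition coef u j := ip u (phi j).

Lemma ip_coef_expansion u N : l2 u ->
  ip u (expansion (coef u) N) = \sum_(0 <= j < N) coef u j ^+ 2.
Proof.
move=> hu; rewrite ipC ip_expansion //; apply: eq_bigr => j _.
by rewrite ipC expr2.
Qed.

Lemma bessel u N : l2 u -> \sum_(0 <= j < N) coef u j ^+ 2 <= ip u u.
Proof.
move=> hu; have := ip_ge0 mu (fun x => u x - expansion (coef u) N x).
rewrite ip_sqrB // ?ip_coef_expansion ?ip_expansion2 //; last exact: l2_expansion.
have -> : \sum_(0 <= j < N) coef u j * coef u j = \sum_(0 <= j < N) coef u j ^+ 2.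
  by apply: eq_bigr => j _; rewrite expr2.
lra.
Qed.

Lemma ip_cvg (u : nat -> T -> R) w v : (forall k, l2 (u k)) -> l2 w -> l2 v ->
  ip (fun x => u k x - w x) (fun x => u k x - w x) @[k --> \oo] --> 0 ->
  ip (u k) v @[k --> \oo] --> ip w v.
Proof.
move=> hu hw hv H; apply/cvgrPdist_le => e e0.
have e20 : 0 < e ^+ 2 / (ip v v + 1).
  by rewrite divr_gt0 ?exprn_gt0 // ltr_wpDl // ip_ge0.
move/cvgrPdist_le : H => /(_ _ e20) H; near=> k.
rewrite distrC -ipBl // -ler_sqr ?nnegrE ?(ltW e0) // real_normK ?num_real //.
apply: le_trans (ip_CS _ _) _ => //; first exact: l2B.
have v1 : 0 < ip v v + 1 by rewrite ltr_wpDl // ip_ge0.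
have : ip (fun x => u k x - w x) (fun x => u k x - w x) <= e ^+ 2 / (ip v v + 1).
  rewrite -[leLHS]ger0_norm ?ip_ge0 // -normrN -[- _]sub0r; near: k; exact: H.
rewrite ler_pdivlMr // => H'; apply: le_trans H'.
by apply: ler_wpM2l; [exact: ip_ge0|rewrite lerDl].
Unshelve. all: by end_near. Qed.

(** Square-summable coefficients are the coefficients of a function. *)
Lemma expansion_cvg c (B : R) : (forall N, \sum_(0 <= j < N) c j ^+ 2 <= B) ->
  exists u, [/\ l2 u, forall k, coef u k = c k &
    ip (fun x => expansion c N x - u x) (fun x => expansion c N x - u x) @[N --> \oo] --> 0].
Proof.
move=> bc; pose s N := \sum_(0 <= j < N) c j ^+ 2.
have sm M N : (M <= N)%N -> ip (fun x => expansion c M x - expansion c N x)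
     (fun x => expansion c M x - expansion c N x) = s N - s M.
  move=> MN; rewrite ip_sqrB; try exact: l2_expansion.
  rewrite !ip_expansion2 // /s; under eq_bigr do rewrite -expr2.
  under [X in _ + X]eq_bigr do rewrite -expr2.
  ring.
have nds : nondecreasing_seq s.
  by apply/nondecreasing_seqP => k; rewrite /s big_nat_recr //= lerDl sqr_ge0.
have cs : cvgn s.
  by apply: nondecreasing_is_cvgn => //; exists B => _ [N _ <-]; exact: bc.
have [u hu Hu] : exists2 w, l2 w & ip (fun x => expansion c k x - w x)
    (fun x => expansion c k x - w x) @[k --> \oo] --> 0.
  apply: riesz_fischer => [k|e e0]; first exact: l2_expansion.
  have /cvgrPdist_le/(_ _ e0)[N _ HN] := cs; exists N => m n Nm Nn.
  wlog mn : m n Nm Nn / (m <= n)%N => [H|].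
    have [|/ltnW] := leqP m n; first exact: H.
    move=> nm; apply: le_trans (H n m Nn Nm nm).
    rewrite le_eqVlt; apply/orP; left; apply/eqP; apply: eq_Rintegral => x _.
    by rewrite -mulrNN !opprB.
  rewrite sm //; apply: (@le_trans _ _ (limn s - s m)).
    by apply: lerB => //; exact: (nondecreasing_cvgn_le nds cs n).
  by apply: le_trans (ler_norm _) _; exact: HN.
exists u; split=> // k; have := ip_cvg (l2_expansion c) hu (hphi k) Hu.
rewrite /coef => /cvg_lim <- //; apply: lim_near_cst => //; near=> N.
rewrite ip_expansion_phi (_ : (k < N)%N) ?mul1r //.
by near: N; exact: nbhs_infty_gt.
Unshelve. all: by end_near. Qed.

Hypothesis complete_phi : forall u, l2 u -> (forall j, coef u j = 0) ->
  {ae mu, forall x, u x = 0}.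

Lemma coef_eq_ae u v : l2 u -> l2 v -> (forall j, coef u j = coef v j) ->
  {ae mu, forall x, u x = v x}.
Proof.
move=> hu hv uv; have h : l2 (fun x => u x - v x) by exact: l2B.
apply: filterS (complete_phi h _) => [x /eqP|j]; first by rewrite subr_eq0 => /eqP.
by rewrite /coef ipBl // -/(coef u j) -/(coef v j) uv subrr.
Qed.

Lemma expansion_cvg_self u : l2 u ->
  ip (fun x => u x - expansion (coef u) N x) (fun x => u x - expansion (coef u) N x)
    @[N --> \oo] --> 0.
Proof.
move=> hu; have [v [hv vc Hv]] := expansion_cvg (fun N => bessel N hu).
have uv := coef_eq_ae hu hv (fun j => esym (vc j)).
apply: cvg_trans Hv; apply: near_eq_cvg; near=> N.
have mE := l2_measurable (l2_expansion (coef u) N).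
have [mu_ mv_] := (l2_measurable hu, l2_measurable hv).
rewrite (@ip_ae _ _ _ _ (fun x => u x - expansion (coef u) N x)
  (fun x => v x - expansion (coef u) N x) (fun x => u x - expansion (coef u) N x)
  (fun x => v x - expansion (coef u) N x)); try exact: measurable_funB.
- by apply: eq_Rintegral => x _; rewrite -mulrNN !opprB.
- by apply: filterS uv => x ->.
- by apply: filterS uv => x ->.
Unshelve. all: by end_near. Qed.

Lemma parseval u v : l2 u -> l2 v ->
  \sum_(0 <= j < N) coef u j * coef v j @[N --> \oo] --> ip u v.
Proof.
move=> hu hv; have := expansion_cvg_self hu.
have -> : (fun N => ip (fun x => u x - expansion (coef u) N x)
    (fun x => u x - expansion (coef u) N x)) =
  (fun N => ip (fun x => expansion (coef u) N x - u x) (fun x => expansion (coef u) N x - u x)).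
  by apply/funext => N; apply: eq_Rintegral => x _; rewrite -mulrNN !opprB.
move=> /(ip_cvg (l2_expansion _) hu hv); apply: cvg_trans; apply: near_eq_cvg; near=> N.
by rewrite ip_expansion //; apply: eq_bigr => j _; rewrite [ip (phi j) v]ipC.
Unshelve. all: by end_near. Qed.

End orthonormal_systems.

(** * Spectral bounds for fractional powers *)

Section interpolation.
Variable R : realType.
Implicit Types (s l m x y : R).

Lemma expR_jensen (t x y : R) : 0 <= t <= 1 ->
  expR (t * x + (1 - t) * y) <= t * expR x + (1 - t) * expR y.
Proof.
move=> /andP[t0 t1]; set z := t * x + (1 - t) * y.
have tangent a : expR z * (1 + (a - z)) <= expR a.
  rewrite -[in leRHS](subrK z a) [expR (a - z + z)]expRD mulrC.
  by apply: ler_wpM2r; rewrite ?expR_ge0 // expR_ge1Dx.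
have -> : expR z = t * (expR z * (1 + (x - z))) + (1 - t) * (expR z * (1 + (y - z))).
  by rewrite /z; ring.
by apply: lerD; apply: ler_wpM2l; rewrite ?subr_ge0.
Qed.

Lemma powR_expR (l x : R) : 0 < l -> l `^ x = expR (x * ln l).
Proof. by move=> l0; rewrite /powR gt_eqF. Qed.

(** Weighted AM-GM for l^(2-s) = (m^(1-s) * l)^s * (m^(-s) * l^2)^(1-s); there
   is equality at l = m. *)
Lemma powR_upper s l m : 0 < s < 1 -> 0 < l -> 0 < m ->
  l `^ (2 - s) <= s * m `^ (1 - s) * l + (1 - s) * m `^ (- s) * l ^+ 2.
Proof.
move=> /andP[s0 s1] l0 m0.
have -> : s * m `^ (1 - s) * l + (1 - s) * m `^ (- s) * l ^+ 2 =
    s * expR ((1 - s) * ln m + ln l) + (1 - s) * expR ((- s) * ln m + ln l + ln l).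
  by rewrite !expRD !lnK ?posrE // !powR_expR // expr2 !mulrA.
rewrite powR_expR //; have -> : (2 - s) * ln l = s * ((1 - s) * ln m + ln l) +
   (1 - s) * ((- s) * ln m + ln l + ln l) by ring.
by apply: expR_jensen; rewrite !ltW.
Qed.

(** The convex function l^(2-s) lies above its tangent at l = m. *)
Lemma powR_lower s l m : 0 < s < 1 -> 0 < l -> 0 < m ->
  (2 - s) * m `^ (1 - s) * l - (1 - s) * m `^ (2 - s) <= l `^ (2 - s).
Proof.
move=> /andP[s0 s1] l0 m0; have s2 : 0 < 2 - s by lra.
have s20 : 2 - s != 0 by rewrite gt_eqF.
have := @expR_jensen (2 - s)^-1 ((2 - s) * ln l) ((2 - s) * ln m) _.
have -> : (2 - s)^-1 * ((2 - s) * ln l) + (1 - (2 - s)^-1) * ((2 - s) * ln m) =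
    ln l + (1 - s) * ln m by field.
rewrite expRD lnK ?posrE // -!powR_expR // => H.
have {}H : l * m `^ (1 - s) <= (2 - s)^-1 * l `^ (2 - s) + (1 - (2 - s)^-1) * m `^ (2 - s).
  by apply: H; rewrite invr_ge0 ltW //= invf_le1 //; lra.
have := ler_wpM2l (ltW s2) H.
have -> : (2 - s) * ((2 - s)^-1 * l `^ (2 - s) + (1 - (2 - s)^-1) * m `^ (2 - s)) =
   l `^ (2 - s) + (1 - s) * m `^ (2 - s) by field.
lra.
Qed.

Lemma sqrD_upper (a b e : R) : 0 < e ->
  (a + b) ^+ 2 <= (1 + e) * a ^+ 2 + (1 + e^-1) * b ^+ 2.
Proof.
move=> e0; rewrite -subr_ge0.
have -> : (1 + e) * a ^+ 2 + (1 + e^-1) * b ^+ 2 - (a + b) ^+ 2 = e^-1 * (e * a - b) ^+ 2.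
  by field; rewrite gt_eqF.
by rewrite mulr_ge0 ?sqr_ge0 // invr_ge0 ltW.
Qed.

Lemma sqrD_lower (a b e : R) : 0 < e ->
  (1 - e) * a ^+ 2 - e^-1 * b ^+ 2 <= (a + b) ^+ 2.
Proof.
move=> e0; rewrite -subr_ge0.
have -> : (a + b) ^+ 2 - ((1 - e) * a ^+ 2 - e^-1 * b ^+ 2) = e^-1 * (e * a + b) ^+ 2 + b ^+ 2.
  by field; rewrite gt_eqF.
by rewrite addr_ge0 ?sqr_ge0 // mulr_ge0 ?sqr_ge0 // invr_ge0 ltW.
Qed.

End interpolation.

Section fractional_powers.
Context (R : realType) d (T : measurableType d) (mu : {measure set T -> \bar R}).
Local Notation l2 := (l2 mu).
Local Notation ip := (ip mu).
Variables (phi : nat -> T -> R) (lam : nat -> R) (s : R).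
Local Notation coef := (coef mu phi).
Local Notation expansion := (expansion phi).
Hypothesis hphi : forall j, l2 (phi j).
Hypothesis ophi : forall j l, ip (phi j) (phi l) = (j == l)%:R.
Hypothesis complete_phi : forall u, l2 u -> (forall j, coef u j = 0) ->
  {ae mu, forall x, u x = 0}.
Hypothesis lam0 : lam 0%N = 0.
Hypothesis lam1 : 0 < lam 1%N.
Hypothesis lamS : forall j, (1 <= j)%N -> lam j <= lam j.+1.
Hypothesis s01 : 0 < s < 1.
Implicit Types (h u v V : T -> R).

Lemma lam_ge j : (1 <= j)%N -> lam 1%N <= lam j.
Proof.
elim: j => // -[_ _|j IH _]; first exact: lexx.
exact: le_trans (IH isT) (lamS _).
Qed.

Lemma lam_gt0 j : (1 <= j)%N -> 0 < lam j.
Proof. by move=> j1; exact: lt_le_trans lam1 (lam_ge j1). Qed.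

Lemma powR_lamK j (x : R) : (1 <= j)%N -> lam j `^ (- x) * lam j `^ x = 1.
Proof. by move=> j1; rewrite -powRD ?addNr ?powRr0 // lt0r_neq0 ?lam_gt0 ?implybT. Qed.

Lemma powR_lam_le j : (1 <= j)%N -> lam j `^ (- s) <= lam 1%N `^ (- s).
Proof.
move=> j1; rewrite !powR_expR ?lam_gt0 // ler_expR.
rewrite !mulNr lerN2; apply: ler_wpM2l; first by case/andP: s01 => /ltW.
by rewrite ler_ln ?posrE ?lam_gt0 // lam_ge.
Qed.

Definition frac_sum u N x := \sum_(1 <= j < N) (lam j `^ s * coef u j * phi j x).

Lemma frac_sumE u N x :
  frac_sum u N x = expansion (fun j => if j == 0%N then 0 else lam j `^ s * coef u j) N x.
Proof.
rewrite /frac_sum /expansion; case: N => [|N]; first by rewrite !big_geq.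
rewrite [RHS]big_ltn //= mul0r add0r; rewrite !big_nat.
by apply: eq_bigr => j /andP[j1 _]; rewrite gtn_eqF.
Qed.

Lemma fractional_coef u h : l2 u -> l2 h ->
  ip (fun x => h x - frac_sum u N x) (fun x => h x - frac_sum u N x) @[N --> \oo] --> 0 ->
  forall k, coef h k = if k == 0%N then 0 else lam k `^ s * coef u k.
Proof.
move=> hu hh H k; set c := fun k => if k == 0%N then 0 else lam k `^ s * coef u k.
have {}H : ip (fun x => expansion c N x - h x) (fun x => expansion c N x - h x) @[N --> \oo] --> 0.
  apply: cvg_trans H; apply: near_eq_cvg; near=> N; apply: eq_Rintegral => x _.
  by rewrite frac_sumE -mulrNN !opprB.
suff E : ip h (phi k) = c k by exact: E.
move: H => /(ip_cvg (l2_expansion hphi c) hh (hphi k)) /cvg_lim <- //.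
apply: lim_near_cst => //; near=> N.
rewrite ip_expansion_phi // (_ : (k < N)%N) ?mul1r //.
by near: N; exact: nbhs_infty_gt.
Unshelve. all: by end_near. Qed.

(** The solution is the series with coefficients lam^-s times those of h. *)
Lemma fractional_solution h : l2 h -> coef h 0 = 0 ->
  exists u, [/\ l2 u, coef u 0 = 0 &
  ip (fun x => h x - frac_sum u N x) (fun x => h x - frac_sum u N x) @[N --> \oo] --> 0].
Proof.
move=> hh h0; pose c j := if j == 0%N then 0 else lam j `^ (- s) * coef h j.
have [N|u [hu cu _]] := @expansion_cvg _ _ _ mu phi hphi ophi c (lam 1%N `^ (- s) ^+ 2 * ip h h).
  apply: (@le_trans _ _ (lam 1%N `^ (- s) ^+ 2 * \sum_(0 <= j < N) coef h j ^+ 2)); last first.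
    by apply: ler_wpM2l; [exact: sqr_ge0|exact: bessel].
  rewrite mulr_sumr; apply: ler_sum => -[|j] _; rewrite /c /=.
    by rewrite expr0n mulr_ge0 ?sqr_ge0.
  rewrite exprMn; apply: ler_wpM2r; first exact: sqr_ge0.
  by rewrite ler_sqr ?nnegrE ?powR_ge0 // powR_lam_le.
exists u; split=> //.
have := expansion_cvg_self hphi ophi complete_phi hh.
apply: cvg_trans; apply: near_eq_cvg; near=> N; apply: eq_Rintegral => x _.
rewrite !frac_sumE; have -> // : (fun j => if j == 0%N then 0 else lam j `^ s * coef u j) = coef h.
apply/funext => -[|j] /=; first by rewrite h0.
by rewrite cu /c /= mulrA (mulrC (_ `^ s)) powR_lamK // mul1r.
Unshelve. all: by end_near. Qed.

Section quadratic_form.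
Variables (u h v V r : T -> R) (t mm e : R).
Hypotheses (hu : l2 u) (hh : l2 h) (hv : l2 v) (hV : l2 V) (hr : l2 r).
Hypothesis Hh : ip (fun x => h x - frac_sum u N x) (fun x => h x - frac_sum u N x)
   @[N --> \oo] --> 0.
Hypothesis HV : forall k, coef V k = lam k * coef v k.
Hypothesis Hr : forall k, coef h k = t^-1 * coef V k + coef r k.
Hypotheses (mm0 : 0 < mm) (e0 : 0 < e < 1).

Let form_cvg : \sum_(0 <= j < N) coef h j * coef u j @[N --> \oo] --> ip h u.
Proof. exact: (parseval hphi ophi complete_phi hh hu). Qed.

Let term j : (1 <= j)%N -> coef h j * coef u j = lam j `^ (- s) * coef h j ^+ 2.
Proof.
move=> j1; rewrite (fractional_coef hu hh Hh) gtn_eqF // expr2 !mulrA.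
by rewrite powR_lamK // mul1r; ring.
Qed.

Let term0 : coef h 0 * coef u 0 = 0.
Proof. by rewrite (fractional_coef hu hh Hh) eqxx mul0r. Qed.

Let pow2 j : (1 <= j)%N -> lam j `^ (- s) * lam j ^+ 2 = lam j `^ (2 - s).
Proof.
move=> j1; rewrite -powR_mulrn ?(ltW (lam_gt0 j1)) // -powRD 1?addrC //.
by rewrite lt0r_neq0 ?lam_gt0 ?implybT.
Qed.

(** In coefficients ip h u is the sum of the lam^(-s) * h^2. With h = V / t +
   r and V = lam * v, its main part is the sum of the lam^(2-s) * v^2 / t^2.
   Bounding lam^(2-s) by a combination of lam and lam^2 that is sharp at lam =
   mm leaves ip V v and ip V V, in which the spectrum does not occur any more.
   *)
Lemma fractional_form_upper :
  ip h u <= (1 + e) * t^-1 ^+ 2 * (s * mm `^ (1 - s) * ip V v + (1 - s) * mm `^ (- s) * ip V V)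
    + (1 + e^-1) * lam 1%N `^ (- s) * ip r r.
Proof.
have [e1 _] := andP e0.
pose A := (1 + e) * t^-1 ^+ 2; pose B := (1 + e^-1) * lam 1%N `^ (- s).
have A0 : 0 <= A by rewrite mulr_ge0 ?sqr_ge0 //; lra.
have B0 : 0 <= 1 + e^-1 by rewrite addr_ge0 // invr_ge0 ltW.
pose S N := A * (s * mm `^ (1 - s) * (\sum_(0 <= j < N) coef V j * coef v j) +
    (1 - s) * mm `^ (- s) * (\sum_(0 <= j < N) coef V j * coef V j)) +
    B * (\sum_(0 <= j < N) coef r j * coef r j).
have cS : S @ \oo --> A * (s * mm `^ (1 - s) * ip V v + (1 - s) * mm `^ (- s) * ip V V) + B * ip r r.
  apply: cvgD; apply: cvgM; try exact: cvg_cst.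
    apply: cvgD; apply: cvgM; try exact: cvg_cst; exact: (parseval hphi ophi complete_phi).
  exact: (parseval hphi ophi complete_phi).
apply: (ler_cvg_to form_cvg cS); near=> N.
rewrite /S !mulr_sumr -!big_split /= mulr_sumr -big_split /=.
apply: ler_sum => -[|j] _.
  rewrite term0 HV lam0 !mul0r !mulr0 add0r mulr0 add0r.
  by apply: mulr_ge0; [rewrite mulr_ge0 ?powR_ge0|rewrite -expr2 sqr_ge0].
have lj := lam_gt0 (ltn0Sn j).
rewrite term // Hr; set a := coef V j.+1; set b := coef r j.+1; set w := coef v j.+1.
have aw : a = lam j.+1 * w by exact: HV.
apply: (@le_trans _ _ (lam j.+1 `^ (- s) * ((1 + e) * (t^-1 * a) ^+ 2 + (1 + e^-1) * b ^+ 2))).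
  by apply: ler_wpM2l; [exact: powR_ge0|exact: sqrD_upper].
rewrite mulrDr; apply: lerD; last first.
  rewrite mulrCA /B -mulrA; apply: ler_wpM2l => //; rewrite expr2.
  by apply: ler_wpM2r; [rewrite -expr2 sqr_ge0|exact: powR_lam_le].
have -> : lam j.+1 `^ (- s) * ((1 + e) * (t^-1 * a) ^+ 2) =
    A * (w ^+ 2 * (lam j.+1 `^ (- s) * lam j.+1 ^+ 2)) by rewrite aw /A; ring.
apply: ler_wpM2l => //; rewrite pow2 //.
have := ler_wpM2l (sqr_ge0 w) (powR_upper s01 lj mm0).
congr (_ <= _); rewrite aw; ring.
Unshelve. all: by end_near. Qed.

(** As above, with the tangent of lam^(2-s) at mm, which is a combination of
   lam and 1. *)
Lemma fractional_form_lower :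
  (1 - e) * t^-1 ^+ 2 * ((2 - s) * mm `^ (1 - s) * ip V v - (1 - s) * mm `^ (2 - s) * ip v v)
    - e^-1 * lam 1%N `^ (- s) * ip r r <= ip h u.
Proof.
have [e1 e2] := andP e0; have [s0 s1] := andP s01.
pose A := (1 - e) * t^-1 ^+ 2; pose B := e^-1 * lam 1%N `^ (- s).
have A0 : 0 <= A by rewrite mulr_ge0 ?sqr_ge0 //; lra.
have B0 : 0 <= e^-1 by rewrite invr_ge0 ltW.
pose S N := A * ((2 - s) * mm `^ (1 - s) * (\sum_(0 <= j < N) coef V j * coef v j) -
    (1 - s) * mm `^ (2 - s) * (\sum_(0 <= j < N) coef v j * coef v j)) -
    B * (\sum_(0 <= j < N) coef r j * coef r j).
have cS : S @ \oo --> A * ((2 - s) * mm `^ (1 - s) * ip V v - (1 - s) * mm `^ (2 - s) * ip v v) - B * ip r r.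
  apply: cvgB; apply: cvgM; try exact: cvg_cst.
    apply: cvgB; apply: cvgM; try exact: cvg_cst; exact: (parseval hphi ophi complete_phi).
  exact: (parseval hphi ophi complete_phi).
apply: (ler_cvg_to cS form_cvg); near=> N.
rewrite /S !mulr_sumr -!sumrB /= mulr_sumr -sumrB /=.
apply: ler_sum => -[|j] _.
  rewrite term0 HV lam0 !mul0r !mulr0 sub0r -expr2 -[coef r 0 * _]expr2.
  rewrite subr_le0; apply: (@le_trans _ _ 0).
    rewrite mulrN oppr_le0; apply: mulr_ge0 => //; apply: mulr_ge0; last exact: sqr_ge0.
    by rewrite mulr_ge0 ?powR_ge0 // subr_ge0 ltW.
  by apply: mulr_ge0; [rewrite mulr_ge0 ?powR_ge0|exact: sqr_ge0].
have lj := lam_gt0 (ltn0Sn j).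
rewrite term // Hr; set a := coef V j.+1; set b := coef r j.+1; set w := coef v j.+1.
have aw : a = lam j.+1 * w by exact: HV.
apply: (@le_trans _ _ (lam j.+1 `^ (- s) * ((1 - e) * (t^-1 * a) ^+ 2 - e^-1 * b ^+ 2))); last first.
  by apply: ler_wpM2l; [exact: powR_ge0|exact: sqrD_lower].
rewrite [leRHS]mulrBr; apply: lerB; last first.
  rewrite mulrCA /B -mulrA; apply: ler_wpM2l => //; rewrite expr2.
  by apply: ler_wpM2r; [rewrite -expr2 sqr_ge0|exact: powR_lam_le].
have -> : lam j.+1 `^ (- s) * ((1 - e) * (t^-1 * a) ^+ 2) =
    A * (w ^+ 2 * (lam j.+1 `^ (- s) * lam j.+1 ^+ 2)) by rewrite aw /A; ring.
apply: ler_wpM2l => //; rewrite pow2 //.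
have := ler_wpM2l (sqr_ge0 w) (powR_lower s01 lj mm0).
congr (_ <= _); rewrite aw; ring.
Unshelve. all: by end_near. Qed.

End quadratic_form.
End fractional_powers.

(** * Change of variables for measures *)

Section transfer.
Context (R : realType) d d' (X : measurableType d) (Y : measurableType d').
Variables (mu : {measure set X -> \bar R}) (nu : {measure set Y -> \bar R}).
Variables (D : set X) (U : set Y) (q : Y -> X) (rho : Y -> R).
Hypotheses (mD : measurable D) (mU : measurable U).
Hypothesis mq : measurable_fun U q.
Hypothesis qD : forall y, U y -> D (q y).
Hypotheses (mrho : measurable_fun U rho) (rho0 : forall y, U y -> 0 <= rho y).
Hypothesis muE : forall A, measurable A -> A `<=` D ->
  (mu A = \int[nu]_(y in U) (\1_A (q y) * rho y)%:E)%E.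
Local Open Scope ereal_scope.
Import HBNNSimple.

Let mF (F : X -> \bar R) : measurable_fun setT F ->
  measurable_fun U (fun y => F (q y) * (rho y)%:E).
Proof.
move=> mF; apply: emeasurable_funM; last exact/measurable_EFinP.
exact: (measurable_comp measurableT _ mF mq).
Qed.

Let transfer_nnsfun (f : {nnsfun X >-> R}) :
  \int[mu]_(x in D) (f x)%:E = \int[nu]_(y in U) ((f (q y))%:E * (rho y)%:E).
Proof.
have mk k : measurable (f @^-1` [set k]) by exact: measurable_funPTI.
transitivity (\sum_(k \in range f) (k%:E * mu (f @^-1` [set k] `&` D))).
  under eq_integral do rewrite fimfunE -fsumEFin//.
  rewrite ge0_integral_fsum//; last 2 first.
  - by move=> y; exact/measurable_EFinP/measurable_funM.
  - by move=> y x _; rewrite nnfun_muleindic_ge0.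
  by apply: eq_fsbigr => r _; rewrite integralZl_indic_nnsfun// integral_indic//=.
transitivity (\sum_(k \in range f)
    \int[nu]_(y in U) (k%:E * (\1_(f @^-1` [set k] `&` D) (q y) * rho y)%:E)).
  apply: eq_fsbigr => k kf; rewrite muE; last by move=> x [].
    rewrite ge0_integralZl_EFin //.
    - move=> y Uy; rewrite lee_fin mulr_ge0 //; exact: rho0.
    - apply/measurable_EFinP; apply: measurable_funM => //.
      apply: (measurable_comp measurableT) => //.
      by apply: measurable_indic; exact: measurableI.
    - by move: kf; rewrite inE => -[x _ <-]; exact: fun_ge0.
  exact: measurableI.
rewrite -ge0_integral_fsum //.
- apply: eq_integral => y; rewrite inE => Uy.
  rewrite [in RHS]fimfunE -fsumEFin // ge0_mule_fsuml; last first.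
    by move=> k; rewrite EFinM nnfun_muleindic_ge0.
  apply: eq_fsbigr => k _; rewrite -!EFinM -mulrA; congr (_ * (_ * _))%:E.
  rewrite !indicE in_setI; congr (nat_of_bool _)%:R.
  by rewrite [X in _ && X]mem_set ?andbT //; exact: qD.
- move=> k; apply: emeasurable_funM => //; apply/measurable_EFinP.
  apply: measurable_funM => //; apply: (measurable_comp measurableT) => //.
  by apply: measurable_indic; exact: measurableI.
- move=> k y Uy; rewrite indicE.
  case: (boolP (q y \in _)) => [|_]; last by rewrite mul0r mule0.
  rewrite inE => -[/= <- _]; rewrite mul1r -EFinM lee_fin mulr_ge0 //.
  exact: rho0.
Qed.

(** The hypothesis muE is the formula for indicator functions; it extends to
   simple functions by linearity and to all nonnegative functions by monotone
   convergence. *)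
Lemma ge0_integral_transfer (F : X -> \bar R) : measurable_fun setT F ->
  (forall x, 0 <= F x) ->
  \int[mu]_(x in D) F x = \int[nu]_(y in U) (F (q y) * (rho y)%:E).
Proof.
move=> mF_ F0; pose f_ := nnsfun_approx measurableT mF_.
have cf x : (f_ n x)%:E @[n --> \oo] --> F x by apply: cvg_nnsfun_approx.
transitivity (limn (fun n => \int[mu]_(x in D) (f_ n x)%:E)).
  rewrite -monotone_convergence//.
  - by apply: eq_integral => y _; apply/esym/cvg_lim => //; exact: cf.
  - by move=> n; apply: measurable_funTS; exact/measurable_EFinP.
  - by move=> n y _; rewrite lee_fin.
  - by move=> y _ m n mn; rewrite lee_fin; exact/lefP/nd_nnsfun_approx.
under eq_fun do rewrite transfer_nnsfun.
rewrite -monotone_convergence//.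
- apply: eq_integral => y; rewrite inE => Uy; apply/cvg_lim => //.
  by apply: cvgeZr => //; exact: cf.
- by move=> n; apply: (mF (F := fun x => (f_ n x)%:E)); exact/measurable_EFinP.
- by move=> n y Uy; rewrite mule_ge0 ?lee_fin //; exact: rho0.
- move=> y Uy m n mn; apply: lee_wpmul2r; first by rewrite lee_fin; exact: rho0.
  by rewrite lee_fin; exact/lefP/nd_nnsfun_approx.
Qed.

Lemma integral_transfer (F : X -> R) : measurable_fun setT F ->
  (\int[mu]_(x in D) F x = \int[nu]_(y in U) (F (q y) * rho y))%R.
Proof.
move=> mF_; have mE : measurable_fun [set: X] (EFin \o F) by exact/measurable_EFinP.
rewrite /Rintegral; congr fine; rewrite [LHS]integralE [RHS]integralE.
congr (_ - _).
- rewrite ge0_integral_transfer //; last exact: measurable_funepos.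
  apply: eq_integral => y; rewrite inE => Uy; rewrite !funeposE /=.
  rewrite -[maxe (F (q y))%:E _]EFin_max -[maxe _ _]EFin_max -EFinM.
  by rewrite maxr_pMl ?mul0r //; exact: rho0.
- rewrite ge0_integral_transfer //; last exact: measurable_funeneg.
  apply: eq_integral => y; rewrite inE => Uy; rewrite !funenegE /=.
  rewrite -[maxe (- F (q y))%:E _]EFin_max -[maxe _ _]EFin_max -EFinM.
  by rewrite maxr_pMl ?mul0r ?mulNr //; exact: rho0.
Qed.

End transfer.

(** * Positive definite matrices *)

Section positive_definite.
Variable R : realType.

Definition posdef n (A : 'M[R]_n) := forall v : 'rV_n, v != 0 -> 0 < (v *m A *m v^T) 0 0.

Lemma posdef_unit n (A : 'M[R]_n) : posdef A -> \det A != 0.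
Proof.
move=> pA; rewrite -unitfE -[_ \is a _]/(A \in unitmx) -row_free_unit -kermx_eq0.
apply/eqP/row_matrixP => i; apply/eqP; rewrite row0; apply: contraT => v0.
have := pA _ v0; rewrite -row_mul mulmx_ker row0 mul0mx mxE ltxx //.
Qed.

Lemma mul_rV_tr_ge0 n (v : 'rV[R]_n) : v != 0 -> 0 < (v *m v^T) 0 0.
Proof.
move=> v0; rewrite mxE.
have [i vi] : exists i, v 0 i != 0.
  apply/existsP; rewrite -negb_forall; apply: contra v0 => /forallP H.
  by apply/eqP/rowP => j; rewrite mxE; exact/eqP.
rewrite (bigD1 i) //= mxE ltr_pwDl //.
  by rewrite lt_def mulf_neq0 //= -expr2 sqr_ge0.
by apply: sumr_ge0 => j _; rewrite mxE -expr2 sqr_ge0.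
Qed.

(** Along the segment from the identity to A the determinant has no zero. *)
Lemma posdef_det n (A : 'M[R]_n) : posdef A -> 0 < \det A.
Proof.
move=> pA; pose P : {poly R} := \det ((1 - 'X)%:M + 'X *: map_mx polyC A).
have PE t : P.[t] = \det ((1 - t)%:M + t *: A).
  rewrite -[P.[t]]/(horner_eval t P) -det_map_mx; congr (\det _).
  apply/matrixP => i j; rewrite !mxE.
  rewrite -[LHS]/(((1 - 'X) *+ (i == j) + 'X * (A i j)%:P).[t]).
  by rewrite !(hornerD, hornerN, hornerMn, hornerM, hornerC, hornerX).
have pt t : 0 <= t <= 1 -> posdef ((1 - t)%:M + t *: A).
  move=> /andP[t0 t1] v v0.
  have -> : v *m ((1 - t)%:M + t *: A) *m v^T =
      (1 - t) *: (v *m v^T) + t *: (v *m A *m v^T).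
    by rewrite mulmxDr mulmxDl mul_mx_scalar -scalemxAr -!scalemxAl.
  rewrite mxE [X in X + _]mxE [X in _ + X]mxE.
  have := pA v v0; have := mul_rV_tr_ge0 v0; set a := (_ 0 0); set b := (_ 0 0) => a0 b0.
  have [->|t1'] := eqVneq t 1; first by rewrite subrr mul0r add0r mul1r.
  by rewrite ltr_pwDl ?mulr_ge0 ?(ltW b0) // mulr_gt0 // subr_gt0 lt_def eq_sym t1'.
have P0 : P.[0] = 1 by rewrite PE subr0 scale0r addr0 det1.
have P1 : P.[1] = \det A by rewrite PE subrr scale1r raddf0 add0r.
rewrite ltNge; apply/negP => dA.
have [x /andP[x0 x1] /rootP Px] : exists2 x, 0 <= x <= 1 & root (- P) x.
  have [|x] := @poly_ivt R (- P) 0 1 ler01; last by exists x.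
  by rewrite !hornerN P0 P1 oppr_le0 ler01 oppr_ge0.
move: Px; rewrite hornerN => /eqP; rewrite oppr_eq0 PE.
by apply/negP; apply: posdef_unit; apply: pt; rewrite x0.
Qed.

Lemma posdef_unitmx n (A : 'M[R]_n) : posdef A -> A \in unitmx.
Proof. by move=> /posdef_det dA; rewrite unitmxE unitfE gt_eqF. Qed.

Lemma invmx_sym n (A : 'M[R]_n) : A^T = A -> (invmx A)^T = invmx A.
Proof. by move=> sA; rewrite trmx_inv sA. Qed.

Lemma posdef_inv n (A : 'M[R]_n) : A^T = A -> posdef A -> posdef (invmx A).
Proof.
move=> sA pA v v0; have uA := posdef_unitmx pA.
have w0 : v *m invmx A != 0.
  apply: contra v0 => /eqP w0; apply/eqP.
  by rewrite -[v](mulmxKV uA) w0 mul0mx.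
by have := pA _ w0; rewrite trmx_mul invmx_sym // mulmxKV // mulmxA.
Qed.

End positive_definite.

(** * Charts *)

Section local_regularity.
Context (R : realType) (n : nat).
Implicit Types (f v : 'rV[R]_n -> R) (U K : set 'rV[R]_n).

Lemma Ck_local k U f :
  (forall y, U y -> exists2 V : set 'rV[R]_n, V y & Ck k V f) -> Ck k U f.
Proof.
elim: k f => [|k IH] f H.
  by move=> y Uy; have [V Vy] := H y Uy; apply.
move=> i; split=> [y Uy|].
  by have [V Vy CV] := H y Uy; exact: (CV i).1.
by apply: IH => y Uy; have [V Vy CV] := H y Uy; exists V => //; exact: (CV i).2.
Qed.

Lemma Ck_subset k U V f : V `<=` U -> Ck k U f -> Ck k V f.
Proof. by move=> VU CU; apply: Ck_local => y /VU Uy; exists U. Qed.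

Lemma compact_in_cube K : compact K -> exists2 r : R, 0 <= r & K `<=` @cube R n r.
Proof.
move=> cK; have [r [_ rK]] := compact_bounded cK.
exists (`|r| + 1); first by rewrite addr_ge0.
move=> y Ky i; apply: le_trans (coord_ler_norm y i) _.
by apply: rK => //; rewrite (le_lt_trans (ler_norm r)) // ltrDl.
Qed.

Lemma compact_rV_closed K : compact K -> closed K.
Proof. by apply: compact_closed; exact: norm_hausdorff. Qed.

(** At a point off K, which is closed, f vanishes in a neighbourhood. *)
Lemma Ck_extend k U K f : open U -> compact K -> K `<=` U ->
  (forall y, ~ K y -> f y = 0) -> Ck k U f -> Ck k setT f.
Proof.
move=> oU cK KU f0 Cf; apply: Ck_local => y _.
have [Ky|nKy] := pselect (K y); first by exists U => //; exact: KU.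
exists (~` K) => //.
have oK : open (~` K) by rewrite openC; exact: compact_rV_closed.
apply: (@eq_Ck _ _ _ oK k (fun=> 0)) => [z Kz|]; first by rewrite f0.
exact: Ck_cst.
Qed.

Lemma partial_off K f i y : closed K -> (forall z, ~ K z -> f z = 0) -> ~ K y ->
  partial i f y = 0.
Proof.
move=> cK f0 Ky; have oK : open (~` K) by rewrite openC.
by rewrite (partial_eq oK (g := fun=> 0)) ?partial_cst.
Qed.

Definition ccube (c : 'rV[R]_n) (r : R) : set 'rV[R]_n :=
  [set y | forall i, `|y 0 i - c 0 i| <= r].

Lemma ccube_compact c r : compact (ccube c r).
Proof.
have := @rV_compact R n (fun i => `[c 0 i - r, c 0 i + r]%classic)
  (fun=> @segment_compact _ _ _).
congr compact; apply/seteqP; split => y /= H i; have := H i.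
  by rewrite /= in_itv /= ler_distl.
by rewrite /= in_itv /= ler_distl.
Qed.

Lemma ball_ccube c r : ball c r `<=` ccube c r.
Proof. by move=> y /rV_ballE[_ H] i; rewrite distrC ltW. Qed.

Lemma ccube_sub_nbhs (A : set 'rV[R]_n) c : nbhs c A -> exists2 r : R, 0 < r & ccube c r `<=` A.
Proof.
move=> /nbhs_ballP[e /= e0 eA]; exists (e / 2); first exact: divr_gt0.
move=> y H; apply: eA; apply/rV_ballE; split=> // i.
by rewrite distrC (le_lt_trans (H i)) // ltr_pdivrMr // ltr_pMr // ltr1n.
Qed.

Lemma open_preimage_on (T T' : topologicalType) (A : set T) (B : set T') (f : T -> T') :
  open A -> (forall x, A x -> {for x, continuous f}) -> open B ->
  open (A `&` f @^-1` B).
Proof.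
move=> oA cf oB; rewrite openE => x [Ax Bx]; apply: filterI.
  exact: open_nbhs_nbhs.
by apply: (cf x Ax); exact: open_nbhs_nbhs.
Qed.

End local_regularity.

Section charts.
Context (R : realType) (n : nat) (M : manifold R n).
Implicit Types (p q : chart R n M) (x : M) (H : 'rV[R]_n -> R).

(** The coordinate map of p. The change of coordinates transition p q is
   convertible to the composite of p and cinv q. *)
Definition cinv p x : 'rV[R]_n := xget 0 [set y | dom p y /\ p y = x].

(** A function of the coordinates, extended by zero to the manifold. *)
Definition of_coords p H x : R := if x \in (p @` dom p : set M) then H (cinv p x) else 0.

Lemma cinvP p x : (p @` dom p) x -> dom p (cinv p x) /\ p (cinv p x) = x.
Proof. by move=> [y dy pyx]; rewrite /cinv; case: xgetP => [z -> //|/(_ y)]; case. Qed.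

Section chart.
Variables (p : chart R n M).
Hypothesis ap : atlas p.

Lemma dom_open : open (dom p). Proof. by have [] := atlas_chart ap. Qed.

Lemma par_continuous y : dom p y -> {for y, continuous p}.
Proof. by have [_ _ H _] := atlas_chart ap; exact: H. Qed.

Lemma image_open V : open V -> V `<=` dom p -> open (p @` V).
Proof. by have [_ _ _] := atlas_chart ap; apply. Qed.

Lemma cinvK y : dom p y -> cinv p (p y) = y.
Proof.
move=> dy; have [|dz E] := @cinvP p (p y); first by exists y.
have [_ inj _ _] := atlas_chart ap; exact: inj.
Qed.

Lemma cinv_continuous x : (p @` dom p) x -> {for x, continuous (cinv p)}.
Proof.
move=> px; have [dx xE] := cinvP px => A /= Ax.
have [B [[oB Bx] BA]] : exists B, open_nbhs (cinv p x) B /\ B `<=` A.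
  by move: Ax; rewrite nbhsE => -[B ? ?]; exists B.
have oV : open (p @` (B `&` dom p)).
  apply: image_open; [exact: openI dom_open|exact: subIsetr].
have Vx : (p @` (B `&` dom p)) x by exists (cinv p x).
apply: filterS (open_nbhs_nbhs (conj oV Vx)) => _ [y [By dy] <-] /=.
by rewrite cinvK //; exact: BA.
Qed.

Lemma of_coords_par H y : dom p y -> of_coords p H (p y) = H y.
Proof. by move=> dy; rewrite /of_coords mem_set ?cinvK //; exists y. Qed.

Lemma of_coords_out H x : ~ (p @` dom p) x -> of_coords p H x = 0.
Proof. by move=> px; rewrite /of_coords memNset. Qed.

Variable K : set 'rV[R]_n.
Hypotheses (cK : compact K) (KD : K `<=` dom p).

Lemma image_closed : closed (p @` K).
Proof.
apply: compact_closed; first exact: manifold_hausdorff.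
apply: continuous_compact => //; apply: continuous_in_subspaceT => y.
by rewrite inE => /KD; exact: par_continuous.
Qed.

Lemma of_coords_off H x : (forall y, ~ K y -> H y = 0) -> ~ (p @` K) x -> of_coords p H x = 0.
Proof.
move=> H0 pKx; have [px|] := pselect ((p @` dom p) x); last exact: of_coords_out.
have [dx xE] := cinvP px; rewrite -xE of_coords_par // H0 // => Kx.
by apply: pKx; exists (cinv p x).
Qed.

(** This function is continuous inside the chart, and zero near every point
   that is not in the image of K, which is compact, hence closed. *)
Lemma of_coords_continuous H : (forall y, ~ K y -> H y = 0) ->
  (forall y, dom p y -> {for y, continuous H}) -> continuous (of_coords p H).
Proof.
move=> H0 cH x; have [px|px] := pselect ((p @` dom p) x).
  have [dx xE] := cinvP px.
  have nE : \forall z \near x, H (cinv p z) = of_coords p H z.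
    apply: filterS (open_nbhs_nbhs (conj (image_open dom_open (@subset_refl _ _)) px)).
    by move=> _ [y dy <-]; rewrite of_coords_par // cinvK.
  have E0 : of_coords p H x = H (cinv p x) by rewrite -{1}xE of_coords_par.
  have C : {for x, continuous (H \o cinv p)}.
    by apply: continuous_comp; [exact: cinv_continuous|exact: cH].
  rewrite /continuous_at E0; apply: cvg_trans C.
  exact: (@near_eq_cvg _ _ _ _ (H \o cinv p) (of_coords p H) nE).
have pKx : ~ (p @` K) x by move=> [y Ky xE]; apply: px; exists y => //; exact: KD.
have oK : open (~` (p @` K)) by rewrite openC; exact: image_closed.
have nE : \forall z \near x, (0 : R) = of_coords p H z.
  by apply: filterS (open_nbhs_nbhs (conj oK pKx)) => z Kz; rewrite of_coords_off.
rewrite /continuous_at of_coords_out //.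
apply: cvg_trans (@cst_continuous M R (0 : R) x).
exact: (@near_eq_cvg _ _ _ _ (fun=> 0) (of_coords p H) nE).
Qed.

End chart.

Lemma overlap_open p q : atlas p -> atlas q -> open (overlap p q).
Proof.
move=> ap aq; apply: (@open_preimage_on 'rV[R]_n M (dom p) (q @` dom q) p).
- exact: dom_open.
- by move=> y; exact: par_continuous.
- by apply: image_open => //; exact: dom_open.
Qed.

Lemma transitionP p q y : overlap p q y ->
  dom q (transition p q y) /\ q (transition p q y) = p y.
Proof. by move=> [_]; exact: cinvP. Qed.

(** In other charts, a compactly supported function of the coordinates is seen
   through the changes of coordinates, which are smooth. *)
Lemma Ck_of_coords k p q K H : atlas p -> atlas q -> compact K -> K `<=` dom p ->
  (forall y, ~ K y -> H y = 0) -> Ck k (dom p) H -> Ck k (dom q) (of_coords p H \o q).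
Proof.
move=> ap aq cK KD H0 CH; apply: Ck_local => y dy.
have [py|py] := pselect ((p @` dom p) (q y)).
  exists (overlap q p); first by [].
  apply: (eq_Ck (overlap_open aq ap) (f := fun z => H (transition q p z))).
    by move=> z /transitionP[dz zE]; rewrite /= -zE of_coords_par.
  apply: (Ck_comp (overlap_open aq ap) (dom_open ap)) CH => [z /transitionP[]//|j].
  exact: atlas_smooth.
have oV : open (dom q `&` q @^-1` (~` (p @` K))).
  apply: open_preimage_on; [exact: dom_open|by move=> z; exact: par_continuous|].
  by rewrite openC; exact: image_closed.
exists (dom q `&` q @^-1` (~` (p @` K))).
  by split=> //= -[z Kz zE]; apply: py; exists z => //; exact: KD.
apply: (@eq_Ck _ _ _ oV k (fun=> 0)) => [z [dz Kz]|]; last exact: Ck_cst.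
by rewrite /= (of_coords_off ap H0).
Qed.

Lemma continuous_of_charts (f : M -> R) :
  (forall p, atlas p -> forall y, dom p y -> {for y, continuous (f \o p)}) -> continuous f.
Proof.
move=> Cf x; have [p ap px] := atlas_cover x; have [dx xE] := cinvP px.
have nE : \forall z \near x, f (p (cinv p z)) = f z.
  apply: filterS (open_nbhs_nbhs (conj (image_open ap (dom_open ap) (@subset_refl _ _)) px)).
  by move=> z /cinvP[_ ->].
have C : {for x, continuous ((f \o p) \o cinv p)}.
  by apply: continuous_comp; [exact: cinv_continuous|exact: Cf].
rewrite /continuous_at -{2}xE; apply: cvg_trans C.
exact: (@near_eq_cvg _ _ _ _ ((f \o p) \o cinv p) f nE).
Qed.

End charts.

Section metric_coefficients.
Context (R : realType) (n k : nat) (M : manifold R n) (g : metric k M).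
Variables (p : chart R n M).
Hypothesis ap : atlas p.

Lemma gmat_posdef y : dom p y -> posdef (g p y).
Proof. exact: gmat_pos. Qed.

Lemma sqrtdet_gt0 y : dom p y -> 0 < sqrtdet g p y.
Proof. by move=> dy; rewrite sqrtr_gt0; exact: posdef_det (gmat_posdef dy). Qed.

Lemma Ck_sqrtdet : Ck k (dom p) (sqrtdet g p).
Proof.
have oD := dom_open ap; apply: Ck_sqrt => //.
  by move=> y dy; exact: posdef_det (gmat_posdef dy).
by apply: Ck_det => // a b; exact: gmat_Ck.
Qed.

(** Cramer's rule. *)
Lemma Ck_invg a b : Ck k (dom p) (fun y => invmx (g p y) a b).
Proof.
have oD := dom_open ap.
apply: (eq_Ck oD (f := fun y => (\det (g p y))^-1 * cofactor (g p y) b a)).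
  by move=> y dy; rewrite /invmx posdef_unitmx ?[in RHS]mxE 1?[in RHS]mxE //; exact: gmat_posdef.
apply: CkM => //; first apply: Ck_inv => //.
- by move=> y dy; rewrite gt_eqF // posdef_det //; exact: gmat_posdef.
- by apply: Ck_det => // c d; exact: gmat_Ck.
apply: CkZ => //; apply: Ck_det => // c d.
rewrite (_ : (fun y => _) = (fun y => g p y (lift b c) (lift a d))); first exact: gmat_Ck.
by apply/funext => y; rewrite !mxE.
Qed.

Lemma invg_sym y a b : dom p y -> invmx (g p y) a b = invmx (g p y) b a.
Proof. by move=> dy;  rewrite -[in LHS](invmx_sym (gmat_sym g ap dy)) mxE. Qed.

End metric_coefficients.

(** * The Riemannian volume *)

Section volume.
Context (R : realType) (n k : nat) (M : manifold R n) (g : metric k M).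
Context (mu : borel_measure R M).
Hypothesis volume : is_volume g mu.

Section chart.
Variables (p : chart R n M).
Hypothesis ap : atlas p.
Let D : set (borel M) := p @` dom p.
Let U : set (borel 'rV[R]_n) := dom p.
Let q : borel 'rV[R]_n -> borel M := p.

Let mD : measurable D.
Proof. by apply: borel_open; apply: image_open => //; exact: dom_open. Qed.

Let mU : measurable U.
Proof. by apply: borel_open; exact: dom_open. Qed.

Let mq : measurable_fun U q.
Proof. by apply: open_continuous_borel; [exact: dom_open|move=> y; exact: par_continuous]. Qed.

Let qD y : U y -> D (q y).
Proof. by exists y. Qed.

Let mrho : measurable_fun U (sqrtdet g p : borel 'rV[R]_n -> R).
Proof.
apply: open_continuous_measurable; first exact: dom_open.
by move=> y Uy; exact: (Ck_continuous (dom_open ap) (Ck_sqrtdet g ap)).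
Qed.

Let rho0 y : U y -> 0 <= sqrtdet g p y.
Proof. by move=> Uy; rewrite ltW // sqrtdet_gt0. Qed.

Let volumeE (A : set (borel M)) : measurable A -> A `<=` D ->
  (mu A = \int[leb R n]_(y in U) (\1_A (q y) * sqrtdet g p y)%:E)%E.
Proof.
move=> mA AD; rewrite (volume ap mA AD).
have E : (fun y : borel 'rV[R]_n => (\1_[set z | dom p z /\ A (p z)] y * sqrtdet g p y)%:E) =
    (fun y => (\1_A (q y) * sqrtdet g p y)%:E) \_ U.
  apply/funext => y; rewrite patchE !indicE.
  have [Uy|nUy] := boolP (y \in U).
    congr (((nat_of_bool _)%:R * _)%:E); rewrite inE in Uy.
    by apply/idP/idP; rewrite !inE; [case|split].
  rewrite memNset ?mul0r // => -[dy _]; move: nUy; rewrite notin_setE; exact.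
rewrite [in RHS]integral_mkcond E lebE //.
- apply/(measurable_restrictT _ mU)/measurable_EFinP; apply: measurable_funM => //.
  exact: (measurable_comp measurableT _ (measurable_indic mA) mq).
- move=> y; rewrite patchE; case: ifPn => // Uy; rewrite inE in Uy.
  by rewrite lee_fin mulr_ge0 //; exact: rho0.
Qed.

(** The formula that defines the volume, extended from sets to functions that
   vanish outside the chart. *)
Lemma integral_chart (F : M -> R) (G : 'rV[R]_n -> R) :
  measurable_fun [set: borel M] (F : borel M -> R) ->
  (forall x, ~ (p @` dom p) x -> F x = 0) -> (forall y, ~ dom p y -> G y = 0) ->
  (forall y, dom p y -> G y = F (p y) * sqrtdet g p y) ->
  \int[mu]_x F x = \int[leb R n]_y G y.
Proof.
move=> mF F0 G0 GE; transitivity (\int[mu]_(x in D) F x).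
  rewrite [in RHS]Rintegral_mkcond; apply: eq_Rintegral => x _; rewrite patchE.
  by case: ifPn => // Dx; rewrite F0 // => Dx'; rewrite mem_set in Dx.
rewrite (integral_transfer mD mU mq qD mrho rho0 volumeE mF) Rintegral_mkcond.
apply: eq_Rintegral => y _; rewrite patchE; case: ifPn => Uy.
  by rewrite inE in Uy; rewrite GE.
by rewrite G0 // => Uy'; rewrite mem_set in Uy.
Qed.

Lemma integral_of_coords_lty (K : set 'rV[R]_n) (H : 'rV[R]_n -> R) :
  compact K -> K `<=` dom p -> (forall y, ~ K y -> H y = 0) -> (forall y, 0 <= H y) ->
  Ck 0 setT H -> (\int[mu]_x (of_coords p H x)%:E < +oo)%E.
Proof.
move=> cK KD H0 Hge0 CH; have oD := dom_open ap.
have mF : measurable_fun [set: borel M] (fun x : borel M => (of_coords p H x)%:E).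
  apply/measurable_EFinP; apply: continuous_borel.
  by apply: (of_coords_continuous ap cK KD H0) => y _; exact: CH.
have F0 x : (0 <= (of_coords p H x)%:E)%E.
  by rewrite lee_fin /of_coords; case: ifP.
have -> : (\int[mu]_x (of_coords p H x)%:E = \int[mu]_(x in D) (of_coords p H x)%:E)%E.
  rewrite [in RHS]integral_mkcond; apply: eq_integral => x _; rewrite patchE.
  by case: ifPn => // Dx; rewrite of_coords_out // => Dx'; rewrite mem_set in Dx.
rewrite (ge0_integral_transfer mD mU mq qD mrho rho0 volumeE mF F0).
have [r r0 Kr] := compact_in_cube cK.
have cG : Ck 0 setT (fun y => H y * sqrtdet g p y).
  apply: (Ck_extend oD cK KD) => [y Ky|]; first by rewrite H0 ?mul0r.
  apply: CkM => //; first exact: Ck_subset CH.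
  exact: Ck_leq (leq0n k) (Ck_sqrtdet g ap).
have iG : (leb R n).-integrable setT (EFin \o (fun y => H y * sqrtdet g p y)).
  apply: (@continuous_integrable _ _ _ r) => [y|y ry]; first exact: cG.
  by rewrite H0 ?mul0r // => /Kr.
apply: le_lt_trans (integrable_lty measurableT iG).
rewrite integral_mkcond; apply: ge0_le_integral => //.
- move=> y _; rewrite patchE; case: ifPn => // Uy; rewrite inE in Uy.
  by rewrite -EFinM lee_fin mulr_ge0 ?rho0 // /q of_coords_par.
- apply/(measurable_restrictT _ mU); apply: emeasurable_funM.
    exact: (measurable_comp measurableT _ mF mq).
  exact/measurable_EFinP.
- have /integrableP[mG _] := iG.
  exact: mG.
- move=> y _; rewrite patchE; case: ifPn => Uy.
    by rewrite inE in Uy; rewrite /q of_coords_par // -EFinM.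
  by rewrite lee_fin H0 ?mul0r // => /KD Uy'; rewrite mem_set in Uy.
Qed.

End chart.

Section compact.
Hypothesis cM : compact [set: M].

Lemma continuous_bounded (f : M -> R) : continuous f -> exists2 C : R, 0 <= C & forall x, `|f x| <= C.
Proof.
move=> cf; have cfM : compact (f @` [set: M]).
  by apply: continuous_compact => //; exact: continuous_subspaceT.
have [C [_ HC]] := compact_bounded cfM.
exists (`|C| + 1); first by rewrite addr_ge0.
move=> x; apply: HC; first by rewrite (le_lt_trans (ler_norm C)) // ltrDl.
by exists x.
Qed.

(** By compactness finitely many bumps, each supported in one chart, have a
   positive sum; dividing by it gives a partition of unity. *)
Lemma bump_cover : exists N (pc : 'I_N -> chart R n M) (b : 'I_N -> 'rV[R]_n -> R)
    (K : 'I_N -> set 'rV[R]_n),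
  (forall i, [/\ atlas (pc i), compact (K i) & K i `<=` dom (pc i)]) /\
  (forall i, [/\ (forall y, ~ K i y -> b i y = 0), (forall y, 0 <= b i y) &
      forall j, Ck j setT (b i)]) /\
  (forall x, 0 < \sum_i of_coords (pc i) (b i) x).
Proof.
have H x : exists t : chart R n M * 'rV[R]_n * R, [/\ atlas t.1.1, 0 < t.2,
    ccube t.1.2 t.2 `<=` dom t.1.1 & (t.1.1 @` ball t.1.2 t.2) x].
  have [p ap [y dy pyx]] := atlas_cover x.
  have [r r0 rD] := ccube_sub_nbhs (open_nbhs_nbhs (conj (dom_open ap) dy)).
  exists (p, y, r); split=> //; exists y => //; exact: ballxx.
have [t Ht] := choice H.
pose V x := (t x).1.1 @` ball (t x).1.2 (t x).2.
have BD x : ball (t x).1.2 (t x).2 `<=` dom (t x).1.1.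
  have [_ _ ? _] := Ht x; exact: subset_trans (@ball_ccube _ _ _ _) _.
have oV x : open (V x).
  have [ax r0 _ _] := Ht x; apply: image_open => //; exact: ball_open.
have : cover_compact [set: M] by rewrite -compact_cover.
move=> /(_ M [set: M] V (fun x _ => oV x)) [|D' _ cD].
  by move=> x _; exists x => //; have [] := Ht x.
pose s : seq M := finmap.enum_fset D'.
pose z (i : 'I_(size s)) := tnth (in_tuple s) i.
exists (size s), (fun i => (t (z i)).1.1), (fun i => bump (t (z i)).1.2 (t (z i)).2),
  (fun i => ccube (t (z i)).1.2 (t (z i)).2).
split; [|split].
- by move=> i; have [] := Ht (z i); split=> //; exact: ccube_compact.
- move=> i; have [_ r0 _ _] := Ht (z i); split=> [y Ky|y|j].
  + by apply: bump_eq0 => // /ball_ccube.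
  + exact: bump_ge0.
  + exact: Ck_bump.
- move=> x; have [w ws [y By yx]] := cD x I.
  have [i wi] : exists i, w = z i by apply/tnthP.
  rewrite (bigD1 i) //= ltr_pwDl //; last first.
    by apply: sumr_ge0 => j _; rewrite /of_coords; case: ifP => // _; exact: bump_ge0.
  rewrite -wi -yx of_coords_par; [|by have [] := Ht w|exact: BD].
  by apply: bump_gt0 => //; have [] := Ht w.
Qed.

(** The constants are dominated by a multiple of the sum of these bumps, each
   of which has a finite integral. *)
Lemma volume_finite : (mu [set: borel M] < +oo)%E.
Proof.
have [N [pc [b [K [HK [Hb S0]]]]]] := bump_cover.
pose B i x := of_coords (pc i) (b i) x.
have cB i : continuous (B i).
  have [ai cK KD] := HK i; have [b0 _ Cb] := Hb i.
  by apply: (of_coords_continuous ai cK KD b0) => y _; exact: (Cb 0).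
pose S x := \sum_i B i x.
have cS : continuous S.
  apply: continuous_big => [|i _ x]; [exact: add_continuous|exact: cB].
have [C C0 SC] : exists2 C : R, 0 <= C & forall x, `|(S x)^-1| <= C.
  apply: continuous_bounded => x; apply: cvgV; last exact: cS.
  by rewrite gt_eqF // S0.
have B0 i x : 0 <= B i x by have [_ H _] := Hb i; rewrite /B /of_coords; case: ifP.
have mB i : measurable_fun [set: borel M] (fun x : borel M => (B i x)%:E).
  by apply/measurable_EFinP; apply: continuous_borel; exact: cB.
have fS : (\int[mu]_x (C * S x)%:E < +oo)%E.
  under eq_integral do rewrite EFinM.
  rewrite ge0_integralZl_EFin //; last 2 first.
    by move=> x _; rewrite lee_fin sumr_ge0.
    by apply/measurable_EFinP; apply: continuous_borel; exact: cS.
  apply: lte_mul_pinfty => //;   under eq_integral do rewrite /S -sumEFin.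
  rewrite ge0_integral_sum //.
    apply: lte_sum_pinfty => i _; have [ai cK KD] := HK i; have [b0 bge Cb] := Hb i.
    exact: (integral_of_coords_lty ai cK KD b0 bge (Cb 0)).
  by move=> i x _; rewrite lee_fin; exact: B0.
apply: le_lt_trans fS; rewrite -[X in (X <= _)%E]mul1e -integral_cst //.
apply: ge0_le_integral => //.
- apply/measurable_EFinP; apply: measurable_funM => //.
  by apply: continuous_borel; exact: cS.
- move=> x _; rewrite lee_fin -ler_pdivrMr ?S0 // mul1r.
  exact: le_trans (ler_norm _) (SC x).
Qed.

Lemma l2_continuous (f : M -> R) : continuous f -> l2 mu (f : borel M -> R).
Proof.
move=> cf; have mf := continuous_borel cf; split=> //.
have [C C0 fC] := continuous_bounded cf.
apply: (@le_lt_trans _ _ ((C ^+ 2)%:E * mu [set: borel M])%E); last first.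
  apply: lte_mul_pinfty; rewrite ?lee_fin ?sqr_ge0 //; exact: volume_finite.
rewrite -integral_cst //; apply: ge0_le_integral => //.
- by move=> x _; rewrite lee_fin sqr_ge0.
- by apply/measurable_EFinP; exact: measurable_funX.
- by move=> x _; rewrite lee_fin -real_normK ?num_real // lerXn2r ?nnegrE.
Qed.

End compact.
End volume.

(** * Green's formula and the spectrum *)

Section green.
Context (R : realType) (n : nat) (M : manifold R n) (g : metric 4 M).
Context (mu : borel_measure R M).
Hypothesis volume : is_volume g mu.
Hypothesis cM : compact [set: M].

Lemma Rintegral_sum_compact (I : Type) (s : seq I) (F : I -> 'rV[R]_n -> R) r :
  (forall i, Ck 0 setT (F i)) -> (forall i y, ~ @cube R n r y -> F i y = 0) ->
  \int[leb R n]_y (\sum_(i <- s) F i y) = \sum_(i <- s) \int[leb R n]_y F i y.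
Proof.
move=> CF F0.
have I0 : \int[leb R n]_y (0 : R) = 0 by rewrite /Rintegral integral0.
elim: s => [|i s IH]; first by under eq_Rintegral do rewrite big_nil; rewrite I0 big_nil.
under eq_Rintegral do rewrite big_cons; rewrite big_cons -IH RintegralD //.
  by apply: (@continuous_integrable _ _ _ r) => [y|y ry]; [exact: CF|exact: F0].
apply: (@continuous_integrable _ _ _ r) => [y|y ry].
  by apply: (Ck_sum openT (k := 0)).
by rewrite big1 // => j _; rewrite F0.
Qed.

Section chart.
Variable p : chart R n M.
Hypothesis ap : atlas p.
Let oD := dom_open ap.

(** The vector density sqrt(det g) * grad f, whose divergence is sqrt(det g)
   times the Laplacian of f. *)
Definition flux (f : 'rV[R]_n -> R) (a : 'I_n) (z : 'rV[R]_n) : R :=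
  sqrtdet g p z * \sum_(b < n) invmx (g p z) a b * partial b f z.

Lemma Ck_flux j f a : (j <= 4)%N -> Ck j.+1 (dom p) f -> Ck j (dom p) (flux f a).
Proof.
move=> j4 Cf; apply: CkM => //; first exact: Ck_leq j4 (Ck_sqrtdet g ap).
apply: Ck_sum => // b _; apply: CkM => //; last exact: Ck_partial.
by apply: (Ck_leq oD j4); exact: Ck_invg.
Qed.

Lemma Ck_laplace_beltrami j f : (j <= 3)%N -> Ck j.+2 (dom p) f ->
  Ck j (dom p) (laplace_beltrami g p f).
Proof.
move=> j3 Cf; apply: CkM => //.
  apply: Ck_inv => //; first by move=> y dy; rewrite gt_eqF // sqrtdet_gt0.
  by apply: (Ck_leq oD (k := 4)); [exact: leq_trans j3 _|exact: Ck_sqrtdet].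
by apply: Ck_sum => // a _; apply: Ck_partial => //; exact: Ck_flux.
Qed.

Variable K : set 'rV[R]_n.
Hypotheses (cK : compact K) (KD : K `<=` dom p).
Let clK := compact_rV_closed cK.

Lemma flux_off f a y : (forall z, ~ K z -> f z = 0) -> ~ K y -> flux f a y = 0.
Proof.
move=> f0 Ky; rewrite /flux big1 ?mulr0 // => b _.
by rewrite (partial_off b clK f0 Ky) mulr0.
Qed.

Lemma laplace_beltrami_off f y : (forall z, ~ K z -> f z = 0) -> ~ K y ->
  laplace_beltrami g p f y = 0.
Proof.
move=> f0 Ky; rewrite /laplace_beltrami big1 ?mulr0 // => a _.
by apply: (partial_off a clK) Ky => z Kz; exact: flux_off.
Qed.

Let coords_continuous v : (forall y, ~ K y -> v y = 0) -> Ck 0 (dom p) v ->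
  continuous (of_coords p v).
Proof. by move=> v0 Cv; apply: (of_coords_continuous ap cK KD v0). Qed.

(** Integrate the divergence of v * flux w - w * flux v, where w is f in
   coordinates: the products of first derivatives cancel by the symmetry of
   the metric, and the divergence of a compactly supported field has integral
   zero. *)
Lemma green (v : 'rV[R]_n -> R) (f : M -> R) (c : R) :
  (forall y, ~ K y -> v y = 0) -> Ck 2 (dom p) v -> continuous f ->
  Ck 2 (dom p) (f \o p) ->
  (forall y, dom p y -> - laplace_beltrami g p (f \o p) y = c * f (p y)) ->
  ip mu (of_coords p (fun y => - laplace_beltrami g p v y)) f =
  c * ip mu (of_coords p v) f.
Proof.
move=> v0 Cv cf Cw fE; set w := f \o p.
have Cv1 := Ck_pred oD Cv; have Cw1 := Ck_pred oD Cw.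
have Lv0 y : ~ K y -> - laplace_beltrami g p v y = 0.
  by move=> Ky; rewrite laplace_beltrami_off ?oppr0.
have CLv : Ck 0 (dom p) (fun y => - laplace_beltrami g p v y).
  by apply: (CkN oD (k := 0)); apply: Ck_laplace_beltrami.
have cLv := coords_continuous Lv0 CLv.
have cv := coords_continuous v0 (Ck_pred oD Cv1).
have lf := l2_continuous volume cM cf.
have lLv := l2_continuous volume cM cLv.
have lv := l2_continuous volume cM cv.
apply/eqP; rewrite -subr_eq0 -ipZl // -ipBl //; last exact: l2Z.
pose X a y := v y * flux w a y - w y * flux v a y.
have X0 a y : ~ K y -> X a y = 0.
  by move=> Ky; rewrite /X v0 // (flux_off _ v0 Ky) mul0r mulr0 subrr.
have CX a : Ck 1 setT (X a).
  apply: (Ck_extend oD cK KD (X0 a)).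
  apply: (CkB oD (k := 1)); apply: (CkM oD (k := 1)).
  - exact: Cv1.
  - by apply: Ck_flux.
  - exact: Cw1.
  - by apply: Ck_flux.
have [r r0 Kr] := compact_in_cube cK.
have Xr a y : ~ @cube R n r y -> X a y = 0 by move=> ry; apply: X0 => /Kr.
have dX a y : ~ @cube R n r y -> partial a (X a) y = 0.
  by move=> ry; exact: partial_support0 (Xr a) ry.
apply/eqP; rewrite [LHS](@integral_chart _ _ _ _ _ _ volume _ ap _
  (fun y => \sum_a partial a (X a) y)).
- rewrite (@Rintegral_sum_compact _ _ _ r).
  + by apply: big1 => a _; exact: (integral_partial_eq0 a (CX a) (Xr a)).
  + by move=> a; exact: Ck_partial (CX a).
  + exact: dX.
- by apply: measurable_funM; [exact: (l2B lLv (l2Z c lv)).1|exact: lf.1].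
- by move=> x px; rewrite !of_coords_out // mulr0 subr0 mul0r.
- by move=> y dy; apply: big1 => a _; apply: (partial_off a clK (X0 a)) => /KD.
move=> y dy; rewrite !of_coords_par //.
have D0 h : Ck 1 (dom p) h -> forall a, derivable h y (delta_mx 0 a).
  by move=> Ch a; exact: (Ch a).1.
have Dv := D0 _ Cv1.
have Dw : forall a, derivable w y (delta_mx 0 a) := D0 _ Cw1.
have Dfv a : derivable (flux v a) y (delta_mx 0 a) by apply: D0; exact: Ck_flux.
have Dfw a : derivable (flux w a) y (delta_mx 0 a) by apply: D0; exact: Ck_flux.
have XE a : partial a (X a) y = (partial a v y * flux w a y - partial a w y * flux v a y)
    + (v y * partial a (flux w a) y - w y * partial a (flux v a) y).
  transitivity (partial a (fun z => v z * flux w a z) y - partial a (fun z => w z * flux v a z) y).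
    exact: (deriveB (derivableM (Dv a) (Dfw a)) (derivableM (Dw a) (Dfv a))).
  rewrite (partialM (Dv a) (Dfw a)) (partialM (Dw a) (Dfv a)).
  move: (partial a v y) (partial a w y) (flux v a y) (flux w a y) (v y) (w y).
  move: (partial a (flux v a) y) (partial a (flux w a) y) => a1 a2 a3 a4 a5 a6 a7 a8.
  ring.
under eq_bigr do rewrite XE.
rewrite big_split /= [X in X + _](_ : _ = 0) ?add0r; last first.
  rewrite sumrB; apply/eqP; rewrite subr_eq0; apply/eqP.
  under eq_bigr do rewrite /flux mulrCA mulr_sumr mulr_sumr.
  under [in RHS]eq_bigr do rewrite /flux mulrCA mulr_sumr mulr_sumr.
  rewrite exchange_big /=; apply: eq_bigr => a _; apply: eq_bigr => b _.
  by rewrite (invg_sym g ap a b dy); ring.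
have rho0 : sqrtdet g p y != 0 by rewrite gt_eqF // sqrtdet_gt0.
have LE h : \sum_a partial a (flux h a) y = sqrtdet g p y * laplace_beltrami g p h y.
  by rewrite /laplace_beltrami mulrA divff // mul1r.
have LwE : laplace_beltrami g p w y = - (c * w y) by rewrite -[w y]/(f (p y)) -fE // opprK.
transitivity (v y * (sqrtdet g p y * laplace_beltrami g p w y) -
    w y * (sqrtdet g p y * laplace_beltrami g p v y)).
  have aux (s t : 'I_n -> R) (x z A B : R) : \sum_i s i = A -> \sum_i t i = B ->
    \sum_i (x * s i - z * t i) = x * A - z * B by move=> <- <-; rewrite !mulr_sumr sumrB.
  exact: (aux (fun i => partial i (flux w i) y) (fun i => partial i (flux v i) y) _ _ _ _ (LE w) (LE v)).
rewrite LwE.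
rewrite -[f (p y)]/(w y).
move: (laplace_beltrami g p v y) (sqrtdet g p y) (v y) (w y) => a1 a2 a3 a4.
ring.
Qed.

End chart.
End green.

Section spectrum.
Context (R : realType) (n : nat) (M : manifold R n) (g : metric 4 M).
Context (mu : borel_measure R M).
Hypothesis volume : is_volume g mu.
Hypothesis cM : compact [set: M].
Variables (lam : nat -> R) (phi : nat -> M -> R).
Hypothesis spectrum : is_spectrum g mu lam phi.
Local Notation coef := (coef mu (phi : nat -> borel M -> R)).

Lemma eigenfunction_continuous j : continuous (phi j).
Proof.
have [_ eig _ _] := spectrum; apply: continuous_of_charts => p ap y dy.
by apply: (Ck_continuous (dom_open ap)) dy; exact: (eig j p ap).1.
Qed.

Lemma l2_eigenfunction j : l2 mu (phi j : borel M -> R).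
Proof. exact: (l2_continuous volume cM (@eigenfunction_continuous j)). Qed.

Lemma eigenfunction_orthonormal j l :
  ip mu (phi j : borel M -> R) (phi l) = (j == l)%:R.
Proof. by have [_ _ H _] := spectrum; exact: H. Qed.

Lemma eigenfunction_complete (u : borel M -> R) : l2 mu u -> (forall j, coef u j = 0) ->
  {ae mu, forall x, u x = 0}.
Proof.
move=> lu u0; have [_ _ _ H] := spectrum; apply: H => //.
exact/l2P.
Qed.

Lemma coef_laplace_beltrami p K v j : atlas p -> compact K -> K `<=` dom p ->
  (forall y, ~ K y -> v y = 0) -> Ck 2 (dom p) v ->
  coef (of_coords p (fun y => - laplace_beltrami g p v y)) j =
  lam j * coef (of_coords p v) j.
Proof.
move=> ap cK KD v0 Cv; have [_ eig _ _] := spectrum; have [Ce He] := eig j p ap.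
apply: (green volume cM ap cK KD v0 Cv (@eigenfunction_continuous j) Ce He).
Qed.

(** Green's formula with the constant function 1. *)
Lemma integral_laplace_beltrami p K v : atlas p -> compact K -> K `<=` dom p ->
  (forall y, ~ K y -> v y = 0) -> Ck 2 (dom p) v ->
  ip mu (of_coords p (fun y => - laplace_beltrami g p v y)) (fun=> 1) = 0.
Proof.
move=> ap cK KD v0 Cv; have oD := dom_open ap.
transitivity (0 * ip mu (of_coords p v) (fun=> 1)); last exact: mul0r.
have c1 : continuous ((fun=> 1 : R) : M -> R) by move=> x; exact: cst_continuous.
have C1 : Ck 2 (dom p) ((fun=> 1 : R) \o p).
  exact: (Ck_cst _ (1 : R) 2).
apply: (green volume cM ap cK KD v0 Cv c1 C1).
move=> y dy; rewrite mul0r /laplace_beltrami big1 ?mulr0 ?oppr0 // => a _.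
rewrite [X in partial a X](_ : _ = fun=> 0) ?partial_cst //; apply/funext => z.
by rewrite big1 ?mulr0 // => b _; rewrite (partial_cst 1) mulr0.
Qed.

Let one_l2 : l2 mu (fun=> 1 : R).
Proof. by apply: (l2_continuous volume cM) => x; exact: cst_continuous. Qed.

(** A partition of unity writes phi j as a finite sum of functions supported
   in charts. By Green's formula the sum of their Laplacians has the
   coefficients of lam j * phi j, hence equals it almost everywhere; and each
   of these Laplacians has integral zero. The Laplacian is thus never compared
   in two charts. *)
Lemma eigenfunction_mean j : (1 <= j)%N -> ip mu (phi j : borel M -> R) (fun=> 1) = 0.
Proof.
move=> j1; have [[lam0 lam1 lamS] eig _ _] := spectrum.
have lj : lam j != 0 by rewrite gt_eqF // (lam_gt0 lam1 lamS).
have [N [pc [b [K [HK [Hb S0]]]]]] := bump_cover cM.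
pose B i x := of_coords (pc i) (b i) x.
pose S x := \sum_i B i x.
pose v i y := b i y * ((phi j \o pc i) y * (S (pc i y))^-1).
have v0 i y : ~ K i y -> v i y = 0.
  by move=> Ky; have [b0 _ _] := Hb i; rewrite /v b0 // mul0r.
have Cv i : Ck 2 (dom (pc i)) (v i).
  have [ai cK KD] := HK i; have oi := dom_open ai; have [b0 _ Cb] := Hb i.
  apply: CkM => //; first exact: Ck_subset (Cb 2).
  apply: CkM => //; first by have [] := eig j _ ai.
  apply: Ck_inv => //; first by move=> y _; rewrite gt_eqF // S0.
  apply: Ck_sum => // l _; have [al cKl KDl] := HK l; have [bl0 _ Cbl] := Hb l.
  by apply: (Ck_of_coords al ai cKl KDl bl0); exact: Ck_subset (Cbl 2).
pose W i := of_coords (pc i) (fun y => - laplace_beltrami g (pc i) (v i) y).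
have lW i : l2 mu (W i : borel M -> R).
  have [ai cK KD] := HK i; have oi := dom_open ai.
  apply: (l2_continuous volume cM); apply: (of_coords_continuous ai cK KD).
    by move=> y Ky; rewrite (@laplace_beltrami_off _ _ _ _ _ _ cK _ _ (v0 i)) ?oppr0.
  by apply: (CkN oi (k := 0)); exact: Ck_laplace_beltrami (Cv i).
have lV i : l2 mu (of_coords (pc i) (v i) : borel M -> R).
  have [ai cK KD] := HK i; have oi := dom_open ai.
  apply: (l2_continuous volume cM); apply: (of_coords_continuous ai cK KD (v0 i)).
  exact: (Ck_continuous oi (Cv i)).
have sumV x : \sum_i of_coords (pc i) (v i) x = phi j x.
  transitivity (\sum_i B i x * (phi j x * (S x)^-1)).
    apply: eq_bigr => i _; have [ai _ _] := HK i.
    have [px|px] := pselect ((pc i @` dom (pc i)) x).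
      by have [dx xE] := cinvP px; rewrite -xE /B !of_coords_par.
    by rewrite /B !of_coords_out // mul0r.
  by rewrite -mulr_suml mulrCA divff ?mulr1 // gt_eqF // S0.
have lsum : l2 mu (fun x : borel M => \sum_i W i x) by apply: l2_sum.
have lp := l2_eigenfunction.
have WE k : coef (fun x => \sum_i W i x) k = coef (fun x => lam j * phi j x) k.
  rewrite /coef ip_suml // ipZl // eigenfunction_orthonormal.
  transitivity (\sum_i lam k * coef (of_coords (pc i) (v i)) k).
    apply: eq_bigr => i _; have [ai cK KD] := HK i.
    exact: (coef_laplace_beltrami k ai cK KD (v0 i) (Cv i)).
  rewrite -mulr_sumr -ip_suml //; under [X in ip mu X _]eq_fun do rewrite sumV.
  rewrite eigenfunction_orthonormal; case: eqP => [->//|_]; by rewrite !mulr0.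
have ae := coef_eq_ae lp eigenfunction_complete lsum (l2Z (lam j) (lp j)) WE.
apply: (mulfI lj); rewrite mulr0 -ipZl //.
rewrite -(ip_ae lsum.1 (l2Z (lam j) (lp j)).1 one_l2.1 one_l2.1 ae) //; last first.
  exact: aeW.
rewrite ip_suml //; apply: big1 => i _; have [ai cK KD] := HK i.
exact: (integral_laplace_beltrami ai cK KD (v0 i) (Cv i)).
Qed.

(** The constants are orthogonal to phi j for j > 0, hence multiples of the
   first eigenfunction. *)
Lemma mean_eq0 (h : borel M -> R) : l2 mu h -> (ip mu h (fun=> 1) = 0) <-> (coef h 0 = 0).
Proof.
move=> lh; have lp := l2_eigenfunction.
have c1 j : (1 <= j)%N -> coef (fun=> 1) j = 0.
  by move=> j1; rewrite /coef ipC eigenfunction_mean.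
have E : ip mu h (fun=> 1) = coef h 0 * coef (fun=> 1) 0.
  have := parseval lp eigenfunction_orthonormal eigenfunction_complete lh one_l2.
  move=> /cvg_lim <- //; apply/cvg_lim => //.
  apply: cvg_near_cst; near=> N; have N0 : (0 < N)%N by near: N; exact: nbhs_infty_gt.
  rewrite big_ltn // big_nat_cond big1 ?addr0 // => i /andP[/andP[i1 _] _].
  by rewrite c1 // mulr0.
have c0 : coef (fun=> 1) 0 != 0.
  apply/eqP => c0; have : forall j, coef (fun=> 1) j = 0 by move=> [|j] //; exact: c1.
  move=> /(eigenfunction_complete one_l2) one0.
  have : ip mu (phi 0%N : borel M -> R) (phi 0%N) = 0.
    rewrite (@ip_ae _ _ _ mu _ (fun=> 0) _ (fun=> 0)) ?ip0l //; try exact: (lp 0).1.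
      by apply: filterS one0 => x /eqP; rewrite oner_eq0.
    by apply: filterS one0 => x /eqP; rewrite oner_eq0.
  by rewrite eigenfunction_orthonormal eqxx => /eqP; rewrite oner_eq0.
rewrite E; split=> [/eqP|->]; last by rewrite mul0r.
by rewrite mulf_eq0 (negPf c0) orbF => /eqP.
Unshelve. all: by end_near.
Qed.

End spectrum.

(** * Sources supported in a chart *)

Section identification.
Context (R : realType) (n : nat) (O M : manifold R n) (g : metric 4 M).
Context (i : O -> M) (V : set M).
Hypothesis iV : identifies i V.
Implicit Types (p q : chart R n O).

Lemma push_atlas p : atlas p -> atlas (push i p).
Proof. by have [_ _] := iV; apply. Qed.

Lemma transition_push p q y : transition (push i p) (push i q) y = transition p q y.
Proof.
have [inj _ _] := iV; rewrite /transition; congr xget; apply/seteqP.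
by split=> z [dz /= E]; split=> //; [exact: inj|rewrite E].
Qed.

Lemma overlap_push p q : overlap (push i p) (push i q) = overlap p q.
Proof.
have [inj _ _] := iV; apply/seteqP; split=> y [dy [z dz zE]]; split=> //; exists z => //.
  exact: inj.
by rewrite /= zE.
Qed.

(** The volume densities of two charts differ by the Jacobian of the change of
   coordinates, so that a factor |det J| is a quotient of volume densities. *)
Lemma sqrtdet_transition p q y : atlas p -> atlas q -> overlap p q y ->
  sqrtdet g (push i p) y =
  `|\det ('J (transition p q) y)| * sqrtdet g (push i q) (transition p q y).
Proof.
move=> ap aq yo; have yo' : overlap (push i p) (push i q) y by rewrite overlap_push.
have TE : transition (push i p) (push i q) = transition p q.
  by apply/funext => z; exact: transition_push.
have := gmat_transition g (push_atlas ap) (push_atlas aq) yo'.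
rewrite /sqrtdet /= TE => ->; rewrite !det_mulmx det_tr mulrAC -expr2.
by rewrite sqrtrM ?sqr_ge0 // sqrtr_sqr.
Qed.

Lemma det_transition_neq0 p q y : atlas p -> atlas q -> overlap p q y ->
  \det ('J (transition p q) y) != 0.
Proof.
move=> ap aq yo; apply/eqP => d0; have [dy _] := yo.
have := sqrtdet_gt0 g (push_atlas ap) (y := y) dy.
by rewrite (sqrtdet_transition ap aq yo) d0 normr0 mul0r ltxx.
Qed.

Lemma sqrtdet_mul_inj (f : chart R n O -> 'rV[R]_n -> R) (w w' : M -> R) :
  sqrtdet_mul_eq g i w f -> sqrtdet_mul_eq g i w' f -> w = w'.
Proof.
move=> [H H0] [H' H0']; apply/funext => x.
have [[z _ <-]|ix] := pselect (range i x); last by rewrite H0 ?H0'.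
have [p ap [y dy <-]] := atlas_cover z.
have r0 : sqrtdet g (push i p) y != 0.
  by rewrite gt_eqF // sqrtdet_gt0 //; exact: push_atlas.
by apply: (mulfI r0); rewrite H // H'.
Qed.

Variable p0 : chart R n O.
Hypothesis ap0 : atlas p0.

(** The density F dx of the chart p0, extended by zero. *)
Definition density (F : 'rV[R]_n -> R) p (y : 'rV[R]_n) : R :=
  if y \in (overlap p p0 : set 'rV[R]_n) then
    `|\det ('J (transition p p0) y)| * F (transition p p0 y) else 0.

Lemma density_in F p y : overlap p p0 y ->
  density F p y = `|\det ('J (transition p p0) y)| * F (transition p p0 y).
Proof. by move=> yo; rewrite /density mem_set. Qed.

Lemma density_out F p y : ~ overlap p p0 y -> density F p y = 0.
Proof. by move=> yo; rewrite /density memNset. Qed.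

Section source.
Variables (K : set 'rV[R]_n) (F : 'rV[R]_n -> R).
Hypotheses (cK : compact K) (KD : K `<=` dom p0).
Hypotheses (F0 : forall y, ~ K y -> F y = 0) (CF : forall k, Ck k setT F).

Let density_off p y : atlas p -> dom p y -> ~ (p0 @` K) (p y) -> density F p y = 0.
Proof.
move=> ap dy Ky; have [yo|] := pselect (overlap p p0 y); last exact: density_out.
have [dT TE] := transitionP yo; rewrite density_in // F0 ?mulr0 // => KT.
by apply: Ky; exists (transition p p0 y).
Qed.

(** The transformation law follows from that of the volume densities by
   sqrtdet_transition. *)
Lemma Cc_density_density : Cc_density (density F).
Proof.
split.
- move=> p ap k; apply: Ck_local => y dy.
  have [yo|yo] := pselect (overlap p p0 y); last first.
    exists (dom p `&` p @^-1` (~` (p0 @` K))).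
      split=> //= -[z Kz zE]; apply: yo; split=> //; exists z => //; exact: KD.
    have oV : open (dom p `&` p @^-1` (~` (p0 @` K))).
      apply: open_preimage_on; [exact: dom_open|by move=> z; exact: par_continuous|].
      by rewrite openC; exact: (image_closed ap0 cK KD).
    apply: (@eq_Ck _ _ _ oV k (fun=> 0)) => [z [dz Kz]|]; last exact: Ck_cst.
    by rewrite density_off.
  exists (overlap p p0) => //; have oo := overlap_open ap ap0.
  have CT j k' : Ck k' (overlap p p0) (fun z => transition p p0 z 0 j).
    exact: (atlas_smooth ap ap0).
  pose D z : R := \det (\matrix_(a, b) partial a (fun z => transition p p0 z 0 b) z).
  have DE z : overlap p p0 z -> \det ('J (transition p p0) z) = D z.
    move=> zo; congr (\det _); apply/matrixP => a b.
    by rewrite [RHS]mxE (jacobianE oo (k := 0)) // => j; exact: (CT j 1).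
  apply: (@eq_Ck _ _ _ oo k (fun z => Num.sqrt (D z * D z) * F (transition p p0 z))).
    by move=> z zo; rewrite density_in // DE // -expr2 sqrtr_sqr.
  have CD : Ck k (overlap p p0) D.
    apply: Ck_det => // a b.
    rewrite (_ : (fun y => _) = partial a (fun z => transition p p0 z 0 b)).
      by apply: Ck_partial; exact: (CT b k.+1).
    by apply/funext => z; rewrite mxE.
  apply: CkM => //.
    apply: Ck_sqrt => //; last exact: CkM.
    move=> z zo; rewrite -expr2 exprn_even_gt0 //= -DE //.
    exact: det_transition_neq0.
  by apply: (Ck_comp oo openT (T := transition p p0)) (CF k) => // j; exact: CT.
- move=> p q ap aq y yo; have [dT TE] := transitionP yo; have [dy _] := yo.
  have [y0|y0] := pselect (overlap p p0 y); last first.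
    rewrite !density_out ?mulr0 // => -[_]; rewrite TE => H; exact: y0.
  have T0 : overlap q p0 (transition p q y).
    by split=> //; rewrite TE; case: y0.
  have E : transition q p0 (transition p q y) = transition p p0 y.
    by rewrite {1}/transition TE.
  have [dy0 _] := transitionP y0.
  have s0 : sqrtdet g (push i p0) (transition p p0 y) != 0.
    by rewrite gt_eqF // sqrtdet_gt0 //; exact: push_atlas.
  have DJ : `|\det ('J (transition p p0) y)| =
      `|\det ('J (transition p q) y)| * `|\det ('J (transition q p0) (transition p q y))|.
    apply: (mulIf s0); transitivity (sqrtdet g (push i p) y).
      by apply/esym; exact: sqrtdet_transition.
    rewrite (sqrtdet_transition ap aq yo) (sqrtdet_transition aq ap0 T0) -mulrA.
    congr (_ * (_ * sqrtdet _ _ _)); exact: E.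
  have combine (a b c d1 d2 f1 f2 : R) : d1 = a * f1 -> a = b * c -> d2 = c * f2 ->
    f1 = f2 -> d1 = b * d2 by move=> -> -> -> ->; rewrite mulrA.
  exact: (combine _ _ _ _ _ _ _ (density_in F y0) DJ (density_in F T0) (congr1 F (esym E))).
- exists (p0 @` K).
    apply: continuous_compact => //; apply: continuous_in_subspaceT => y.
    by rewrite inE => /KD; exact: par_continuous.
  by move=> p ap y dy; exact: density_off.
Qed.

(** The function f / sqrt(det g) for f = density F, which is supported in the
   chart p0. *)
Definition source : M -> R :=
  of_coords (push i p0) (fun y => F y * (sqrtdet g (push i p0) y)^-1).

Lemma sqrtdet_mul_source : sqrtdet_mul_eq g i source (density F).
Proof.
have aq := push_atlas ap0; split=> [p ap y dy|x ix]; last first.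
  by rewrite /source of_coords_out // => -[z dz zE]; apply: ix; exists (p0 z).
have [yo|yo] := pselect (overlap p p0 y).
  have [dT TE] := transitionP yo; rewrite density_in // (sqrtdet_transition ap ap0 yo).
  have -> : i (p y) = (push i p0) (transition p p0 y) by rewrite /= TE.
  rewrite /source of_coords_par // -mulrA; congr (_ * _).
  rewrite mulrCA divff ?mulr1 //.
  by rewrite gt_eqF // sqrtdet_gt0.
rewrite density_out // /source of_coords_out ?mulr0 // => -[z dz /= zE].
apply: yo; split=> //; exists z => //.
by have [inj _ _] := iV; exact: inj.
Qed.

Context (mu : borel_measure R M) (lam : nat -> R) (phi : nat -> M -> R) (s : R).
Hypotheses (volume : is_volume g mu) (cM : compact [set: M]).
Hypotheses (spectrum : is_spectrum g mu lam phi) (s01 : 0 < s < 1).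

Let aq : atlas (push i p0) := push_atlas ap0.
Let oD := dom_open aq.

Lemma source_off (y : 'rV[R]_n) : ~ K y -> F y * (sqrtdet g (push i p0) y)^-1 = 0.
Proof. by move=> Ky; rewrite F0 // mul0r. Qed.

Lemma Ck_source : Ck 4 (dom (push i p0)) (fun y => F y * (sqrtdet g (push i p0) y)^-1).
Proof.
apply: (CkM oD (k := 4)); first exact: Ck_subset (CF 4).
apply: (Ck_inv oD (k := 4)); last exact: Ck_sqrtdet.
by move=> y dy; rewrite gt_eqF // sqrtdet_gt0.
Qed.

Lemma l2_source : l2 mu (source : borel M -> R).
Proof.
apply: (l2_continuous volume cM).
apply: (of_coords_continuous aq cK KD source_off) => y dy.
exact: (Ck_continuous oD Ck_source).
Qed.

(** The factor sqrt(det g) cancels, so that this pairing is an integral in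
   coordinates in which the metric does not occur. *)
Lemma ip_source (u : borel M -> R) : l2 mu u ->
  ip mu (source : borel M -> R) u = \int[leb R n]_y (F y * u (i (p0 y))).
Proof.
move=> lu; apply: (integral_chart volume aq).
- by apply: measurable_funM; [exact: l2_source.1|exact: lu.1].
- by move=> x px; rewrite /source of_coords_out // mul0r.
- by move=> y dy; rewrite F0 ?mul0r // => /KD.
move=> y dy; rewrite /source of_coords_par // mulrAC; congr (_ * _).
by rewrite -mulrA mulVf ?mulr1 // gt_eqF // sqrtdet_gt0.
Qed.

Hypothesis intF : \int[leb R n]_y F y = 0.

Let one_l2 : l2 mu (fun=> 1 : R).
Proof. by apply: (l2_continuous volume cM) => x; exact: cst_continuous. Qed.

Lemma mean_source : ip mu (source : borel M -> R) (fun=> 1) = 0.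
Proof. by rewrite ip_source //; under eq_Rintegral do rewrite mulr1. Qed.

Let lphi := l2_eigenfunction volume cM spectrum.
Let ophi := eigenfunction_orthonormal spectrum.
Let cphi := eigenfunction_complete spectrum.

Lemma frac_sum_l2 (u : borel M -> R) N : l2 mu u ->
  l2 mu (frac_sum mu (phi : nat -> borel M -> R) lam s u N).
Proof.
move=> lu; rewrite (_ : frac_sum _ _ _ _ _ _ = expansion (phi : nat -> borel M -> R)
  (fun j => if j == 0%N then 0 else lam j `^ s * coef mu (phi : nat -> borel M -> R) u j) N).
  exact: l2_expansion.
by apply/funext => x; exact: frac_sumE.
Qed.

Lemma fractional_laplacianP (u h : borel M -> R) : l2 mu u -> l2 mu h ->
  is_fractional_laplacian mu lam phi s u h <->
  ip mu (fun x => h x - frac_sum mu (phi : nat -> borel M -> R) lam s u N x)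
        (fun x => h x - frac_sum mu (phi : nat -> borel M -> R) lam s u N x)
     @[N --> \oo] --> 0.
Proof.
move=> lu lh; have lN N : l2 mu (fun x => h x - frac_sum mu (phi : nat -> borel M -> R) lam s u N x).
  by apply: l2B => //; exact: frac_sum_l2.
rewrite -(cvg_Lnorm2 lN); split=> [[_ _ H]|H]; first exact: H.
by split; [exact/l2P|exact/l2P|exact: H].
Qed.

Lemma source_to_solution_exists : exists v,
  source_to_solution g mu lam phi s i (density F, v).
Proof.
have [[lam0 lam1 lamS] _ _ _] := spectrum.
have lh := l2_source.
have h0 := (mean_eq0 volume cM spectrum lh).1 mean_source.
have [u [lu u0 Hu]] := fractional_solution lphi ophi cphi lam1 lamS s01 lh h0.
exists (u \o i); split=> /=; first exact: Cc_density_density.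
  by exists source; [exact: sqrtdet_mul_source|exact: mean_source].
exists u; split=> //.
  exists source; last exact: sqrtdet_mul_source.
  by apply/fractional_laplacianP.
exact: (mean_eq0 volume cM spectrum lu).2.
Qed.

(** By sqrtdet_mul_inj, the fractional Laplacian of the solution is the source
   itself. *)
Lemma source_to_solutionP v : source_to_solution g mu lam phi s i (density F, v) ->
  exists u : borel M -> R, [/\ l2 mu u,
    ip mu (fun x => source x - frac_sum mu (phi : nat -> borel M -> R) lam s u N x)
          (fun x => source x - frac_sum mu (phi : nat -> borel M -> R) lam s u N x)
     @[N --> \oo] --> 0 &
    ip mu (source : borel M -> R) u = \int[leb R n]_y (F y * v (p0 y))].
Proof.
move=> [_ _ [u [[w Hw wf] _ /= ->]]].
have wE := sqrtdet_mul_inj wf sqrtdet_mul_source; rewrite {w wf}wE in Hw.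
have lu : l2 mu (u : borel M -> R) by have [/l2P] := Hw.
exists u; split=> //; first by apply/(fractional_laplacianP lu l2_source).
exact: ip_source.
Qed.

End source.
End identification.

(** * Oscillating sources and quasimodes *)

Section oscillations.
Context (R : realType) (n : nat).
Implicit Types (xi e y : 'rV[R]_n) (P Q chi : 'rV[R]_n -> R) (tau w : R).
Local Notation e_ i := (delta_mx 0 i : 'rV[R]_n).

Definition phase xi tau w y : R := tau * (\sum_i xi 0 i * y 0 i) + w.

Lemma Ck_phase k xi tau w : Ck k setT (phase xi tau w).
Proof.
apply: (CkD openT); last exact: Ck_cst.
apply: (CkZ openT); apply: (Ck_sum openT) => i _.
by apply: (CkZ openT); exact: (Ck_coord openT).
Qed.

Lemma derive_affine (f : 'rV[R]_n -> R) y (v : 'rV[R]_n) (c : R) :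
  (forall h : R, f (h *: v + y) = f y + h * c) -> 'D_v f y = c.
Proof.
move=> fE; rewrite /derive; apply/cvg_lim => //; apply: cvg_near_cst.
near=> h; have h0 : h != 0 by near: h; exact: nbhs_dnbhs_neq.
by rewrite /= fE addrAC subrr add0r -[_ *: _]/(_ * _) mulrA mulVf ?mul1r.
Unshelve. all: by end_near. Qed.

Lemma partial_phase i xi tau w y : partial i (phase xi tau w) y = tau * xi 0 i.
Proof.
apply: derive_affine => h; rewrite /phase addrAC; congr (_ + w).
rewrite mulrCA -mulrDr; congr (_ * _); rewrite addrC.
under eq_bigr do rewrite !mxE mulrDr.
rewrite big_split /=; congr (_ + _); rewrite (bigD1 i) //= eqxx big1 ?addr0.
  by rewrite mulr1 mulrC.
by move=> j ji; rewrite (negPf ji) !mulr0.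
Qed.

Lemma partial_cos i xi tau w y : is_derive y (e_ i) (fun z => cos (phase xi tau w z))
  (- (tau * xi 0 i * sin (phase xi tau w y))).
Proof.
have D := is_derive_comp1 (e_ i) (Ck_differentiable openT (Ck_phase 1 xi tau w) I)
  (is_derive_cos (phase xi tau w y)).
by rewrite -[X in is_derive _ _ _ X]/_ -(partial_phase i xi tau w y) mulrC -mulNr.
Qed.

Lemma partial_sin i xi tau w y : is_derive y (e_ i) (fun z => sin (phase xi tau w z))
  (tau * xi 0 i * cos (phase xi tau w y)).
Proof.
have D := is_derive_comp1 (e_ i) (Ck_differentiable openT (Ck_phase 1 xi tau w) I)
  (is_derive_sin (phase xi tau w y)).
by rewrite -(partial_phase i xi tau w y) mulrC.
Qed.

Lemma partial_osc i P Q xi tau w y : derivable P y (e_ i) -> derivable Q y (e_ i) ->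
  partial i (fun z => P z * cos (phase xi tau w z) + Q z * sin (phase xi tau w z)) y =
  (partial i P y + tau * xi 0 i * Q y) * cos (phase xi tau w y) +
  (partial i Q y - tau * xi 0 i * P y) * sin (phase xi tau w y).
Proof.
move=> dP dQ; have [dc cE] := partial_cos i xi tau w y; have [ds sE] := partial_sin i xi tau w y.
rewrite (partialD (derivableM dP dc) (derivableM dQ ds)) (partialM dP dc) (partialM dQ ds).
rewrite {2 4}/partial cE sE; ring.
Qed.

Lemma partialZ i (c : R) P y : derivable P y (e_ i) ->
  partial i (fun z => c * P z) y = c * partial i P y.
Proof.
move=> dP; have dc : derivable (fun=> c) y (e_ i) by exact: derivable_cst.
by rewrite (partialM dc dP) partial_cst mul0r add0r.
Qed.

(** When e and xi are dual to each other, this is chi * cos (phase) up to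
   O(tau^-1). Being a derivative, it has integral zero. *)
Definition test chi e xi tau w y : R :=
  tau^-1 * \sum_i e 0 i * partial i (fun z => chi z * sin (phase xi tau w z)) y.

Section test.
Variables (chi : 'rV[R]_n -> R) (K : set 'rV[R]_n) (e xi : 'rV[R]_n).
Hypotheses (Cchi : forall k, Ck k setT chi) (cK : compact K).
Hypothesis chi0 : forall y, ~ K y -> chi y = 0.
Hypothesis exi : \sum_i e 0 i * xi 0 i = 1.

Let Cmod k tau w : Ck k setT (fun z => chi z * sin (phase xi tau w z)).
Proof. by apply: (CkM openT) => //; have [] := Ck_sin_cos openT (Ck_phase k xi tau w). Qed.

Let mod0 tau w y : ~ K y -> chi y * sin (phase xi tau w y) = 0.
Proof. by move=> Ky; rewrite chi0 // mul0r. Qed.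

Lemma Ck_test k tau w : Ck k setT (test chi e xi tau w).
Proof.
apply: (CkZ openT); apply: (Ck_sum openT) => i _; apply: (CkZ openT).
exact: Ck_partial (Cmod k.+1 tau w).
Qed.

Lemma test_off tau w y : ~ K y -> test chi e xi tau w y = 0.
Proof.
move=> Ky; rewrite /test big1 ?mulr0 // => i _.
by rewrite (partial_off i (compact_rV_closed cK) (@mod0 tau w) Ky) mulr0.
Qed.

Lemma integral_test tau w : \int[leb R n]_y test chi e xi tau w y = 0.
Proof.
have [r r0 Kr] := compact_in_cube cK.
have m0 y : ~ @cube R n r y -> chi y * sin (phase xi tau w y) = 0.
  by move=> ry; apply: mod0 => /Kr.
pose T i y := tau^-1 * e 0 i * partial i (fun z => chi z * sin (phase xi tau w z)) y.
have CT i : Ck 0 setT (T i) by apply: (CkZ openT (k := 0)); exact: Ck_partial (Cmod 1 tau w).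
have T0 i y : ~ @cube R n r y -> T i y = 0.
  by move=> ry; rewrite /T (partial_support0 i m0 ry) mulr0.
transitivity (\int[leb R n]_y \sum_i T i y).
  apply: eq_Rintegral => y _; rewrite /test mulr_sumr; apply: eq_bigr => i _.
  by rewrite mulrA.
rewrite (Rintegral_sum_compact _ CT T0) big1 // => i _.
rewrite RintegralZl //; last first.
  apply: (@continuous_integrable _ _ _ r) => [y|y ry].
    exact: (Ck_partial i (Cmod 1 tau w)).
  exact: (partial_support0 i m0 ry).
by rewrite (integral_partial_eq0 i (Cmod 1 tau w) m0) mulr0.
Qed.

Lemma testE tau w y : tau != 0 -> test chi e xi tau w y =
  chi y * cos (phase xi tau w y) +
  tau^-1 * ((\sum_i e 0 i * partial i chi y) * sin (phase xi tau w y)).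
Proof.
move=> t0; rewrite /test.
have E i : partial i (fun z => chi z * sin (phase xi tau w z)) y =
    partial i chi y * sin (phase xi tau w y) +
    tau * (xi 0 i * (chi y * cos (phase xi tau w y))).
  have [ds sE] := partial_sin i xi tau w y.
  rewrite (partialM ((Cchi 1 i).1 y I) ds).
  rewrite [X in _ + _ * X]/partial sE; ring.
under eq_bigr do rewrite E mulrDr.
rewrite big_split /= mulrDr addrC; congr (_ + _); last first.
  by rewrite mulr_suml; congr (_ * _); apply: eq_bigr => i _; rewrite mulrA.
transitivity (tau^-1 * (tau * (\sum_i e 0 i * xi 0 i) * (chi y * cos (phase xi tau w y)))).
  congr (_ * _); rewrite mulr_sumr mulr_suml; apply: eq_bigr => i _.
  move: (cos _) => c; ring.
by rewrite exi mulr1 mulKf.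
Qed.

End test.
End oscillations.

Lemma dual_neq0 (R : realType) n (e xi : 'rV[R]_n) : \sum_j e 0 j * xi 0 j = 1 -> xi != 0.
Proof.
move=> exi; apply/eqP => x0; have := exi; rewrite x0 big1 => [/esym/eqP|j _].
  by rewrite oner_eq0.
by rewrite mxE mulr0.
Qed.

Section compactly_supported.
Context (R : realType) (n : nat) (U K : set 'rV[R]_n).
Hypotheses (oU : open U) (cK : compact K) (KU : K `<=` U).
Implicit Types (f h : 'rV[R]_n -> R).
Local Notation I f := (\int[leb R n]_y f y).

(** Continuous functions supported in K; as K is inside U, the values off U of a
   factor that is multiplied by such a function are irrelevant. *)
Definition supported f := Ck 0 U f /\ forall y, ~ K y -> f y = 0.

Lemma supported_continuous f : supported f -> continuous f.
Proof. by move=> [Cf f0] y; exact: (Ck_extend oU cK KU f0 Cf). Qed.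

Lemma supported_integrable f : supported f -> (leb R n).-integrable setT (EFin \o f).
Proof.
move=> sf; have [r r0 Kr] := compact_in_cube cK.
apply: (@continuous_integrable _ _ _ r); first exact: supported_continuous.
by move=> y ry; apply: sf.2 => /Kr.
Qed.

Lemma supportedMr f h : supported f -> Ck 0 U h -> supported (fun y => f y * h y).
Proof.
move=> [Cf f0] Ch; split; first exact: (CkM oU (k := 0)).
by move=> y Ky; rewrite f0 // mul0r.
Qed.

Lemma supportedD f h : supported f -> supported h -> supported (fun y => f y + h y).
Proof.
move=> [Cf f0] [Ch h0]; split; first exact: (CkD oU (k := 0)).
by move=> y Ky; rewrite f0 // h0 // addr0.
Qed.

Lemma supportedZ (c : R) f : supported f -> supported (fun y => c * f y).
Proof.
move=> [Cf f0]; split; first exact: (CkZ oU (k := 0)).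
by move=> y Ky; rewrite f0 // mulr0.
Qed.

Lemma supportedB f h : supported f -> supported h -> supported (fun y => f y - h y).
Proof.
move=> [Cf f0] [Ch h0]; split; first exact: (CkB oU (k := 0)).
by move=> y Ky; rewrite f0 // h0 // subr0.
Qed.

Lemma supported_norm f : supported f -> supported (fun y => `|f y|).
Proof.
move=> [Cf f0]; split; last by move=> y Ky; rewrite f0 // normr0.
move=> y Uy; apply: (@continuous_comp _ _ _ f (fun x : R => `|x|)); first exact: Cf.
exact: norm_continuous.
Qed.

Lemma supported_sum (J : Type) (s : seq J) (F : J -> 'rV[R]_n -> R) :
  (forall j, supported (F j)) -> supported (fun y => \sum_(j <- s) F j y).
Proof.
move=> sF; split; first by apply: (Ck_sum oU (k := 0)) => j _; exact: (sF j).1.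
by move=> y Ky; rewrite big1 // => j _; rewrite (sF j).2.
Qed.

Lemma integralD_supported f h : supported f -> supported h ->
  I (fun y => f y + h y) = I f + I h.
Proof. by move=> sf sh; rewrite RintegralD //; exact: supported_integrable. Qed.

Lemma integralZ_supported (c : R) f : supported f -> I (fun y => c * f y) = c * I f.
Proof. by move=> sf; rewrite RintegralZl //; exact: supported_integrable. Qed.

Lemma le_integral_supported f h : supported f -> supported h ->
  (forall y, K y -> f y <= h y) -> I f <= I h.
Proof.
move=> sf sh fh; apply: le_Rintegral => //; [exact: supported_integrable..|].
move=> y _; have [Ky|Ky] := pselect (K y); first exact: fh.
by rewrite sf.2 // sh.2.
Qed.

Lemma dist_integral_supported (c : R) f h e : supported f -> supported h -> supported e ->
  (forall y, K y -> `|f y - h y| <= c * e y) -> `|I f - I h| <= c * I e.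
Proof.
move=> sf sh se fh; rewrite -(integralZ_supported c se).
have sce := supportedZ c se.
rewrite ler_distl lerBlDr -!integralD_supported //; apply/andP; split.
- apply: le_integral_supported => //; first exact: supportedD.
  by move=> y /fh; rewrite ler_distl lerBlDr => /andP[].
- apply: le_integral_supported => //; first exact: supportedD.
  by move=> y /fh; rewrite ler_distl => /andP[].
Qed.

End compactly_supported.

Section quasimode.
Context (R : realType) (n : nat) (M : manifold R n) (g : metric 4 M).
Variables (p : chart R n M) (K : set 'rV[R]_n) (chi : 'rV[R]_n -> R) (xi : 'rV[R]_n).
Hypotheses (ap : atlas p) (cK : compact K) (KD : K `<=` dom p).
Hypotheses (Cchi : forall k, Ck k setT chi) (chi0 : forall y, ~ K y -> chi y = 0).
Hypothesis xi0 : xi != 0.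
Let oD := dom_open ap.
Let clK := compact_rV_closed cK.
Local Notation rho := (sqrtdet g p).
Local Notation supported := (supported (dom p) K).

(** The principal symbol of the Laplacian, at the covector xi. *)
Definition symbol y : R := \sum_a xi 0 a * \sum_b invmx (g p y) a b * xi 0 b.

Lemma symbolE y : symbol y = (xi *m invmx (g p y) *m xi^T) 0 0.
Proof.
rewrite -mulmxA mxE; apply: eq_bigr => a _; congr (_ * _); rewrite mxE.
by apply: eq_bigr => b _; rewrite mxE.
Qed.

Lemma symbol_gt0 y : dom p y -> 0 < symbol y.
Proof.
move=> dy; rewrite symbolE; apply: posdef_inv => //; first exact: gmat_sym.
exact: gmat_posdef.
Qed.

Lemma Ck_symbol : Ck 4 (dom p) symbol.
Proof.
apply: (Ck_sum oD) => a _; apply: (CkZ oD); apply: (Ck_sum oD) => b _.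
by apply: (CkM oD); [exact: Ck_invg|exact: Ck_cst].
Qed.

Lemma rho_neq0 y : dom p y -> rho y != 0.
Proof. by move=> dy; rewrite gt_eqF // sqrtdet_gt0. Qed.

Lemma Ck_invrho : Ck 4 (dom p) (fun y => (rho y)^-1).
Proof. by apply: (Ck_inv oD); [exact: rho_neq0|exact: Ck_sqrtdet]. Qed.

Lemma kap_gt0 y : dom p y -> 0 < rho y * symbol y.
Proof. by move=> dy; rewrite mulr_gt0 ?sqrtdet_gt0 ?symbol_gt0. Qed.

Lemma Ck_invkap : Ck 4 (dom p) (fun y => (rho y * symbol y)^-1).
Proof.
apply: (Ck_inv oD) => [y dy|]; first by rewrite gt_eqF // kap_gt0.
by apply: (CkM oD); [exact: Ck_sqrtdet|exact: Ck_symbol].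
Qed.

(** With this amplitude, the terms of order tau^2 of the Laplacian of the
   quasimode add up to - tau^2 * chi * cos (phase) / sqrt(det g). *)
Definition amplitude y : R := chi y * (rho y * symbol y)^-1.

Lemma Ck_amplitude : Ck 4 (dom p) amplitude.
Proof.
by apply: (CkM oD); [exact: Ck_subset (Cchi 4)|exact: Ck_invkap].
Qed.

Lemma amplitude_off y : ~ K y -> amplitude y = 0.
Proof. by move=> Ky; rewrite /amplitude chi0 // mul0r. Qed.

Definition quasimode tau w y : R := amplitude y * cos (phase xi tau w y).

Lemma Ck_quasimode tau w : Ck 4 (dom p) (quasimode tau w).
Proof.
apply: (CkM oD); first exact: Ck_amplitude.
by have [_] := Ck_sin_cos openT (Ck_phase 4 xi tau w); exact: Ck_subset.
Qed.

Lemma quasimode_off tau w y : ~ K y -> quasimode tau w y = 0.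
Proof. by move=> Ky; rewrite /quasimode amplitude_off // mul0r. Qed.

Let P a z : R := flux g p amplitude a z.
Let Q a z : R := rho z * (\sum_b invmx (g p z) a b * xi 0 b) * amplitude z.

Let CP a : Ck 3 (dom p) (P a).
Proof. exact: (@Ck_flux _ _ _ g p ap 3 amplitude a isT Ck_amplitude). Qed.

Let CQ a : Ck 4 (dom p) (Q a).
Proof.
apply: (CkM oD); last exact: Ck_amplitude.
apply: (CkM oD); first exact: Ck_sqrtdet.
by apply: (Ck_sum oD) => b _; apply: (CkM oD); [exact: Ck_invg|exact: Ck_cst].
Qed.

Let flux_quasimode tau w a z : dom p z -> flux g p (quasimode tau w) a z =
  P a z * cos (phase xi tau w z) + (- tau * Q a z) * sin (phase xi tau w z).
Proof.
move=> dz; rewrite /P /Q /flux.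
have E b : partial b (quasimode tau w) z = partial b amplitude z * cos (phase xi tau w z)
    - tau * (xi 0 b * (amplitude z * sin (phase xi tau w z))).
  have [dc cE] := partial_cos b xi tau w z.
  have dA := (Ck_leq oD (isT : (1 <= 4)%N) Ck_amplitude b).1 z dz.
  rewrite (partialM dA dc) [X in _ + _ * X]/partial cE; ring.
transitivity (rho z * \sum_b (invmx (g p z) a b * partial b amplitude z * cos (phase xi tau w z) +
    invmx (g p z) a b * xi 0 b * (- tau * (amplitude z * sin (phase xi tau w z))))).
  congr (_ * _); apply: eq_bigr => b _; rewrite E.
  move: (cos _) (sin _) (partial b amplitude z) (amplitude z) => x1 x2 x3 x4; ring.
rewrite big_split /= -!mulr_suml.
move: (cos _) (sin _) (\sum_i _) (\sum_i _) (rho z) (amplitude z) => x1 x2 x3 x4 x5 x6; ring.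
Qed.

Let B1 y : R := \sum_a (partial a (Q a) y + xi 0 a * P a y).
Let B2 y : R := \sum_a partial a (P a) y.

Let sumQ y : dom p y -> \sum_a xi 0 a * Q a y = chi y.
Proof.
move=> dy; transitivity (rho y * symbol y * amplitude y).
  rewrite /symbol mulr_sumr mulr_suml; apply: eq_bigr => a _; rewrite /Q; ring.
by rewrite /amplitude mulrCA divff ?mulr1 // gt_eqF // kap_gt0.
Qed.

Let laplace_quasimode tau w y : dom p y ->
  rho y * laplace_beltrami g p (quasimode tau w) y =
  (B2 y - tau ^+ 2 * chi y) * cos (phase xi tau w y) - tau * B1 y * sin (phase xi tau w y).
Proof.
move=> dy; rewrite /laplace_beltrami mulrA divff ?rho_neq0 // mul1r.
rewrite -(sumQ dy) /B1 /B2 mulr_sumr -sumrB mulr_suml mulr_sumr mulr_suml -sumrB.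
apply: eq_bigr => a _; rewrite -/(flux g p (quasimode tau w) a).
rewrite (partial_eq oD a (flux_quasimode tau w a) dy).
have dP : derivable (P a) y (delta_mx 0 a) by exact: (CP a a).1.
have dQ : derivable (Q a) y (delta_mx 0 a) by exact: (CQ a a).1.
have dtQ : derivable (fun z => - tau * Q a z) y (delta_mx 0 a).
  exact: (CkZ oD (- tau) (CQ a) a).1.
by rewrite (partial_osc _ _ _ dP dtQ) (partialZ _ dQ); ring.
Qed.

Let P0 a y : ~ K y -> P a y = 0.
Proof. by move=> Ky; exact: (@flux_off _ _ _ g p K cK amplitude a y amplitude_off Ky). Qed.

Let Q0 a y : ~ K y -> Q a y = 0.
Proof. by move=> Ky; rewrite /Q amplitude_off // mulr0. Qed.

(** The density - sqrt(det g) * Delta (quasimode), divided by tau^2. It is chi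
   * cos (phase) up to O(tau^-1), as is the test source. *)
Definition quasisource tau w y : R :=
  - (tau^-1 ^+ 2) * (rho y * laplace_beltrami g p (quasimode tau w) y).

Lemma Ck_laplace_quasimode tau w : Ck 0 (dom p) (laplace_beltrami g p (quasimode tau w)).
Proof. by apply: Ck_laplace_beltrami => //; exact: Ck_leq (Ck_quasimode tau w). Qed.

Lemma supported_quasisource tau w : supported (quasisource tau w).
Proof.
split; last first.
  move=> y Ky; rewrite /quasisource (@laplace_beltrami_off _ _ _ g p K cK _ y (@quasimode_off tau w) Ky).
  by rewrite !mulr0.
apply: (CkZ oD (k := 0)); apply: (CkM oD (k := 0)); last exact: Ck_laplace_quasimode.
by apply: (Ck_leq oD (k := 4)); last exact: Ck_sqrtdet.
Qed.

(** B1 and B2 collect the terms of orders tau and 1 of the Laplacian of the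
   quasimode. *)
Lemma quasisource_approx : exists2 b, supported b &
  forall tau w y, 1 <= tau -> K y ->
    `|quasisource tau w y - chi y * cos (phase xi tau w y)| <= tau^-1 * b y.
Proof.
have sB1 : supported B1.
  apply: supported_sum => // a; split; last first.
    by move=> y Ky; rewrite P0 // mulr0 addr0 (partial_off a clK (Q0 a)).
  apply: (CkD oD (k := 0)).
    by apply: (Ck_leq oD (k := 3)) => //; exact: Ck_partial (CQ a).
  by apply: (CkZ oD (k := 0)); apply: (Ck_leq oD (k := 3)).
have sB2 : supported B2.
  apply: supported_sum => // a; split; last first.
    by move=> y Ky; rewrite (partial_off a clK (P0 a)).
  by apply: (Ck_leq oD (k := 2)) => //; exact: Ck_partial (CP a).
exists (fun y => `|B1 y| + `|B2 y|).
  by apply: supportedD => //; exact: supported_norm.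
move=> tau w y t1 Ky; have dy := KD Ky.
have t0 : 0 < tau := lt_le_trans ltr01 t1.
rewrite /quasisource laplace_quasimode //.
have -> : - tau^-1 ^+ 2 * ((B2 y - tau ^+ 2 * chi y) * cos (phase xi tau w y) -
   tau * B1 y * sin (phase xi tau w y)) - chi y * cos (phase xi tau w y) =
   tau^-1 * (B1 y * sin (phase xi tau w y)) - tau^-1 ^+ 2 * (B2 y * cos (phase xi tau w y)).
  by field; rewrite gt_eqF.
have ti0 : 0 <= tau^-1 by rewrite invr_ge0 ltW.
have ti1 : tau^-1 <= 1 by rewrite invf_le1.
apply: (le_trans (ler_normB _ _)); rewrite mulrDr; apply: lerD.
  rewrite normrM ger0_norm // ler_wpM2l // normrM ler_piMr //.
  exact: sin_max.
rewrite normrM ger0_norm ?sqr_ge0 // expr2 -mulrA ler_wpM2l //.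
rewrite -[leRHS]mul1r ler_pM // normrM ler_piMr //.
exact: cos_max.
Qed.

End quasimode.

(** * High frequency energies *)

Section scaling.
Variable R : realType.
Implicit Types (s t a x : R).

Lemma powR_scale s t a x : 0 < t -> 0 < a -> t `^ s * (t * a) `^ (x - s) = t `^ x * a `^ (x - s).
Proof.
move=> t0 a0; rewrite powRM ?ltW // mulrA -powRD ?subrKC //.
by apply/implyP => _; rewrite gt_eqF.
Qed.

(** After multiplication by T = t^s the powers of t in the bound of
   fractional_form_upper cancel. *)
Lemma scaled_upper (T t m1 m2 a1 a2 s e L Q X Y Z : R) : 0 < t -> 0 <= T ->
  T * m1 = t * a1 -> T * m2 = a2 ->
  Q <= (1 + e) * t^-1 ^+ 2 * (s * m1 * (t * X) + (1 - s) * m2 * (t ^+ 2 * Y))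
       + (1 + e^-1) * L * Z ->
  T * Q <= (1 + e) * (s * a1 * X + (1 - s) * a2 * Y) + (1 + e^-1) * L * (T * Z).
Proof.
move=> t0 T0 E1 E2 HQ; apply: le_trans (ler_wpM2l T0 HQ) _.
have -> : T * ((1 + e) * t^-1 ^+ 2 * (s * m1 * (t * X) + (1 - s) * m2 * (t ^+ 2 * Y))
       + (1 + e^-1) * L * Z) =
   (1 + e) * t^-1 ^+ 2 * (s * (T * m1) * (t * X) + (1 - s) * (T * m2) * (t ^+ 2 * Y))
       + (1 + e^-1) * L * (T * Z) by move: (e^-1) (t^-1) => ? ?; ring.
rewrite E1 E2 le_eqVlt; apply/orP; left; apply/eqP; congr (_ + _).
by field; rewrite gt_eqF.
Qed.

Lemma scaled_lower (T t m1 m3 a1 a3 s e L Q X W Z : R) : 0 < t -> 0 <= T ->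
  T * m1 = t * a1 -> T * m3 = t ^+ 2 * a3 ->
  (1 - e) * t^-1 ^+ 2 * ((2 - s) * m1 * (t * X) - (1 - s) * m3 * W) - e^-1 * L * Z <= Q ->
  (1 - e) * ((2 - s) * a1 * X - (1 - s) * a3 * W) - e^-1 * L * (T * Z) <= T * Q.
Proof.
move=> t0 T0 E1 E2 HQ; apply: le_trans _ (ler_wpM2l T0 HQ).
have -> : T * ((1 - e) * t^-1 ^+ 2 * ((2 - s) * m1 * (t * X) - (1 - s) * m3 * W) - e^-1 * L * Z) =
   (1 - e) * t^-1 ^+ 2 * ((2 - s) * (T * m1) * (t * X) - (1 - s) * (T * m3) * W)
       - e^-1 * L * (T * Z) by move: (e^-1) (t^-1) => ? ?; ring.
rewrite E1 E2 le_eqVlt; apply/orP; left; apply/eqP; congr (_ - _).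
by field; rewrite gt_eqF.
Qed.

(** The integrals XA and YA are replaced by their limits X1 and X2; the errors
   are gathered in c1 and c2. *)
Lemma combine_bounds (s e ei L ti ts A1 A2 A3 XA X1 YA X2 X3 E1 E2 E3 TZ TQ c1 c2 : R) :
  0 < s < 1 -> 0 < e < 1 -> 0 <= ei -> 0 <= L -> 0 <= ti -> 0 <= A1 -> 0 <= A2 -> 0 <= ts ->
  X1 - ti * E1 <= XA -> XA <= X1 + ti * E1 -> YA <= X2 + ti * E2 -> TZ <= ts * E3 ->
  (1 - e) * ((2 - s) * A1 * XA - (1 - s) * A3 * X3) - ei * L * TZ <= TQ ->
  TQ <= (1 + e) * (s * A1 * XA + (1 - s) * A2 * YA) + (1 + ei) * L * TZ ->
  c1 = `|(1 + e) * (s * A1 * E1 + (1 - s) * A2 * E2)| + `|(1 - e) * ((2 - s) * A1 * E1)| ->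
  c2 = `|(1 + ei) * L * E3| + `|ei * L * E3| ->
  (1 - e) * ((2 - s) * A1 * X1 - (1 - s) * A3 * X3) - (c1 * ti + c2 * ts) <= TQ <=
  (1 + e) * (s * A1 * X1 + (1 - s) * A2 * X2) + (c1 * ti + c2 * ts).
Proof.
move=> /andP[s0 s1] /andP[e0 e1] ei0 L0 ti0 A10 A20 ts0 xl xu yu tz lo up c1E c2E.
have s0' := ltW s0; have s1' : 0 <= 1 - s by rewrite subr_ge0 ltW.
have s2' : 0 <= 2 - s by apply: le_trans s1' _; lra.
have e0' : 0 <= 1 + e by rewrite addr_ge0 // ltW.
have e1' : 0 <= 1 - e by rewrite subr_ge0 ltW.
apply/andP; split.
- apply: le_trans lo.
  have B1 : ei * L * TZ <= ei * L * (ts * E3) by rewrite ler_wpM2l ?mulr_ge0.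
  have B2 : (1 - e) * ((2 - s) * A1 * (X1 - ti * E1)) <= (1 - e) * ((2 - s) * A1 * XA).
    by rewrite ler_wpM2l // ler_wpM2l // mulr_ge0.
  have B3 : (1 - e) * ((2 - s) * A1 * E1) * ti <= c1 * ti.
    by rewrite ler_wpM2r // (le_trans (ler_norm _)) // c1E lerDr.
  have B4 : ei * L * E3 * ts <= c2 * ts.
    by rewrite ler_wpM2r // (le_trans (ler_norm _)) // c2E lerDr.
  move: B1 B2 B3 B4; move: (c1 * ti) (c2 * ts) => x1 x2; lra.
- apply: (le_trans up).
  have B1 : (1 + ei) * L * TZ <= (1 + ei) * L * (ts * E3).
    by rewrite ler_wpM2l ?mulr_ge0 ?addr_ge0.
  have B2 : (1 + e) * (s * A1 * XA + (1 - s) * A2 * YA) <=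
     (1 + e) * (s * A1 * (X1 + ti * E1) + (1 - s) * A2 * (X2 + ti * E2)).
    by rewrite ler_wpM2l // lerD // ler_wpM2l // mulr_ge0.
  have B3 : (1 + e) * (s * A1 * E1 + (1 - s) * A2 * E2) * ti <= c1 * ti.
    by rewrite ler_wpM2r // (le_trans (ler_norm _)) // c1E lerDl.
  have B4 : (1 + ei) * L * E3 * ts <= c2 * ts.
    by rewrite ler_wpM2r // (le_trans (ler_norm _)) // c2E lerDl.
  move: B1 B2 B3 B4; move: (c1 * ti) (c2 * ts) => x1 x2; lra.
Qed.

Lemma error_small (s c1 c2 d : R) : s < 1 -> 0 < d -> exists2 tau0, 1 <= tau0 &
  forall tau, tau0 <= tau -> c1 * tau^-1 + c2 * (tau ^+ 2) `^ (s - 1) <= d.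
Proof.
move=> s1 d0; have s1' : 0 < 1 - s by rewrite subr_gt0.
pose B1 := `|c1| / (d / 2); pose B2 := (`|c2| / (d / 2)) `^ (1 - s)^-1.
have d2 : 0 < d / 2 by rewrite divr_gt0.
have B10 : 0 <= B1 by rewrite divr_ge0 // ltW.
have B20 : 0 <= B2 by exact: powR_ge0.
exists (1 + B1 + B2); first by rewrite -addrA lerDl addr_ge0.
move=> tau tB; have t1 : 1 <= tau by apply: le_trans tB; rewrite -addrA lerDl addr_ge0.
have t0 : 0 < tau := lt_le_trans ltr01 t1.
have tB1 : B1 <= tau by apply: le_trans tB; rewrite -addrA addrCA lerDl addr_ge0.
have tB2 : B2 <= tau by apply: le_trans tB; rewrite lerDr addr_ge0.
rewrite [leRHS](splitr d); apply: lerD.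
  apply: (@le_trans _ _ (`|c1| * tau^-1)).
    by apply: ler_wpM2r; [rewrite invr_ge0 ltW|exact: ler_norm].
  by rewrite ler_pdivrMr // mulrC -ler_pdivrMr.
apply: (@le_trans _ _ (`|c2| * (tau ^+ 2) `^ (s - 1))).
  by rewrite ler_wpM2r ?powR_ge0 ?ler_norm.
rewrite -opprB powRN ler_pdivrMr ?powR_gt0 ?exprn_gt0 // mulrC -ler_pdivrMr //.
have -> : `|c2| / (d / 2) = B2 `^ (1 - s).
  by rewrite /B2 -powRrM mulVf ?gt_eqF // powRr1 // divr_ge0 // ltW.
apply: ge0_ler_powR; [exact: ltW|by rewrite nnegrE|by rewrite nnegrE ltW // exprn_gt0|].
by apply: le_trans tB2 _; rewrite expr2 ler_peMr // ltW.
Qed.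

End scaling.

Section energy.
Context (R : realType) (n : nat) (O M : manifold R n) (g : metric 4 M).
Context (i : O -> M) (V : set M) (mu : borel_measure R M).
Context (lam : nat -> R) (phi : nat -> M -> R) (s : R).
Hypotheses (iV : identifies i V) (volume : is_volume g mu) (cM : compact [set: M]).
Hypotheses (spectrum : is_spectrum g mu lam phi) (s01 : 0 < s < 1).
Variable p0 : chart R n O.
Hypothesis ap0 : atlas p0.
Local Notation q := (push i p0).
Local Notation rho := (sqrtdet g q).
Local Notation I f := (\int[leb R n]_y f y).
Local Notation phi_ := (phi : nat -> borel M -> R).
Let aq : atlas q := push_atlas iV ap0.
Let oD : open (dom q) := dom_open aq.

(** These two functions bound the energies of oscillating sources at high
   frequency, as weights of chi^2 * cos^2 (phase). They agree at the points
   where symbol g q xi is a0. *)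
Definition upper_symbol xi a0 y : R :=
  s * a0 `^ (1 - s) * (rho y * symbol g q xi y)^-1 + (1 - s) * a0 `^ (- s) * (rho y)^-1.

Definition lower_symbol xi a0 y : R :=
  (2 - s) * a0 `^ (1 - s) * (rho y * symbol g q xi y)^-1
  - (1 - s) * a0 `^ (2 - s) * (rho y * (rho y * symbol g q xi y)^-1 ^+ 2).

Section bounds.
Variables (K : set 'rV[R]_n) (chi : 'rV[R]_n -> R) (e xi : 'rV[R]_n).
Hypotheses (cK : compact K) (KD : K `<=` dom p0).
Hypotheses (Cchi : forall k, Ck k setT chi) (chi0 : forall y, ~ K y -> chi y = 0).
Hypothesis exi : \sum_j e 0 j * xi 0 j = 1.
Local Notation supp := (supported (dom q) K).
Local Notation kap y := (rho y * symbol g q xi y).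

Let xi0 : xi != 0 := dual_neq0 exi.
Let Crho : Ck 0 (dom q) rho := Ck_leq oD (leq0n 4) (Ck_sqrtdet g aq).
Let Cirho : Ck 0 (dom q) (fun y => (rho y)^-1) := Ck_leq oD (leq0n 4) (Ck_invrho g aq).
Let Cikap : Ck 0 (dom q) (fun y => (kap y)^-1) := Ck_leq oD (leq0n 4) (Ck_invkap g aq xi0).

Let supp_chi : supp chi.
Proof. by split=> //; exact: Ck_subset (Cchi 0). Qed.

Let Ccos tau w : Ck 0 (dom q) (fun y => cos (phase xi tau w y)).
Proof. by have [_] := Ck_sin_cos openT (Ck_phase 0 xi tau w); exact: Ck_subset. Qed.

Definition modulated tau w y : R := chi y * cos (phase xi tau w y).

Let supp_mod tau w : supp (modulated tau w).
Proof. exact: supportedMr. Qed.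

Let l2_coords f : supp f -> l2 mu (of_coords q f : borel M -> R).
Proof.
move=> [Cf f0]; apply: (l2_continuous volume cM).
exact: (of_coords_continuous aq cK KD f0).
Qed.

Let ip_coords f h : supp f -> supp h ->
  ip mu (of_coords q f : borel M -> R) (of_coords q h) = I (fun y => f y * h y * rho y).
Proof.
move=> sf sh; apply: (integral_chart volume aq).
- by apply: measurable_funM; [exact: (l2_coords sf).1|exact: (l2_coords sh).1].
- by move=> x px; rewrite of_coords_out // mul0r.
- by move=> y dy; rewrite sf.2 ?mul0r // => /KD.
by move=> y dy; rewrite !of_coords_par.
Qed.

Section form.
Variables (tau w a0 eta : R) (v : O -> R).
Hypotheses (tau0 : 0 < tau) (a00 : 0 < a0) (eta01 : 0 < eta < 1).
Let F := test chi e xi tau w.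
Let A := quasisource g q chi xi tau w.
Let qm := quasimode g q chi xi tau w.
Let LB := laplace_beltrami g q qm.
Let t := tau ^+ 2.
Hypothesis Hv : source_to_solution g mu lam phi s i (density p0 F, v).

Let F0 y : ~ K y -> F y = 0. Proof. exact: test_off. Qed.

Let CF k : Ck k setT F. Proof. exact: Ck_test. Qed.

Let sF : supp F. Proof. by split=> //; exact: Ck_subset (CF 0). Qed.

Let sA : supp A. Proof. exact: supported_quasisource. Qed.

Let sqm : supp qm.
Proof.
split; last by move=> y; exact: quasimode_off.
by apply: (Ck_leq oD (k := 4)) => //; exact: Ck_quasimode.
Qed.

Let sLB : supp (fun y => - LB y).
Proof.
split; last first.
  move=> y Ky; rewrite /LB (@laplace_beltrami_off _ _ _ g q K cK _ y) ?oppr0 //.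
  by move=> z; exact: quasimode_off.
by apply: (CkN oD (k := 0)); exact: Ck_laplace_quasimode.
Qed.

Let sr : supp (fun y => (F y - A y) * (rho y)^-1).
Proof. by apply: (supportedMr oD) => //; exact: (supportedB oD). Qed.

Let sh : supp (fun y => F y * (rho y)^-1). Proof. exact: (supportedMr oD). Qed.

Let t0 : 0 < t. Proof. by rewrite exprn_gt0. Qed.

Let offD y f : supp f -> ~ dom q y -> f y = 0.
Proof. by move=> sf dy; apply: sf.2 => /KD. Qed.

Let AE y : - LB y * rho y = t * A y.
Proof.
rewrite /A /quasisource -/qm -/LB /t; move: (LB y) (rho y) => x1 x2; field.
by rewrite gt_eqF.
Qed.

Let h := of_coords q (fun y => F y * (rho y)^-1) : borel M -> R.
Let v_ := of_coords q qm : borel M -> R.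
Let V_ := of_coords q (fun y => - LB y) : borel M -> R.
Let r_ := of_coords q (fun y => (F y - A y) * (rho y)^-1) : borel M -> R.

Let hE x : h x = t^-1 * V_ x + r_ x.
Proof.
have [px|px] := pselect ((q @` dom q) x); last first.
  by rewrite /h /V_ /r_ !of_coords_out // mulr0 addr0.
have [dx xE] := cinvP px; rewrite -xE /h /V_ /r_ !of_coords_par //.
have r0 := rho_neq0 g aq dx; have := AE (cinv q x).
move: (LB _) (A _) (F _) (rho _) r0 => x1 x2 x3 x4 x40 E.
have -> : x2 = t^-1 * (- x1 * x4) by rewrite E mulKf // gt_eqF.
by field; rewrite x40 gt_eqF.
Qed.

(** The bounds on ip h u for the source h, the quasimode v, its Laplacian V
   and r = (F - A) / sqrt(det g), with t = tau^2: the quadratic forms are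
   computed in the chart, where sqrt(det g) * V = t * A. *)
Lemma energy_form :
  (1 - eta) * ((2 - s) * a0 `^ (1 - s) * I (fun y => A y * qm y)
               - (1 - s) * a0 `^ (2 - s) * I (fun y => qm y * qm y * rho y))
    - eta^-1 * lam 1%N `^ (- s) *
      (t `^ s * I (fun y => (F y - A y) * (F y - A y) * (rho y)^-1))
  <= t `^ s * I (fun y => F y * v (p0 y)) <=
  (1 + eta) * (s * a0 `^ (1 - s) * I (fun y => A y * qm y)
               + (1 - s) * a0 `^ (- s) * I (fun y => A y * A y * (rho y)^-1))
    + (1 + eta^-1) * lam 1%N `^ (- s) *
      (t `^ s * I (fun y => (F y - A y) * (F y - A y) * (rho y)^-1)).
Proof.
have [s0 s1] := andP s01.
have [[lam0 lam1 lamS] _ _ _] := spectrum.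
have [u [lu Hu Qu]] := source_to_solutionP iV ap0 cK KD F0 CF volume cM spectrum Hv.
have lphi := l2_eigenfunction volume cM spectrum.
have ophi := eigenfunction_orthonormal spectrum.
have cphi := eigenfunction_complete spectrum.
have lV := l2_coords sLB; have lr := l2_coords sr; have lv := l2_coords sqm; have lh := l2_coords sh.
have HV k : coef mu phi_ V_ k =
    lam k * coef mu phi_ v_ k.
  apply: (coef_laplace_beltrami volume cM spectrum k aq cK KD).
    by move=> y; exact: quasimode_off.
  by apply: (Ck_leq oD (k := 4)) => //; exact: Ck_quasimode.
have Hr k : coef mu phi_ h k =
    t^-1 * coef mu phi_ V_ k + coef mu phi_ r_ k.
  rewrite /coef -ipZl // -ipDl //; last exact: l2Z.
  by congr (ip mu _ _); apply/funext => x; exact: hE.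
have mm0 : 0 < t * a0 by rewrite mulr_gt0.
have up := fractional_form_upper lphi ophi cphi lam0 lam1 lamS s01 lu lh lv lV lr Hu HV Hr mm0 eta01.
have lo := fractional_form_lower lphi ophi cphi lam0 lam1 lamS s01 lu lh lv lV lr Hu HV Hr mm0 eta01.
have Qu' : ip mu h u = I (fun y => F y * v (p0 y)) by exact: Qu.
rewrite Qu' in up lo.
have sAqm : supp (fun y => A y * qm y) by apply: (supportedMr oD) => //; exact: sqm.1.
have sAA : supp (fun y => A y * A y * (rho y)^-1).
  by apply: (supportedMr oD) => //; apply: (supportedMr oD) => //; exact: sA.1.
have ipVv : ip mu V_ v_ = t * I (fun y => A y * qm y).
  rewrite ip_coords // -(integralZ_supported oD cK KD) //; apply: eq_Rintegral => y _.
  by rewrite mulrAC AE mulrA.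
have ipVV : ip mu V_ V_ = t ^+ 2 * I (fun y => A y * A y * (rho y)^-1).
  rewrite ip_coords // -(integralZ_supported oD cK KD) //; apply: eq_Rintegral => y _.
  have [dy|dy] := pselect (dom q y); last first.
    by rewrite (offD sA dy) (offD sLB dy) !mul0r mulr0.
  have r0 := rho_neq0 g aq dy.
  transitivity ((- LB y * rho y) * (- LB y * rho y) * (rho y)^-1); last first.
    by rewrite AE; move: (A y) (rho y)^-1 => ? ?; ring.
  by move: (LB y) (rho y) r0 => ? ? ?; field.
have ipvv : ip mu v_ v_ = I (fun y => qm y * qm y * rho y) by rewrite ip_coords.
have iprr : ip mu r_ r_ = I (fun y => (F y - A y) * (F y - A y) * (rho y)^-1).
  rewrite ip_coords //; apply: eq_Rintegral => y _.
  have [dy|dy] := pselect (dom q y); last by rewrite (offD sF dy) (offD sA dy) subrr !mul0r.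
  have r0 := rho_neq0 g aq dy.
  by move: (F y) (A y) (rho y) r0 => ? ? ? ?; field.
rewrite ipVv ipVV iprr in up; rewrite ipVv ipvv iprr in lo.
have E1 : t `^ s * (t * a0) `^ (1 - s) = t * a0 `^ (1 - s).
  by rewrite powR_scale // powRr1 // ltW.
have E2 : t `^ s * (t * a0) `^ (- s) = a0 `^ (- s).
  by have := powR_scale s 0 t0 a00; rewrite sub0r powRr0 mul1r.
have E3 : t `^ s * (t * a0) `^ (2 - s) = t ^+ 2 * a0 `^ (2 - s).
  by rewrite powR_scale // -(powR_mulrn 2) // ltW.
rewrite (scaled_upper t0 (powR_ge0 _ _) E1 E2 up) andbT.
exact: (scaled_lower t0 (powR_ge0 _ _) E1 E3 lo).
Qed.

End form.

(** In energy_form, F and A are chi * cos (phase) up to O(tau^-1), while the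
   quasimode is chi * cos (phase) / (sqrt(det g) * symbol). Replacing A by
   chi * cos (phase) changes the integrals by O(tau^-1), and the remainder F - A
   contributes tau^(2 s) * O(tau^-2). *)
Lemma energy_bounds (a0 eta : R) : 0 < a0 -> 0 < eta < 1 -> exists c1 c2 : R,
  forall tau w v, 1 <= tau ->
  source_to_solution g mu lam phi s i (density p0 (test chi e xi tau w), v) ->
  (1 - eta) * I (fun y => modulated tau w y * modulated tau w y * lower_symbol xi a0 y)
    - (c1 * tau^-1 + c2 * (tau ^+ 2) `^ (s - 1))
  <= (tau ^+ 2) `^ s * I (fun y => test chi e xi tau w y * v (p0 y)) <=
  (1 + eta) * I (fun y => modulated tau w y * modulated tau w y * upper_symbol xi a0 y)
    + (c1 * tau^-1 + c2 * (tau ^+ 2) `^ (s - 1)).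
Proof.
move=> a00 eta01; have [eta0 eta1] := andP eta01; have [s0 s1] := andP s01.
have [b sb bA] := quasisource_approx g aq cK KD Cchi chi0 xi0.
pose D y := \sum_j e 0 j * partial j chi y.
have sD : supp D.
  apply: supported_sum => // j; apply: (supportedZ oD); split.
    by apply: Ck_subset (Ck_partial j (Cchi 1)).
  by move=> y Ky; rewrite (partial_off j (compact_rV_closed cK) chi0 Ky).
have sachi : supp (fun y => `|chi y|) := supported_norm supp_chi.
pose e1 y := b y * `|chi y| * (kap y)^-1.
pose e2 y := b y * (2 * `|chi y| + b y) * (rho y)^-1.
pose e3 y := (`|D y| + b y) * (`|D y| + b y) * (rho y)^-1.
have se1 : supp e1.
  by apply: (supportedMr oD) => //; apply: (supportedMr oD) => //; exact: sachi.1.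
have se2 : supp e2.
  apply: (supportedMr oD) => //; apply: (supportedMr oD) => //.
  by apply: (CkD oD (k := 0)); [exact: (CkZ oD 2 sachi.1)|exact: sb.1].
have sDb : supp (fun y => `|D y| + b y) by apply: (supportedD oD) => //; exact: supported_norm.
have se3 : supp e3 by apply: (supportedMr oD) => //; apply: (supportedMr oD) => //; exact: sDb.1.
pose L := lam 1%N `^ (- s).
pose c1u := (1 + eta) * (s * a0 `^ (1 - s) * I e1 + (1 - s) * a0 `^ (- s) * I e2).
pose c1l := (1 - eta) * ((2 - s) * a0 `^ (1 - s) * I e1).
pose c2u := (1 + eta^-1) * L * I e3.
pose c2l := eta^-1 * L * I e3.
exists (`|c1u| + `|c1l|), (`|c2u| + `|c2l|) => tau w v t1 Hv.
have tau0 : 0 < tau := lt_le_trans ltr01 t1.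
have := energy_form tau0 a00 eta01 Hv.
set F := test chi e xi tau w; set A := quasisource g q chi xi tau w.
set m := modulated tau w; set qm := quasimode g q chi xi tau w.
have sF : supp F.
  by split; [exact: Ck_subset (Ck_test e xi Cchi 0 tau w)|exact: test_off].
have sA : supp A by exact: supported_quasisource.
have sm : supp m := supp_mod tau w.
have sqm : supp qm.
  split; last by move=> y; exact: quasimode_off.
  by apply: (Ck_leq oD (k := 4)) => //; exact: Ck_quasimode.
have smm : supp (fun y => m y * m y) by apply: (supportedMr oD) => //; exact: sm.1.
have sX1 : supp (fun y => m y * m y * (kap y)^-1) by exact: (supportedMr oD).
have sX2 : supp (fun y => m y * m y * (rho y)^-1) by exact: (supportedMr oD).
have sX3 : supp (fun y => m y * m y * (rho y * (kap y)^-1 ^+ 2)).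
  by apply: (supportedMr oD) => //; apply: (CkM oD (k := 0)) => //; apply: (CkM oD (k := 0)).
have sAqm : supp (fun y => A y * qm y) by apply: (supportedMr oD) => //; exact: sqm.1.
have sAA : supp (fun y => A y * A y * (rho y)^-1).
  by apply: (supportedMr oD) => //; apply: (supportedMr oD) => //; exact: sA.1.
have sZ : supp (fun y => (F y - A y) * (F y - A y) * (rho y)^-1).
  have sFA : supp (fun y => F y - A y) by exact: (supportedB oD).
  by apply: (supportedMr oD) => //; apply: (supportedMr oD) => //; exact: sFA.1.
have ti0 : 0 < tau^-1 by rewrite invr_gt0.
have ti1 : tau^-1 <= 1 by rewrite invf_le1.
have mchi y : `|m y| <= `|chi y| by rewrite normrM ler_piMr // cos_max.
have bAm y : K y -> `|A y - m y| <= tau^-1 * b y by move=> Ky; exact: bA.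
have b0 y : K y -> 0 <= b y.
  move=> Ky; have := le_trans (normr_ge0 _) (bAm y Ky).
  by rewrite pmulr_rge0.
have dXA : `|I (fun y => A y * qm y) - I (fun y => m y * m y * (kap y)^-1)| <= tau^-1 * I e1.
  apply: (dist_integral_supported oD cK KD) => // y Ky.
  have k0 : 0 <= (kap y)^-1 by rewrite invr_ge0 ltW // kap_gt0 //; exact: KD.
  have -> : A y * qm y - m y * m y * (kap y)^-1 = (A y - m y) * m y * (kap y)^-1.
    rewrite /qm /quasimode /amplitude /m /modulated.
    by move: (A y) (chi y) (cos _) (kap y)^-1 => ? ? ? ?; ring.
  rewrite normrM (ger0_norm k0) normrM /e1 !mulrA ler_wpM2r // ler_pM //; exact: bAm.
have dYA : `|I (fun y => A y * A y * (rho y)^-1) - I (fun y => m y * m y * (rho y)^-1)| <= tau^-1 * I e2.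
  apply: (dist_integral_supported oD cK KD) => // y Ky.
  have k0 : 0 <= (rho y)^-1 by rewrite invr_ge0 ltW // sqrtdet_gt0 //; exact: KD.
  have -> : A y * A y * (rho y)^-1 - m y * m y * (rho y)^-1 =
      (A y - m y) * (2 * m y + (A y - m y)) * (rho y)^-1.
    by move: (A y) (m y) (rho y)^-1 => ? ? ?; ring.
  rewrite normrM (ger0_norm k0) normrM /e2 [leRHS]mulrA [X in _ <= X * _]mulrA ler_wpM2r //.
  have bb : tau^-1 * b y <= b y by rewrite ler_piMl // b0.
  rewrite ler_pM //; first exact: bAm.
  apply: le_trans (ler_normD _ _) _; apply: lerD; last exact: le_trans (bAm y Ky) bb.
  by rewrite normrM (ger0_norm (ler0n R 2)) ler_wpM2l.
have ZE : I (fun y => (F y - A y) * (F y - A y) * (rho y)^-1) <= (tau ^+ 2)^-1 * I e3.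
  rewrite -(integralZ_supported oD cK KD) //.
  apply: (le_integral_supported oD cK KD) => //; first exact: (supportedZ oD).
  move=> y Ky; have k0 : 0 <= (rho y)^-1 by rewrite invr_ge0 ltW // sqrtdet_gt0 //; exact: KD.
  have FA : `|F y - A y| <= tau^-1 * (`|D y| + b y).
    have -> : F y - A y = (F y - m y) - (A y - m y) by ring.
    apply: le_trans (ler_normB _ _) _; rewrite mulrDr lerD ?bAm //.
    rewrite /F (testE Cchi exi) ?gt_eqF // /m /modulated addrAC subrr add0r.
    by rewrite normrM gtr0_norm // ler_wpM2l ?(ltW ti0) // normrM ler_piMr // sin_max.
  rewrite /e3 mulrA ler_wpM2r // -exprVn.
  have -> : tau^-1 ^+ 2 * ((`|D y| + b y) * (`|D y| + b y)) =
    (tau^-1 * (`|D y| + b y)) * (tau^-1 * (`|D y| + b y)).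
    by move: (tau^-1) => ?; ring.
  by rewrite -[leLHS]ger0_norm ?normrM ?ler_pM // -expr2 sqr_ge0.
have WE : I (fun y => qm y * qm y * rho y) = I (fun y => m y * m y * (rho y * (kap y)^-1 ^+ 2)).
  apply: eq_Rintegral => y _; rewrite /qm /quasimode /amplitude /m /modulated.
  by move: (chi y) (cos _) (kap y)^-1 (rho y) => ? ? ? ?; ring.
have UE : I (fun y => m y * m y * upper_symbol xi a0 y) =
    s * a0 `^ (1 - s) * I (fun y => m y * m y * (kap y)^-1) +
    (1 - s) * a0 `^ (- s) * I (fun y => m y * m y * (rho y)^-1).
  rewrite -!(integralZ_supported oD cK KD) // -(integralD_supported oD cK KD);
    [|exact: (supportedZ oD)..].
  apply: eq_Rintegral => y _; rewrite /upper_symbol.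
  by move: (m y) (kap y)^-1 (rho y)^-1 (a0 `^ (1 - s)) (a0 `^ (- s)) => ? ? ? ? ?; ring.
have LE : I (fun y => m y * m y * lower_symbol xi a0 y) =
    (2 - s) * a0 `^ (1 - s) * I (fun y => m y * m y * (kap y)^-1) -
    (1 - s) * a0 `^ (2 - s) * I (fun y => m y * m y * (rho y * (kap y)^-1 ^+ 2)).
  rewrite -mulNr -!(integralZ_supported oD cK KD) // -(integralD_supported oD cK KD);
    [|exact: (supportedZ oD)..].
  apply: eq_Rintegral => y _; rewrite /lower_symbol.
  by move: (m y) (kap y)^-1 (rho y) (a0 `^ (1 - s)) (a0 `^ (2 - s)) => ? ? ? ? ?; ring.
rewrite {}WE {}UE {}LE.
have a10 := powR_ge0 a0 (1 - s); have a20 := powR_ge0 a0 (- s).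
have L0 : 0 <= L := powR_ge0 _ _.
have T0 := powR_ge0 (tau ^+ 2) s.
have TE : (tau ^+ 2) `^ s * (tau ^+ 2)^-1 = (tau ^+ 2) `^ (s - 1).
  have t20 : 0 < tau ^+ 2 by rewrite exprn_gt0.
  by rewrite powRB ?powRr1 ?ltW //; apply/implyP => _; rewrite gt_eqF.
have TZ : (tau ^+ 2) `^ s * I (fun y => (F y - A y) * (F y - A y) * (rho y)^-1) <=
    (tau ^+ 2) `^ (s - 1) * I e3.
  by rewrite -TE -mulrA ler_wpM2l.
have cs0 := powR_ge0 (tau ^+ 2) (s - 1).
have ei0 : 0 <= eta^-1 by rewrite invr_ge0 ltW.
move: dXA dYA TZ; set XA := I (fun y => A y * qm y).
set X1 := I (fun y => m y * m y * (kap y)^-1).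
set YA := I (fun y => A y * A y * (rho y)^-1); set X2 := I (fun y => m y * m y * (rho y)^-1).
set Z := I (fun y => (F y - A y) * (F y - A y) * (rho y)^-1).
set X3 := I (fun y => m y * m y * (rho y * (kap y)^-1 ^+ 2)).
set Q := I (fun y => F y * v (p0 y)).
rewrite -/L !ler_distl => /andP[xl xu] /andP[_ yu] TZ /andP[lo up].
exact: (combine_bounds s01 eta01 ei0 L0 (ltW ti0) a10 a20 cs0 xl xu yu TZ lo up erefl erefl).
Qed.

End bounds.
End energy.

(** * Recovery of the metric *)

Section positivity.
Context (R : realType) (n : nat).

(** f is at least f c / 2 on a small cube around c, and cubes have positive
   measure. *)
Lemma integral_gt0 (f : 'rV[R]_n -> R) (K : set 'rV[R]_n) c : compact K ->
  (forall y, ~ K y -> f y = 0) -> continuous f -> (forall y, 0 <= f y) -> 0 < f c ->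
  0 < \int[leb R n]_y f y.
Proof.
move=> cK f0 cf fge fc.
have fc2 : 0 < f c / 2 by rewrite divr_gt0.
have [d d0 dP] : exists2 d : R, 0 < d & ccube c d `<=` [set y | f c / 2 <= f y].
  apply: ccube_sub_nbhs; have /cvgrPdist_le/(_ _ fc2) := cf c.
  by apply: filterS => y /=; rewrite ler_distlC => /andP[+ _]; lra.
pose F (y : borel 'rV[R]_n) : R := \1_(@cube R n d) y.
have mF : measurable_fun [set: borel 'rV[R]_n] F.
  by apply: measurable_indic; exact: measurable_cube.
pose G (y : borel 'rV[R]_n) : R := F (y - c).
have GE y : G y = (if `[< ccube c d y >] then 1 else 0).
  rewrite /G /F indicE; case: asboolP => H.
    by rewrite mem_set // => i; rewrite !mxE; exact: H.
  by rewrite memNset // => H'; apply: H => i; have := H' i; rewrite !mxE.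
have mG : measurable_fun [set: borel 'rV[R]_n] G.
  exact: (measurable_comp measurableT _ mF (@measurable_fun_shift R n (- c))).
have [r r0 Kr] := compact_in_cube (@ccube_compact R n c d).
have iG : (leb R n).-integrable setT (EFin \o G).
  apply: (@cube_integrable _ _ _ r 1) => // y; rewrite GE; case: asboolP => //.
  - by rewrite normr1.
  - by rewrite normr0.
  - by move=> /Kr.
have intG : \int[leb R n]_y G y = (d *+ 2) ^+ n.
  rewrite (Rintegral_shift (- c) mF) /Rintegral lebE; last 2 first.
  - exact/measurable_EFinP.
  - by move=> y; rewrite lee_fin /F indicE.
  by rewrite LI_cube // ltW.
have [r' r'0 Kr'] := compact_in_cube cK.
have if_ : (leb R n).-integrable setT (EFin \o f).
  by apply: (@continuous_integrable _ _ _ r') => // y ry; apply: f0 => /Kr'.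
have : f c / 2 * \int[leb R n]_y G y <= \int[leb R n]_y f y.
  rewrite -RintegralZl //; apply: le_Rintegral => //.
    have := integrableZl measurableT (f c / 2) iG.
    by apply: eq_integrable => // y _.
  move=> y _; rewrite GE; case: asboolP => H; last by rewrite mulr0.
  by rewrite mulr1; exact: dP.
apply: lt_le_trans; rewrite intG mulr_gt0 // exprn_gt0 //.
by rewrite mulrn_wgt0.
Qed.

End positivity.

Section asymptotics.
Context (R : realType) (n : nat) (O M : manifold R n) (g : metric 4 M).
Context (i : O -> M) (V : set M) (mu : borel_measure R M).
Context (lam : nat -> R) (phi : nat -> M -> R) (s : R).
Hypotheses (iV : identifies i V) (volume : is_volume g mu) (cM : compact [set: M]).
Hypotheses (spectrum : is_spectrum g mu lam phi) (s01 : 0 < s < 1).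
Variable p0 : chart R n O.
Hypothesis ap0 : atlas p0.
Local Notation q := (push i p0).
Local Notation rho := (sqrtdet g q).
Local Notation I f := (\int[leb R n]_y f y).
Variables (c e xi : 'rV[R]_n).
Hypotheses (dc : dom p0 c) (exi : \sum_j e 0 j * xi 0 j = 1).
Let aq : atlas q := push_atlas iV ap0.
Let oD : open (dom q) := dom_open aq.
Let a0 := symbol g q xi c.

(** The principal symbol at (c, xi) of the map from the coefficient functions
   of densities to solutions. *)
Definition solution_symbol : R := a0 `^ (- s) * (rho c)^-1.

Let xi0 : xi != 0 := dual_neq0 exi.

Let a00 : 0 < a0. Proof. by apply: symbol_gt0. Qed.

Let rc0 : 0 < rho c. Proof. exact: sqrtdet_gt0. Qed.

Lemma solution_symbol_gt0 : 0 < solution_symbol.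
Proof. by rewrite mulr_gt0 ?powR_gt0 ?invr_gt0. Qed.

Let upperE : upper_symbol g i s p0 xi a0 c = solution_symbol.
Proof.
have a0E : a0 `^ (1 - s) = a0 * a0 `^ (- s).
  by rewrite powRD ?powRr1 ?ltW //; apply/implyP => _; rewrite gt_eqF.
rewrite /upper_symbol /solution_symbol -/a0 a0E.
move: (a0 `^ (- s)) (rho c) rc0 a00 => x r r0 a0'.
by field; rewrite !gt_eqF.
Qed.

Let lowerE : lower_symbol g i s p0 xi a0 c = solution_symbol.
Proof.
have a0E : a0 `^ (1 - s) = a0 * a0 `^ (- s).
  by rewrite powRD ?powRr1 ?ltW //; apply/implyP => _; rewrite gt_eqF.
have a0E2 : a0 `^ (2 - s) = a0 ^+ 2 * a0 `^ (- s).
  by rewrite powRD ?(powR_mulrn 2) ?ltW //; apply/implyP => _; rewrite gt_eqF.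
rewrite /lower_symbol /solution_symbol -/a0 a0E a0E2.
move: (a0 `^ (- s)) (rho c) rc0 a00 => x r r0 a0'.
by field; rewrite !gt_eqF.
Qed.

Let Crho : Ck 0 (dom q) rho := Ck_leq oD (leq0n 4) (Ck_sqrtdet g aq).
Let Cikap : Ck 0 (dom q) (fun y => (rho y * symbol g q xi y)^-1) :=
  Ck_leq oD (leq0n 4) (Ck_invkap g aq xi0).

Let Cupper : Ck 0 (dom q) (upper_symbol g i s p0 xi a0).
Proof.
apply: (CkD oD (k := 0)); apply: (CkZ oD (k := 0)) => //.
by apply: (Ck_leq oD (k := 4)) => //; exact: Ck_invrho.
Qed.

Let Clower : Ck 0 (dom q) (lower_symbol g i s p0 xi a0).
Proof.
apply: (CkB oD (k := 0)); apply: (CkZ oD (k := 0)) => //.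
by apply: (CkM oD (k := 0)) => //; apply: (CkM oD (k := 0)).
Qed.

(** Near c the upper and lower weights are both close to solution_symbol, and
   the phases 0 and pi / 2 give the weights cos^2 and sin^2, of sum 1. *)
Lemma energy_asymptotics (eps : R) : 0 < eps ->
  exists2 r0, 0 < r0 /\ ccube c r0 `<=` dom p0 &
  forall r, 0 < r -> r <= r0 -> exists2 tau0, 1 <= tau0 & forall tau v0 v1, tau0 <= tau ->
  source_to_solution g mu lam phi s i
    (density p0 (test (bump c r) e xi tau 0), v0) ->
  source_to_solution g mu lam phi s i
    (density p0 (test (bump c r) e xi tau (pi / 2)), v1) ->
  `|(tau ^+ 2) `^ s * (I (fun y => test (bump c r) e xi tau 0 y * v0 (p0 y)) +
                       I (fun y => test (bump c r) e xi tau (pi / 2) y * v1 (p0 y)))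
    - solution_symbol * I (fun y => bump c r y * bump c r y)|
  <= eps * I (fun y => bump c r y * bump c r y).
Proof.
move=> eps0; set S := solution_symbol; have S0 : 0 < S := solution_symbol_gt0.
have eps4 : 0 < eps / 4 by rewrite divr_gt0.
have [r0 r00 r0P] : exists2 r0 : R, 0 < r0 & ccube c r0 `<=` [set y | [/\ dom q y,
    `|upper_symbol g i s p0 xi a0 c - upper_symbol g i s p0 xi a0 y| <= eps / 4 &
    `|lower_symbol g i s p0 xi a0 c - lower_symbol g i s p0 xi a0 y| <= eps / 4]].
  apply: ccube_sub_nbhs.
  have nU : nbhs c (dom q) by apply: open_nbhs_nbhs.
  have /cvgrPdist_le/(_ _ eps4) nu := Cupper dc.
  have /cvgrPdist_le/(_ _ eps4) nl := Clower dc.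
  by near=> y; split; near: y.
exists r0; first by split=> // y /r0P[].
move=> r r_0 rr0; set chi := bump c r.
pose K := ccube c r.
have KK y : K y -> ccube c r0 y by move=> Ky j; exact: le_trans (Ky j) rr0.
have cK : compact K := @ccube_compact R n c r.
have KD : K `<=` dom p0 by move=> y /KK/r0P[].
have chi0 y : ~ K y -> chi y = 0 by move=> Ky; apply: bump_eq0 => // /ball_ccube.
have Cchi k : Ck k setT chi by exact: Ck_bump.
have schi : supported (dom q) K chi by split=> //; exact: Ck_subset (Cchi 0).
have schi2 : supported (dom q) K (fun y => chi y * chi y).
  by apply: (supportedMr oD) => //; exact: schi.1.
set J := I (fun y => chi y * chi y).
have J0 : 0 < J.
  apply: (@integral_gt0 _ _ _ K c) => //.
  - exact: schi2.2.
  - exact: (supported_continuous oD cK KD schi2).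
  - by move=> y; rewrite -expr2 sqr_ge0.
  - by rewrite -expr2 exprn_gt0 //; apply: bump_gt0 => //; exact: ballxx.
(* Chosen so that (1 + eta) * (S + eps / 4) = S + eps / 2. *)
pose eta := eps / (4 * S + eps).
have den0 : 0 < 4 * S + eps by rewrite addr_gt0 // mulr_gt0.
have etaE : eta * (4 * S + eps) = eps by rewrite /eta divfK // gt_eqF.
have eta01 : 0 < eta < 1.
  by rewrite /eta divr_gt0 //= ltr_pdivrMr // mul1r ltrDr mulr_gt0.
have [c1 [c2 bounds]] := energy_bounds iV volume cM spectrum s01 ap0 cK KD Cchi chi0 exi a00 eta01.
have [s0 s1] := andP s01.
have dJ : 0 < eps / 4 * J by rewrite mulr_gt0.
have [tau0 tau01 err] := error_small c1 c2 s1 dJ.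
exists tau0 => // tau v0 v1 tt H0 H1.
have t1 : 1 <= tau := le_trans tau01 tt.
have /andP[l0 u0] := bounds tau 0 v0 t1 H0.
have /andP[l1 u1] := bounds tau (pi / 2) v1 t1 H1.
have {err} := err tau tt => err.
set er := c1 * tau^-1 + _ in err l0 l1 u0 u1.
have smod w : supported (dom q) K (modulated chi xi tau w).
  apply: (supportedMr oD) => //.
  by have [_] := Ck_sin_cos openT (Ck_phase 0 xi tau w); exact: Ck_subset.
have phases (W : 'rV[R]_n -> R) : Ck 0 (dom q) W ->
    I (fun y => modulated chi xi tau 0 y * modulated chi xi tau 0 y * W y) +
    I (fun y => modulated chi xi tau (pi / 2) y * modulated chi xi tau (pi / 2) y * W y) =
    I (fun y => chi y * chi y * W y).
  move=> CW; have sW w : supported (dom q) K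
      (fun y => modulated chi xi tau w y * modulated chi xi tau w y * W y).
    by apply: (supportedMr oD) => //; apply: (supportedMr oD) => //; exact: (smod w).1.
  rewrite -(integralD_supported oD cK KD) //; apply: eq_Rintegral => y _.
  rewrite /modulated /phase addr0 cosDpihalf; set th := tau * _.
  have := cos2Dsin2 th; move: (cos th) (sin th) => x1 x2 E.
  rewrite -[RHS]mul1r -E; move: (chi y) (W y) => ? ?; ring.
have UJ : I (fun y => chi y * chi y * upper_symbol g i s p0 xi a0 y) <= (S + eps / 4) * J.
  rewrite -(integralZ_supported oD cK KD) //; apply: (le_integral_supported oD cK KD).
  - exact: (supportedMr oD).
  - exact: (supportedZ oD).
  move=> y /KK/r0P[_ + _]; rewrite upperE -/S ler_distlC => /andP[_ yS].
  by rewrite mulrC ler_wpM2r // -expr2 sqr_ge0.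
have LJ : (S - eps / 4) * J <= I (fun y => chi y * chi y * lower_symbol g i s p0 xi a0 y).
  rewrite -(integralZ_supported oD cK KD) //; apply: (le_integral_supported oD cK KD).
  - exact: (supportedZ oD).
  - exact: (supportedMr oD).
  move=> y /KK/r0P[_ _]; rewrite lowerE -/S ler_distlC => /andP[yS _].
  by rewrite [leRHS]mulrC ler_wpM2r // -expr2 sqr_ge0.
rewrite -(phases _ Cupper) in UJ; rewrite -(phases _ Clower) in LJ.
have [eta0 eta1] := andP eta01.
have etaSJ : eta * S * J = (eps - eta * eps) / 4 * J.
  by congr (_ * J); have := etaE; lra.
have etaeJ : 0 <= eta * eps * J.
  exact: mulr_ge0 (mulr_ge0 (ltW eta0) (ltW eps0)) (ltW J0).
have UU : (1 + eta) * (I (fun y => modulated chi xi tau 0 y * modulated chi xi tau 0 y * upper_symbol g i s p0 xi a0 y) +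
    I (fun y => modulated chi xi tau (pi / 2) y * modulated chi xi tau (pi / 2) y * upper_symbol g i s p0 xi a0 y))
    <= S * J + eps / 2 * J.
  apply: le_trans (ler_wpM2l _ UJ) _; first by rewrite addr_ge0 // ltW.
  by move: etaSJ; nra.
have LL : S * J - eps / 2 * J <= (1 - eta) * (I (fun y => modulated chi xi tau 0 y * modulated chi xi tau 0 y * lower_symbol g i s p0 xi a0 y) +
    I (fun y => modulated chi xi tau (pi / 2) y * modulated chi xi tau (pi / 2) y * lower_symbol g i s p0 xi a0 y)).
  apply: le_trans _ (ler_wpM2l _ LJ); last by rewrite subr_ge0 ltW.
  by move: etaSJ etaeJ; nra.
move: l0 l1 u0 u1 UU LL.
set L0 := I (fun y => modulated chi xi tau 0 y * modulated chi xi tau 0 y * lower_symbol g i s p0 xi a0 y).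
set L1 := I (fun y => modulated chi xi tau (pi / 2) y * modulated chi xi tau (pi / 2) y * lower_symbol g i s p0 xi a0 y).
set U0 := I (fun y => modulated chi xi tau 0 y * modulated chi xi tau 0 y * upper_symbol g i s p0 xi a0 y).
set U1 := I (fun y => modulated chi xi tau (pi / 2) y * modulated chi xi tau (pi / 2) y * upper_symbol g i s p0 xi a0 y).
set E0 := I (fun y => test chi e xi tau 0 y * v0 (p0 y)).
set E1 := I (fun y => test chi e xi tau (pi / 2) y * v1 (p0 y)).
move: (_ `^ s) E0 E1 U0 U1 L0 L1 er err => T E0 E1 U0 U1 L0 L1 er err l0 l1 u0 u1 UU LL.
rewrite ler_distl mulrDr; apply/andP; split; lra.
Unshelve. all: by end_near. Qed.

End asymptotics.

Section conformal.
Variable R : realType.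

(** Polarization. *)
Lemma form0_sym n (A : 'M[R]_n) : A^T = A -> (forall x : 'rV_n, (x *m A *m x^T) 0 0 = 0) -> A = 0.
Proof.
move=> sA A0; apply/matrixP => a b; rewrite [RHS]mxE.
pose B (x y : 'rV[R]_n) := (x *m A *m y^T) 0 0.
have BC x y : B x y = B y x.
  have E : (x *m A *m y^T)^T = y *m A *m x^T by rewrite !trmx_mul trmxK sA mulmxA.
  by rewrite /B -E [RHS]mxE.
have B0 x y : B x y = 0.
  have := A0 (x + y); rewrite linearD /= !mulmxDl !mulmxDr.
  rewrite mxE [X in X + _]mxE [X in _ + X]mxE.
  rewrite -!/(B _ _) /B !A0 -!/(B _ _) (BC y x) add0r addr0 => H.
  by move: H; lra.
have := B0 (delta_mx 0 a) (delta_mx 0 b).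
by rewrite /B trmx_delta -rowE -colE !mxE.
Qed.

(** Writing a for the cotangent norm squared and d for the volume density, the
   hypothesis is a1^(-s) / d1 = a2^(-s) / d2. Hence a1 = k * a2 with k^s = d2
   / d1, so the metrics are conformal. Comparing determinants, k^(2 s) = k^n,
   and k = 1 because 2 s < n. *)
Lemma metric_of_symbol n (G1 G2 : 'M[R]_n) (s : R) : (2 <= n)%N -> 0 < s < 1 ->
  G1^T = G1 -> G2^T = G2 -> posdef G1 -> posdef G2 ->
  (forall x : 'rV_n, x != 0 ->
    ((x *m invmx G1 *m x^T) 0 0) `^ (- s) * (Num.sqrt (\det G1))^-1 =
    ((x *m invmx G2 *m x^T) 0 0) `^ (- s) * (Num.sqrt (\det G2))^-1) ->
  G1 = G2.
Proof.
move=> n2 /andP[s0 s1] sG1 sG2 pG1 pG2 H.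
have dG1 := posdef_det pG1; have dG2 := posdef_det pG2.
set d1 := Num.sqrt (\det G1) in H; set d2 := Num.sqrt (\det G2) in H.
have d10 : 0 < d1 by rewrite sqrtr_gt0.
have d20 : 0 < d2 by rewrite sqrtr_gt0.
pose k := (d2 / d1) `^ s^-1.
have k0 : 0 < k by rewrite powR_gt0 // divr_gt0.
have ks : k `^ s = d2 / d1.
  by rewrite /k -powRrM mulVf ?powRr1 // ?gt_eqF // divr_ge0 // ltW.
have E (x : 'rV[R]_n) : (x *m invmx G1 *m x^T) 0 0 = k * (x *m invmx G2 *m x^T) 0 0.
  have [->|x0] := eqVneq x 0; first by rewrite !mul0mx mxE mulr0.
  have := H x x0; have := posdef_inv sG1 pG1 x0; have := posdef_inv sG2 pG2 x0.
  set a1 := (x *m invmx G1 *m _) 0 0; set a2 := (_ *m _) 0 0 => a20 a10.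
  rewrite !powRN -!invfM => /invr_inj Ea.
  have Es : a1 `^ s = (k * a2) `^ s.
    have d1n : d1 != 0 by rewrite gt_eqF.
    by rewrite powRM ?ltW // ks; apply: (mulIf d1n); rewrite Ea mulrAC divfK // mulrC.
  have := congr1 (fun z => z `^ s^-1) Es; rewrite -!powRrM divff ?gt_eqF // !powRr1 ?ltW //.
  by rewrite mulr_gt0.
have EI : invmx G1 = k *: invmx G2.
  apply/eqP; rewrite -subr_eq0; apply/eqP; apply: form0_sym.
    by rewrite linearB /= linearZ /= !invmx_sym.
  move=> x; rewrite mulmxBr mulmxBl -scalemxAr -scalemxAl mxE [X in _ + X]mxE [X in - X]mxE.
  by rewrite E subrr.
have G2E : G2 = k *: G1.
  have u1 := posdef_unitmx pG1; have u2 := posdef_unitmx pG2.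
  have : G2 *m (invmx G1 *m G1) = G2 by rewrite mulVmx // mulmx1.
  by rewrite EI -scalemxAl -scalemxAr mulmxA mulmxV // mul1mx => <-.
have kn : k ^+ n = k `^ (2 * s).
  have detE : \det G2 = k ^+ n * \det G1 by rewrite G2E detZ.
  rewrite mulrC powRrM ks powR_mulrn ?divr_ge0 ?ltW // expr_div_n.
  by rewrite !sqr_sqrtr ?ltW // detE mulfK // gt_eqF.
have k1 : k = 1.
  have : ln (k ^+ n) = ln (k `^ (2 * s)) by rewrite kn.
  rewrite lnXn // ln_powR => Hl.
  have : ln k = 0.
    have n2s : n%:R - 2 * s != 0.
      by rewrite gt_eqF // subr_gt0 (@lt_le_trans _ _ 2) // ?ler_nat //; lra.
    apply: (mulfI n2s); rewrite mulr0 mulrBl -Hl mulr_natl subrr //.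
  by move/eqP; rewrite ln_eq0 // => /eqP.
by rewrite G2E k1 scale1r.
Qed.

End conformal.

(** The energies of the test sources are the same for both metrics, hence so
   are their asymptotics. *)
Lemma solution_symbol_eq (R : realType) (s : R) (n : nat) (s01 : 0 < s < 1)
  (M1 M2 : manifold R n) (cM1 : compact [set: M1]) (cM2 : compact [set: M2])
  (g1 : metric 4 M1) (g2 : metric 4 M2) (V1 : set M1) (V2 : set M2)
  (O : manifold R n) (i1 : O -> M1) (i2 : O -> M2)
  (iV1 : identifies i1 V1) (iV2 : identifies i2 V2)
  (mu1 : borel_measure R M1) (mu2 : borel_measure R M2)
  (volume1 : is_volume g1 mu1) (volume2 : is_volume g2 mu2)
  (lam1 lam2 : nat -> R) (phi1 : nat -> M1 -> R) (phi2 : nat -> M2 -> R)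
  (spectrum1 : is_spectrum g1 mu1 lam1 phi1)
  (spectrum2 : is_spectrum g2 mu2 lam2 phi2)
  (same : source_to_solution g1 mu1 lam1 phi1 s i1 =
          source_to_solution g2 mu2 lam2 phi2 s i2)
  (p : chart R n O) (ap : atlas p) (c e xi : 'rV[R]_n) (dc : dom p c)
  (exi : \sum_j e 0 j * xi 0 j = 1) :
  solution_symbol g1 i1 s p c xi = solution_symbol g2 i2 s p c xi.
Proof.
apply/eqP; apply: contraT => S12.
set S1 := solution_symbol _ _ _ _ _ _ in S12; set S2 := solution_symbol _ _ _ _ _ _ in S12.
pose eps := `|S1 - S2| / 3.
have eps0 : 0 < eps by rewrite divr_gt0 // normr_gt0 subr_eq0.
have [r1 [r10 r1D] H1] :=
  energy_asymptotics iV1 volume1 cM1 spectrum1 s01 ap dc exi eps0.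
have [r2 [r20 r2D] H2] :=
  energy_asymptotics iV2 volume2 cM2 spectrum2 s01 ap dc exi eps0.
pose r := Num.min r1 r2.
have r0 : 0 < r by rewrite lt_min r10.
have [rr1 rr2] : r <= r1 /\ r <= r2 by rewrite !ge_min !lexx orbT.
have [tau1 t11 A1] := H1 r r0 rr1; have [tau2 t21 A2] := H2 r r0 rr2.
pose tau := Num.max tau1 tau2.
have [tt1 tt2] : tau1 <= tau /\ tau2 <= tau by rewrite !le_max !lexx orbT.
have cK : compact (ccube c r) := @ccube_compact R n c r.
have KD : ccube c r `<=` dom p.
  by move=> y Ky; apply: r1D => j; exact: le_trans (Ky j) rr1.
have chi0 y : ~ ccube c r y -> bump c r y = 0.
  by move=> Ky; apply: bump_eq0 => // /ball_ccube.
have Cchi k : Ck k setT (bump c r) by exact: Ck_bump.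
have sol w : exists v, source_to_solution g1 mu1 lam1 phi1 s i1
    (density p (test (bump c r) e xi tau w), v).
  apply: (source_to_solution_exists iV1 ap cK KD _ _ volume1 cM1 spectrum1 s01).
  - by move=> y; exact: test_off.
  - by move=> k; exact: Ck_test.
  - exact: (integral_test e xi Cchi cK chi0).
have [v0 Hv0] := sol 0; have [v1 Hv1] := sol (pi / 2).
have B1 := A1 tau v0 v1 tt1 Hv0 Hv1.
rewrite same in Hv0 Hv1; have B2 := A2 tau v0 v1 tt2 Hv0 Hv1.
have J0 : 0 < \int[leb R n]_y (bump c r y * bump c r y).
  have cb : continuous (fun y => bump c r y * bump c r y).
    by move=> y; exact: (continuousM (Cchi 0%N y I) (Cchi 0%N y I)).
  apply: (integral_gt0 (c := c) cK _ cb).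
  - by move=> y Ky; rewrite chi0 // mul0r.
  - by move=> y; rewrite -expr2 sqr_ge0.
  - by rewrite -expr2 exprn_gt0 //; apply: bump_gt0 => //; exact: ballxx.
move: B1 B2; rewrite -/S1 -/S2; set E := (_ `^ s) * _; set J := \int[_]_y _ in J0 *.
move=> B1 B2; have : `|S1 - S2| * J <= 2 * eps * J.
  rewrite -[J in leLHS]gtr0_norm // -normrM.
  have -> : (S1 - S2) * J = (E - S2 * J) - (E - S1 * J) by ring.
  by apply: le_trans (ler_normB _ _) _; move: B1 B2; lra.
rewrite ler_pM2r // /eps; have : 0 < `|S1 - S2| by rewrite normr_gt0 subr_eq0.
lra.
Qed.

Theorem corollary1p1 (R : realType) (s : R) (n : nat)
  (hs : 0 < s < 1) (hn : (2 <= n)%N)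
  (M1 M2 : manifold R n)
  (M1_compact : compact [set: M1]) (M2_compact : compact [set: M2])
  (M1_connected : connected [set: M1]) (M2_connected : connected [set: M2])
  (g1 : metric 4 M1) (g2 : metric 4 M2)
  (O1 : set M1) (O2 : set M2)
  (O1_open : open O1) (O2_open : open O2)
  (O1_nonempty : O1 !=set0) (O2_nonempty : O2 !=set0)
  (O : manifold R n) (i1 : O -> M1) (i2 : O -> M2)
  (OO1 : identifies i1 O1) (OO2 : identifies i2 O2)
  (mu1 : borel_measure R M1) (mu2 : borel_measure R M2)
  (mu1_volume : is_volume g1 mu1) (mu2_volume : is_volume g2 mu2)
  (lambda1 lambda2 : nat -> R) (phi1 : nat -> M1 -> R) (phi2 : nat -> M2 -> R)
  (spectrum1 : is_spectrum g1 mu1 lambda1 phi1)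
  (spectrum2 : is_spectrum g2 mu2 lambda2 phi2)
  (same_operator : source_to_solution g1 mu1 lambda1 phi1 s i1 =
                   source_to_solution g2 mu2 lambda2 phi2 s i2) :
  forall p : chart R n O, atlas p -> forall y : 'rV[R]_n, dom p y ->
    restrict_metric i1 g1 p y = restrict_metric i2 g2 p y.
Proof.
move=> p ap y dy; rewrite /restrict_metric.
have aq1 := push_atlas OO1 ap; have aq2 := push_atlas OO2 ap.
apply: (metric_of_symbol hn hs).
- exact: (gmat_sym g1 aq1 dy).
- exact: (gmat_sym g2 aq2 dy).
- exact: (gmat_posdef g1 aq1 dy).
- exact: (gmat_posdef g2 aq2 dy).
move=> x x0; have xx := mul_rV_tr_ge0 x0.
pose e := ((x *m x^T) 0 0)^-1 *: x.
have xE : (x *m x^T) 0 0 = \sum_j x 0 j * x 0 j.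
  by rewrite mxE; apply: eq_bigr => j _; rewrite mxE.
have eE j : e 0 j = ((x *m x^T) 0 0)^-1 * x 0 j by rewrite [LHS]mxE.
have ex : \sum_j e 0 j * x 0 j = 1.
  under eq_bigr do rewrite eE -mulrA.
  by rewrite -mulr_sumr -xE mulVf // gt_eqF.
have := solution_symbol_eq hs M1_compact M2_compact OO1 OO2 mu1_volume mu2_volume
  spectrum1 spectrum2 same_operator ap dy ex.
by rewrite /solution_symbol !symbolE.
Qed.
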